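(* Let $F$ be a maximal abelian subgroup of $G=\mathrm{Sp}(n)/\langle -I\rangle$, with associated function $m$, integers $k,s_0,s_1$ and maps $\vec\mu=(\mu_1,\dots,\mu_{s_0})$ (unordered), and let $W(F)=N_G(F)/C_G(F)$. There is an exact sequence $$1\longrightarrow \mathrm{Hom}(F/\ker m,B_F)\rtimes S_{\vec\mu}\longrightarrow W(F)\longrightarrow \mathrm{Aut}(F/\ker m,m,\vec\mu)\times\bigl(\{\pm1\}^{s_1}\rtimes S_{s_1}\bigr)\longrightarrow 1.$$
   Context: Let $n\ge1$, $\mathrm{Sp}(n)=\{X\in M_n(\mathbb H):XX^*=I\}$, $G=\mathrm{Sp}(n)/\langle -I\rangle$ and $\pi:\mathrm{Sp}(n)\to G$ the projection; $[A]=\pi(A)$. For a closed abelian subgroup $F\subset G$, define $m:F\times F\to\{\pm1\}$ by $m([A],[B])=\lambda$ where $ABA^{-1}B^{-1}=\lambda I$; let $\ker m=\{x\in F:m(x,y)=1\ \forall y\in F\}$, so $F/\ker m$ is an $\mathbb F_2$-vector space to which $m$ descends, and let $k=\frac12\mathrm{rank}(F/\ker m)$. Let $B_F=\{x\in\ker m: A^2=I\ \forall A\in\pi^{-1}(x)\}$. Every maximal abelian subgroup $F$ satisfies $\dim\mathfrak g_0^F=\dim F$ ($\mathfrak g_0$ the Lie algebra of $G$, fixed vectors under the adjoint action), and then: $\pi^{-1}(B_F)$ is commutative and consists of involutions and the identity; let $\mathbb H^n=V_1\oplus\cdots\oplus V_s$ be the decomposition of the right $\mathbb H$-module $\mathbb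 H^n$ into its distinct nonzero simultaneous eigenspaces (eigenvalues $\pm1$); each $\dim_{\mathbb H}V_i$ is $2^{k-1}$ or $2^k$; order them so that $\dim_{\mathbb H}V_i=2^{k-1}$ for $1\le i\le s_0$ and $2^k$ for $s_0<i\le s$, and put $s_1=s-s_0$, so $n=2^{k-1}s_0+2^ks_1$. (If $k=0$, then $F$ is a maximal torus, $s_0=0$ and $s_1=n$.) Every $A\in\pi^{-1}(F)$ preserves each $V_i$, and for $1\le i\le s_0$, $(A|_{V_i})^2=\mu_i([A])\mathrm{id}$ with $\mu_i([A])\in\{\pm1\}$; $\mu_i$ descends to $F/\ker m$. For a map $\mu:F\to\{\pm1\}$ let $a_\mu$ be the number of $i\in\{1,\dots,s_0\}$ with $\mu_i=\mu$, and $S_{\vec\mu}=\prod_\mu S_{a_\mu}$, regarded as the group of permutations $\sigma$ of $\{1,\dots,s_0\}$ with $\mu_{\sigma(i)}=\mu_i$. For $F$ maximal abelian, $\pi^{-1}(B_F)=\{\sum_i\varepsilon_i\mathrm{id}_{V_i}:\varepsilon_i=\pm1\}$, and $S_{\vec\mu}$ acts on $B_F$ (hence on $\mathrm{Hom}(F/\ker m,B_F)$) by permuting the coordinates $\varepsilon_1,\dots,\varepsilon_{s_0}$. $\mathrm{Aut}(F/\ker m,m,\vec\mu)$ is the group of linear automorphisms $f$ of $F/\ker m$ preserving $m$ and such that, for some permutation $\rho$ of $\{1,\dots,s_0\}$, $\mu_{\rho(i)}\circ f=\mu_i$ for all $i$. $S_{s_1}$ acts on $\{\pm1\}^{s_1}$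 by permuting coordinates. *)

(* Defs.v *)
From HB Require Import structures.
From mathcomp Require Import all_boot all_order all_algebra all_fingroup.
From mathcomp Require Import generic_quotient.
From mathcomp Require Import ring.
From mathcomp Require Import mathcomp_extra boolp classical_sets reals.

Set Implicit Arguments.
Unset Strict Implicit.
Unset Printing Implicit Defensive.

Import GRing.Theory.

Local Open Scope classical_set_scope.
Local Open Scope quotient_scope.
Local Open Scope group_scope.

Definition gsub (T : groupType) (S : groupClosed T) : Type := {x : T | x \in S}.

Section SubgroupType.
Variables (T : groupType) (S : groupClosed T).

HB.instance Definition _ := SubChoice.copy (gsub S) {x : T | x \in S}.

Lemma gsub_closed : group_closed S.
Proof.
split=> [|x y Sx Sy]; first exact: gpred1.
by apply: gpredM => //; apply: gpredVr.
Qed.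

HB.instance Definition _ :=
  SubChoice_isSubGroup.Build T (mem S) (gsub S) gsub_closed.

End SubgroupType.

Structure abelian_subgroup (T : groupType) := AbelianSubgroup {
  abg_set :> groupClosed T;
  abgC : {in abg_set &, forall x y, x * y = y * x}
}.

Definition maximal_abelian (T : groupType) (F : abelian_subgroup T) : Prop :=
  forall F' : abelian_subgroup T, {subset F <= F'} -> {subset F' <= F}.

Structure normal_subgroup (T : groupType) := NormalSubgroup {
  nsg_set :> groupClosed T;
  nsgJ : forall x y, x \in nsg_set -> x ^ y \in nsg_set
}.

Section Quotient.
Variables (T : groupType) (N : normal_subgroup T).

Definition coset_rel : rel T := fun x y => x^-1 * y \in (N : groupClosed T).

Lemma coset_rel_refl : reflexive coset_rel.
Proof. by move=> x; rewrite /coset_rel mulVg gpred1. Qed.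

Lemma coset_rel_sym : symmetric coset_rel.
Proof.
by move=> x y; apply/idP/idP=> /gpredVr; rewrite /coset_rel invgM invgK.
Qed.

Lemma coset_rel_trans : transitive coset_rel.
Proof.
move=> y x z xy yz; have := gpredM _ _ xy yz.
by rewrite /coset_rel mulgA mulgK.
Qed.

Canonical coset_equiv :=
  EquivRel coset_rel coset_rel_refl coset_rel_sym coset_rel_trans.

Definition gquot : Type := {eq_quot coset_equiv}.
HB.instance Definition _ := Choice.on gquot.
HB.instance Definition _ := EqQuotient.on gquot.

Definition gquot_mul (x y : gquot) : gquot := \pi_gquot (repr x * repr y).
Definition gquot_one : gquot := \pi_gquot 1.
Definition gquot_inv (x : gquot) : gquot := \pi_gquot (repr x)^-1.

Lemma gquotP (x y : T) :
  reflect (\pi_gquot x = \pi_gquot y) (x^-1 * y \in (N : groupClosed T)).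
Proof. exact: (@eqmodP _ coset_equiv). Qed.

Lemma gquot_mulE x y : \pi_gquot (x * y) = gquot_mul (\pi x) (\pi y).
Proof.
apply/gquotP; rewrite invgM -mulgA (mulgA x^-1).
have /gquotP Nx : \pi_gquot x = \pi_gquot (repr (\pi_gquot x)) by rewrite reprK.
have /gquotP Ny : \pi_gquot y = \pi_gquot (repr (\pi_gquot y)) by rewrite reprK.
set x' := repr _ in Nx *; set y' := repr _ in Ny *.
have -> : y^-1 * (x^-1 * x' * y') = (x^-1 * x') ^ y * (y^-1 * y').
  by rewrite conjgE !mulgA mulgK.
by apply: gpredM; [apply: nsgJ; apply: Nx|apply: Ny].
Qed.

Lemma gquot_ind (P : gquot -> Prop) : (forall x, P (\pi_gquot x)) -> forall c, P c.
Proof. by move=> Ppi c; rewrite -[c]reprK. Qed.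

Lemma gquot_mulA : associative gquot_mul.
Proof.
elim/gquot_ind=> x; elim/gquot_ind=> y; elim/gquot_ind=> z.
by rewrite -(gquot_mulE y z) -(gquot_mulE x y) -!gquot_mulE mulgA.
Qed.

Lemma gquot_mul1 : left_id gquot_one gquot_mul.
Proof. by elim/gquot_ind=> x; rewrite -gquot_mulE mul1g. Qed.

Lemma gquot_mulr1 : right_id gquot_one gquot_mul.
Proof. by elim/gquot_ind=> x; rewrite -gquot_mulE mulg1. Qed.

Lemma gquot_mulV : left_inverse gquot_one gquot_inv gquot_mul.
Proof. by move=> c; rewrite -[c in gquot_mul _ c]reprK -gquot_mulE mulVg. Qed.

Lemma gquot_mulrV : right_inverse gquot_one gquot_inv gquot_mul.
Proof. by move=> c; rewrite -[c in gquot_mul c _]reprK -gquot_mulE mulgV. Qed.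

HB.instance Definition _ := isGroup.Build gquot
  gquot_mulA gquot_mul1 gquot_mulr1 gquot_mulV gquot_mulrV.

Lemma gquot_piM (x y : T) : \pi_gquot (x * y) = \pi_gquot x * \pi_gquot y.
Proof. exact: gquot_mulE. Qed.

Lemma gquot_pi1 : \pi_gquot 1 = 1.
Proof. by []. Qed.

Lemma gquot_piV (x : T) : \pi_gquot x^-1 = (\pi_gquot x)^-1.
Proof.
by apply: (mulgI (\pi_gquot x)); rewrite -gquot_piM !mulgV gquot_pi1.
Qed.

Lemma gquot_piF (x y : T) : \pi_gquot (x * y^-1) = \pi_gquot x * (\pi_gquot y)^-1.
Proof. by rewrite gquot_piM gquot_piV. Qed.

End Quotient.

Section NormaliserQuotient.
Variables (T : groupType) (S : groupClosed T).

Definition norm_pred : {pred T} :=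
  fun x => `[< forall y, (y ^ x \in S) = (y \in S) >].

Lemma norm_closed : group_closed norm_pred.
Proof.
split=> [|x z /asboolP Nx /asboolP Nz]; apply/asboolP=> y; rewrite ?conjg1 //.
by rewrite conjgM -(Nz ((y ^ x) ^ z^-1)) conjgKV Nx.
Qed.

HB.instance Definition _ :=
  isMulClosed.Build T norm_pred (group_closedM norm_closed).
HB.instance Definition _ := isMul1Closed.Build T norm_pred (fst norm_closed).
HB.instance Definition _ :=
  isInvClosed.Build T norm_pred (group_closedV norm_closed).

Definition normaliser : groupClosed T := norm_pred.

Definition cent_pred : {pred gsub normaliser} :=
  fun x => `[< forall y, y \in S -> y ^ val x = y >].

Lemma cent_closed : group_closed cent_pred.
Proof.
split=> [|x z /asboolP Cx /asboolP Cz]; apply/asboolP=> y Sy.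
  by rewrite val1 conjg1.
by rewrite gmulfF conjgM Cx // -{1}[y]Cz // conjgK.
Qed.

HB.instance Definition _ :=
  isMulClosed.Build _ cent_pred (group_closedM cent_closed).
HB.instance Definition _ := isMul1Closed.Build _ cent_pred (fst cent_closed).
HB.instance Definition _ :=
  isInvClosed.Build _ cent_pred (group_closedV cent_closed).

Lemma cent_normal x y : x \in cent_pred -> x ^ y \in cent_pred.
Proof.
move=> /asboolP Cx; apply/asboolP=> z Sz; rewrite gmulfJ.
have /asboolP Ny := valP y.
rewrite /= -[z in LHS](conjgKV (val y)) -conjJg Cx ?conjgKV //.
by rewrite -Ny conjgKV.
Qed.

Definition centraliser : normal_subgroup (gsub normaliser) :=
  NormalSubgroup cent_normal.

Definition weyl_group : groupType := gquot centraliser.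

End NormaliserQuotient.

(** The multiplicative group {1, -1}: [b] stands for (-1)^b, so that the unit
    is [false]. *)
Definition sign : Type := bool.
HB.instance Definition _ := Finite.on sign.
HB.instance Definition _ :=
  isGroup.Build sign addbA addFb addbF addbb addbb.
Definition sgnN : sign := true.

(** [V], written multiplicatively, is an F_2-vector space of dimension [d]. *)
Definition F2_rank (V : groupType) (d : nat) : Prop :=
  exists f : {multiplicative {ffun 'I_d -> sign} -> V}, bijective f.

Section HomGroup.
Variables (Q T : groupType) (B : abelian_subgroup T).

Definition hom_pred : pred (Q -> gsub B) :=
  fun f => `[< {morph f : x y / x * y} >].

Definition ghom : Type := {f : Q -> gsub B | hom_pred f}.
HB.instance Definition _ := SubChoice.copy ghom {f : Q -> gsub B | hom_pred f}.

Lemma gsub_abgC (x y : gsub B) : x * y = y * x.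
Proof. by apply/val_inj; rewrite !valM (abgC (valP x) (valP y)). Qed.

Lemma hom1P : hom_pred (fun=> 1).
Proof. by apply/asboolP=> x y; rewrite mulg1. Qed.

Lemma homMP (f g : ghom) : hom_pred (fun x => val f x * val g x).
Proof.
apply/asboolP=> x y; have /asboolP-> := valP f; have /asboolP-> := valP g.
by rewrite -!mulgA; congr (_ * _); rewrite !mulgA [_ * val g x]gsub_abgC.
Qed.

Lemma homVP (f : ghom) : hom_pred (fun x => (val f x)^-1).
Proof.
apply/asboolP=> x y; have /asboolP-> := valP f.
by rewrite invgM gsub_abgC.
Qed.

Definition hom_one : ghom := exist hom_pred _ hom1P.
Definition hom_mul (f g : ghom) : ghom := exist hom_pred _ (homMP f g).
Definition hom_inv (f : ghom) : ghom := exist hom_pred _ (homVP f).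

Lemma hom_mulA : associative hom_mul.
Proof. by move=> f g h; apply/val_inj/funext=> x; apply: mulgA. Qed.
Lemma hom_mul1 : left_id hom_one hom_mul.
Proof. by move=> f; apply/val_inj/funext=> x; apply: mul1g. Qed.
Lemma hom_mulr1 : right_id hom_one hom_mul.
Proof. by move=> f; apply/val_inj/funext=> x; apply: mulg1. Qed.
Lemma hom_mulV : left_inverse hom_one hom_inv hom_mul.
Proof. by move=> f; apply/val_inj/funext=> x; apply: mulVg. Qed.
Lemma hom_mulrV : right_inverse hom_one hom_inv hom_mul.
Proof. by move=> f; apply/val_inj/funext=> x; apply: mulgV. Qed.

HB.instance Definition _ := isGroup.Build ghom
  hom_mulA hom_mul1 hom_mulr1 hom_mulV hom_mulrV.

End HomGroup.

(** Automorphisms are stored with their inverse; [f * g] is [f \o g]. *)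
Section AutGroup.
Variable Q : groupType.

Definition aut_pred : pred ((Q -> Q) * (Q -> Q)) := fun p =>
  `[< [/\ cancel p.1 p.2, cancel p.2 p.1 & {morph p.1 : x y / x * y}] >].

Definition gaut : Type := {p : (Q -> Q) * (Q -> Q) | aut_pred p}.
HB.instance Definition _ :=
  SubChoice.copy gaut {p : (Q -> Q) * (Q -> Q) | aut_pred p}.

Definition aut_fun (f : gaut) : Q -> Q := (val f).1.

Lemma aut1P : aut_pred (id, id).
Proof. exact/asboolP. Qed.

Lemma autMP (f g : gaut) :
  aut_pred ((val f).1 \o (val g).1, (val g).2 \o (val f).2).
Proof.
have /asboolP[fK fK' fM] := valP f; have /asboolP[gK gK' gM] := valP g.
apply/asboolP; split=> [||x y /=]; [exact: can_comp|exact: can_comp|].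
by rewrite gM fM.
Qed.

Lemma autVP (f : gaut) : aut_pred ((val f).2, (val f).1).
Proof.
have /asboolP[fK fK' fM] := valP f; apply/asboolP; split=> // x y /=.
by apply: (canLR fK); rewrite fM !fK'.
Qed.

Definition aut_one : gaut := exist aut_pred _ aut1P.
Definition aut_mul (f g : gaut) : gaut := exist aut_pred _ (autMP f g).
Definition aut_inv (f : gaut) : gaut := exist aut_pred _ (autVP f).

Lemma aut_mulA : associative aut_mul.
Proof. by move=> f g h; apply/val_inj. Qed.
Lemma aut_mul1 : left_id aut_one aut_mul.
Proof. by move=> f; apply/val_inj; rewrite /=; case: (val f). Qed.
Lemma aut_mulr1 : right_id aut_one aut_mul.
Proof. by move=> f; apply/val_inj; rewrite /=; case: (val f). Qed.
Lemma aut_mulV : left_inverse aut_one aut_inv aut_mul.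
Proof.
move=> f; have /asboolP[fK fK' _] := valP f.
by apply/val_inj; congr pair; apply/funext=> x /=; rewrite fK.
Qed.
Lemma aut_mulrV : right_inverse aut_one aut_inv aut_mul.
Proof.
move=> f; have /asboolP[fK fK' _] := valP f.
by apply/val_inj; congr pair; apply/funext=> x /=; rewrite fK'.
Qed.

HB.instance Definition _ := isGroup.Build gaut
  aut_mulA aut_mul1 aut_mulr1 aut_mulV aut_mulrV.

End AutGroup.

Structure gaction (H N : groupType) := GAction {
  gact :> H -> N -> N;
  gact_morph : forall h, {morph gact h : x y / x * y};
  gact1 : forall x, gact 1 x = x;
  gactM : forall h h' x, gact (h * h') x = gact h (gact h' x)
}.

Record semidirect (H N : groupType) (a : gaction H N) : Type := Semidirect {
  sd_left : N;
  sd_right : H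
}.

Section Semidirect.
Variables (H N : groupType) (a : gaction H N).

Definition sd_pair (u : semidirect a) : N * H := (sd_left u, sd_right u).
Definition pair_sd (p : N * H) : semidirect a := Semidirect a p.1 p.2.

Lemma sd_pairK : cancel sd_pair pair_sd.
Proof. by case. Qed.

HB.instance Definition _ := Choice.copy (semidirect a) (can_type sd_pairK).

Definition sd_mul (u v : semidirect a) : semidirect a :=
  Semidirect a (sd_left u * a (sd_right u) (sd_left v))
               (sd_right u * sd_right v).
Definition sd_one : semidirect a := Semidirect a 1 1.
Definition sd_inv (u : semidirect a) : semidirect a :=
  Semidirect a (a (sd_right u)^-1 (sd_left u)^-1) (sd_right u)^-1.

Lemma gact_1 h : a h 1 = 1.
Proof. by apply: (mulgI (a h 1)); rewrite -gact_morph !mulg1. Qed.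

Lemma sd_mulA : associative sd_mul.
Proof.
by move=> u v w; rewrite /sd_mul /= gact_morph gactM !mulgA.
Qed.
Lemma sd_mul1 : left_id sd_one sd_mul.
Proof. by case=> x h; rewrite /sd_mul /= gact1 !mul1g. Qed.
Lemma sd_mulr1 : right_id sd_one sd_mul.
Proof. by case=> x h; rewrite /sd_mul /= gact_1 !mulg1. Qed.
Lemma sd_mulV : left_inverse sd_one sd_inv sd_mul.
Proof.
by case=> x h; rewrite /sd_mul /= -gact_morph !mulVg gact_1.
Qed.
Lemma sd_mulrV : right_inverse sd_one sd_inv sd_mul.
Proof.
by case=> x h; rewrite /sd_mul /= -gactM !mulgV gact1 mulgV.
Qed.

HB.instance Definition _ := isGroup.Build (semidirect a)
  sd_mulA sd_mul1 sd_mulr1 sd_mulV sd_mulrV.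

End Semidirect.

Section HomAction.
Variables (Q T H : groupType) (B : abelian_subgroup T) (a : gaction H (gsub B)).

Lemma hom_actP h (f : ghom Q B) : hom_pred (fun x => a h (val f x)).
Proof.
by apply/asboolP=> x y; have /asboolP-> := valP f; rewrite gact_morph.
Qed.

Definition hom_act h (f : ghom Q B) : ghom Q B :=
  exist (@hom_pred Q T B) _ (hom_actP h f).

Lemma hom_act_morph h : {morph hom_act h : f g / f * g}.
Proof. by move=> f g; apply/val_inj/funext=> x /=; rewrite gact_morph. Qed.
Lemma hom_act1 f : hom_act 1 f = f.
Proof. by apply/val_inj/funext=> x /=; rewrite gact1. Qed.
Lemma hom_actM h h' f : hom_act (h * h') f = hom_act h (hom_act h' f).
Proof. by apply/val_inj/funext=> x /=; rewrite gactM. Qed.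

Definition hom_action : gaction H (ghom Q B) :=
  GAction hom_act_morph hom_act1 hom_actM.

End HomAction.

(** In mathcomp [(s * t) i = t (s i)], so that [e |-> e \o s] is a left action
    of the symmetric group. *)
Section SignAction.
Variable s : nat.

Definition sign_act (g : {perm 'I_s}) (e : {ffun 'I_s -> sign}) :
  {ffun 'I_s -> sign} := [ffun i => e (g i)].

Lemma sign_act_morph g : {morph sign_act g : e e' / e * e'}.
Proof. by move=> e e'; apply/ffunP=> i; rewrite !ffunE. Qed.
Lemma sign_act1 e : sign_act 1 e = e.
Proof. by apply/ffunP=> i; rewrite !ffunE perm1. Qed.
Lemma sign_actM g g' e : sign_act (g * g') e = sign_act g (sign_act g' e).
Proof. by apply/ffunP=> i; rewrite !ffunE permM. Qed.

Definition sign_action : gaction {perm 'I_s} {ffun 'I_s -> sign} :=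
  GAction sign_act_morph sign_act1 sign_actM.

End SignAction.

Definition short_exact (A B C : groupType)
    (i : {multiplicative A -> B}) (p : {multiplicative B -> C}) : Prop :=
  [/\ injective i,
      forall b, p b = 1 <-> (exists a, i a = b)
    & forall c, exists b, p b = c].

Record quat (R : realType) : Type := Quat {
  qre : R; qi : R; qj : R; qk : R
}.

Section Quaternion.
Variable R : realType.
Local Open Scope ring_scope.
Implicit Types x y z : quat R.

Definition quat_tuple x := (qre x, qi x, qj x, qk x).
Definition tuple_quat (t : R * R * R * R) :=
  let: (a, b, c, d) := t in Quat a b c d.

Lemma quat_tupleK : cancel quat_tuple tuple_quat.
Proof. by case. Qed.

HB.instance Definition _ := Choice.copy (quat R) (can_type quat_tupleK).

Definition qadd x y :=
  Quat (qre x + qre y) (qi x + qi y) (qj x + qj y) (qk x + qk y).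
Definition qopp x := Quat (- qre x) (- qi x) (- qj x) (- qk x).
Definition qzero : quat R := Quat 0 0 0 0.
Definition qone : quat R := Quat 1 0 0 0.
Definition qmul x y := Quat
  (qre x * qre y - qi x * qi y - qj x * qj y - qk x * qk y)
  (qre x * qi y + qi x * qre y + qj x * qk y - qk x * qj y)
  (qre x * qj y - qi x * qk y + qj x * qre y + qk x * qi y)
  (qre x * qk y + qi x * qj y - qj x * qi y + qk x * qre y).

Lemma qaddA : associative qadd.
Proof. by move=> x y z; congr Quat; apply: addrA. Qed.
Lemma qaddC : commutative qadd.
Proof. by move=> x y; congr Quat; apply: addrC. Qed.
Lemma qadd0 : left_id qzero qadd.
Proof. by case=> *; congr Quat; apply: add0r. Qed.
Lemma qaddN : left_inverse qzero qopp qadd.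
Proof. by move=> x; congr Quat; apply: addNr. Qed.

HB.instance Definition _ := GRing.isZmodule.Build (quat R) qaddA qaddC qadd0 qaddN.

Lemma qmulA : associative qmul.
Proof. by move=> x y z; congr Quat => /=; ring. Qed.
Lemma qmul1 : left_id qone qmul.
Proof. by case=> *; congr Quat => /=; ring. Qed.
Lemma qmulr1 : right_id qone qmul.
Proof. by case=> *; congr Quat => /=; ring. Qed.
Lemma qmulDl : left_distributive qmul qadd.
Proof. by move=> x y z; congr Quat => /=; ring. Qed.
Lemma qmulDr : right_distributive qmul qadd.
Proof. by move=> x y z; congr Quat => /=; ring. Qed.
Lemma qone_neq0 : qone != qzero.
Proof. by apply/eqP=> -[] /eqP; rewrite oner_eq0. Qed.

HB.instance Definition _ := GRing.Zmodule_isNzRing.Build (quat R)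
  qmulA qmul1 qmulr1 qmulDl qmulDr qone_neq0.

Definition qconj x : quat R := Quat (qre x) (- qi x) (- qj x) (- qk x).

Lemma qconjK : involutive qconj.
Proof. by case=> a b c d; rewrite /qconj /= !opprK. Qed.
Lemma qconjM x y : qconj (x * y) = qconj y * qconj x.
Proof. by congr Quat => /=; ring. Qed.
Lemma qconjD : {morph qconj : x y / x + y}.
Proof. by move=> x y; congr Quat => /=; ring. Qed.
Lemma qconj0 : qconj 0 = 0.
Proof. by congr Quat; rewrite oppr0. Qed.
Lemma qconj1 : qconj 1 = 1.
Proof. by congr Quat; rewrite oppr0. Qed.

(** Matrix of the left multiplication by [x]; it is used only to show that
    one-sided inverses of quaternionic matrices are two-sided. *)
Definition qlmx x : 'M[R]_4 := \matrix_(i, j) nth 0 (nth [::]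
  [:: [:: qre x; - qi x; - qj x; - qk x];
      [:: qi x; qre x; - qk x; qj x];
      [:: qj x; qk x; qre x; - qi x];
      [:: qk x; - qj x; qi x; qre x]] i) j.

Lemma qlmxM x y : qlmx (x * y) = qlmx x *m qlmx y.
Proof.
apply/matrixP=> -[[|[|[|[|//]]]] ?] [[|[|[|[|//]]]] ?];
by rewrite !mxE !big_ord_recl big_ord0 !mxE /= /bump /= ?add1n /=; ring.
Qed.

Lemma qlmxD : {morph qlmx : x y / x + y}.
Proof.
move=> x y; apply/matrixP=> -[[|[|[|[|//]]]] ?] [[|[|[|[|//]]]] ?];
by rewrite !mxE /=; ring.
Qed.

Lemma qlmx0 : qlmx 0 = 0.
Proof.
apply/matrixP=> -[[|[|[|[|//]]]] ?] [[|[|[|[|//]]]] ?];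
by rewrite !mxE /=; ring.
Qed.

Lemma qlmx1 : qlmx 1 = 1%:M.
Proof.
apply/matrixP=> -[[|[|[|[|//]]]] ?] [[|[|[|[|//]]]] ?];
by rewrite !mxE /=; ring.
Qed.

Lemma qlmx_inj : injective qlmx.
Proof.
move=> [a b c d] [a' b' c' d'] /matrixP e.
by congr Quat; [have := e 0 0|have := e 1 0|have := e 2 0|have := e 3 0];
  rewrite !mxE.
Qed.

Definition qmxreal n (A : 'M[quat R]_n) := \mxblock_(i < n, j < n) qlmx (A i j).

Lemma qmxrealM n (A B : 'M[quat R]_n) :
  qmxreal (A *m B) = qmxreal A *m qmxreal B.
Proof.
rewrite mul_mxblock; apply: eq_mxblock => i j.
rewrite mxE (big_morph _ qlmxD qlmx0); apply: eq_bigr => k _.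
exact: qlmxM.
Qed.

Lemma qmxreal1 n : qmxreal (1%:M : 'M[quat R]_n) = 1%:M.
Proof.
apply/matrixP=> s t; rewrite [LHS]mxE [RHS]mxE.
rewrite -(can_eq (@tagnat.sigK _ _)).
rewrite /tagnat.sig1 /tagnat.sig2.
case: (tagnat.sig s) (tagnat.sig t) => [i u] [j v] /=.
case: (eqVneq i j) v => [<-|nij] v.
  by rewrite [X in qlmx X]mxE eqxx qlmx1 mxE eq_Tagged.
by rewrite [X in qlmx X]mxE (negPf nij) qlmx0 mxE eqE /= /tag_eq /= (negPf nij).
Qed.

Lemma qmulmx1C n (A B : 'M[quat R]_n) : A *m B = 1%:M -> B *m A = 1%:M.
Proof.
move=> AB1; have /mulmx1C : qmxreal A *m qmxreal B = 1%:M.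
  by rewrite -qmxrealM AB1 qmxreal1.
rewrite -qmxrealM -qmxreal1 /qmxreal => /eq_mxblockP e.
by apply/matrixP=> i j; apply/qlmx_inj/e.
Qed.

Definition conjtr m n (A : 'M[quat R]_(m, n)) : 'M[quat R]_(n, m) :=
  \matrix_(i, j) qconj (A j i).

Lemma conjtrK m n (A : 'M[quat R]_(m, n)) : conjtr (conjtr A) = A.
Proof. by apply/matrixP=> i j; rewrite !mxE qconjK. Qed.

Lemma conjtrM m n p (A : 'M[quat R]_(m, n)) (B : 'M[quat R]_(n, p)) :
  conjtr (A *m B) = conjtr B *m conjtr A.
Proof.
apply/matrixP=> i j; rewrite !mxE (big_morph _ qconjD qconj0).
by apply: eq_bigr => k _; rewrite !mxE qconjM.
Qed.

Lemma conjtr1 n : conjtr (1%:M : 'M[quat R]_n) = 1%:M.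
Proof.
apply/matrixP=> i j; rewrite !mxE eq_sym.
by case: eqVneq; rewrite ?qconj1 ?qconj0.
Qed.

End Quaternion.

Section CompactSymplectic.
Variables (R : realType) (n : nat).
Local Open Scope ring_scope.

Definition sp_pred : pred 'M[quat R]_n := fun X => X *m conjtr X == 1%:M.

Definition Sp : Type := {X : 'M[quat R]_n | sp_pred X}.
HB.instance Definition _ := SubChoice.copy Sp {X : 'M[quat R]_n | sp_pred X}.

Lemma sp1P : sp_pred 1%:M.
Proof. by rewrite /sp_pred conjtr1 mulmx1. Qed.

Lemma spMP (X Y : Sp) : sp_pred (val X *m val Y).
Proof.
rewrite /sp_pred conjtrM mulmxA -(mulmxA (val X)) (eqP (valP Y)) mulmx1.
exact: (valP X).
Qed.

Lemma spVP (X : Sp) : sp_pred (conjtr (val X)).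
Proof. by rewrite /sp_pred conjtrK (qmulmx1C (eqP (valP X))). Qed.

Definition sp_one : Sp := exist sp_pred _ sp1P.
Definition sp_mul (X Y : Sp) : Sp := exist sp_pred _ (spMP X Y).
Definition sp_inv (X : Sp) : Sp := exist sp_pred _ (spVP X).

Lemma sp_mulA : associative sp_mul.
Proof. by move=> X Y Z; apply/val_inj/mulmxA. Qed.
Lemma sp_mul1 : left_id sp_one sp_mul.
Proof. by move=> X; apply/val_inj/mul1mx. Qed.
Lemma sp_mulr1 : right_id sp_one sp_mul.
Proof. by move=> X; apply/val_inj/mulmx1. Qed.
Lemma sp_mulV : left_inverse sp_one sp_inv sp_mul.
Proof. by move=> X; apply/val_inj/(qmulmx1C (eqP (valP X))). Qed.
Lemma sp_mulrV : right_inverse sp_one sp_inv sp_mul.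
Proof. by move=> X; apply/val_inj/(eqP (valP X)). Qed.

HB.instance Definition _ := isGroup.Build Sp
  sp_mulA sp_mul1 sp_mulr1 sp_mulV sp_mulrV.

Definition pm1_pred : {pred Sp} :=
  fun X => (val X == 1%:M) || (val X == - 1%:M).

Lemma pm1_closed : group_closed pm1_pred.
Proof.
have N1 : conjtr (- 1%:M) = - 1%:M :> 'M[quat R]_n.
  apply/matrixP=> i j; rewrite !mxE eq_sym.
  by case: eqVneq => _; congr Quat; rewrite /= ?oppr0.
split=> [|X Y]; first by rewrite unfold_in /pm1_pred eqxx.
rewrite !unfold_in /= => /orP[] /eqP-> /orP[] /eqP->;
  by rewrite ?N1 ?conjtr1 ?mulNmx mul1mx ?opprK eqxx ?orbT.
Qed.

HB.instance Definition _ :=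
  isMulClosed.Build Sp pm1_pred (group_closedM pm1_closed).
HB.instance Definition _ := isMul1Closed.Build Sp pm1_pred (fst pm1_closed).
HB.instance Definition _ :=
  isInvClosed.Build Sp pm1_pred (group_closedV pm1_closed).

Lemma pm1_central X Y : X \in pm1_pred -> (X * Y = Y * X)%g.
Proof.
by case/orP=> /eqP eX; apply/val_inj;
  rewrite /= eX ?mulNmx ?mulmxN mulmx1 mul1mx.
Qed.

Lemma pm1_normal X Y : X \in pm1_pred -> (X ^ Y)%g \in pm1_pred.
Proof. by move=> pX; rewrite conjgE (pm1_central Y pX) mulKg. Qed.

Definition pm1 : normal_subgroup Sp := NormalSubgroup pm1_normal.

(** [PSp] is Sp(n)/<-I>; the projection is [\pi_(gquot (pm1 R n))]. *)
Definition PSp : groupType := gquot pm1.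

End CompactSymplectic.

Section Invariants.
Variables (R : realType) (n : nat).
Local Notation Sp := (Sp R n).
Local Notation PSp := (PSp R n).
Local Notation proj := (\pi_(gquot (pm1 R n))).

Section Form.
Variable F : abelian_subgroup PSp.

(** For commuting [x] and [y], see [form_commutator] below. *)
Definition form (x y : PSp) : sign :=
  if repr x * repr y * (repr x)^-1 * (repr y)^-1 == 1 then 1 else sgnN.

Lemma repr_proj A : exists2 z, z \in pm1_pred (n:=n) & repr (proj A) = A * z.
Proof.
exists (A^-1 * repr (proj A)); last by rewrite mulgA mulgV mul1g.
by apply/(@gquotP _ (pm1 R n)); rewrite reprK.
Qed.

Lemma formP A B : form (proj A) (proj B) = 1 <-> A * B = B * A.
Proof.
have [z pz eA] := repr_proj A; have [w pw eB] := repr_proj B.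
have zC X : X * z = z * X by rewrite (pm1_central X pz).
have wC X : X * w = w * X by rewrite (pm1_central X pw).
have eAB : A * z * (B * w) = A * B * (z * w).
  by rewrite -!mulgA; congr (_ * _); rewrite !mulgA -zC.
have eBA : B * w * (A * z) = B * A * (z * w).
  by rewrite -!mulgA; congr (_ * _); rewrite [RHS]mulgA wC.
have cE (X Y : Sp) : X * Y * X^-1 * Y^-1 = X * Y * (Y * X)^-1.
  by rewrite invgM !mulgA.
rewrite /form eA eB cE eAB eBA; case: eqP => [/divg1_eq /mulIg //|ne]; split=> // e.
by case: ne; rewrite e mulgV.
Qed.

Lemma form_commutator A B : proj A * proj B = proj B * proj A ->
  val (A * B * A^-1 * B^-1) =
  if form (proj A) (proj B) == 1 then 1%:M%R else (- 1%:M)%R.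
Proof.
rewrite -!gquot_piM => /esym/(@gquotP _ (pm1 R n)) pC.
have cE : A * B * A^-1 * B^-1 = A * B * (B * A)^-1 by rewrite invgM !mulgA.
have eAB : A * B = ((B * A)^-1 * (A * B)) * (B * A).
  by rewrite (pm1_central (B * A) pC) mulgA mulgV mul1g.
have -> : A * B * A^-1 * B^-1 = (B * A)^-1 * (A * B).
  by rewrite cE {1}eAB -mulgA mulgV mulg1.
case: eqP => [/formP ->|nf]; first by rewrite mulVg.
case/orP: pC => /eqP // e; case: nf; apply/formP.
by rewrite eAB (_ : (B * A)^-1 * (A * B) = 1) ?mul1g //; apply/val_inj.
Qed.

Lemma form_reprP x y :
  form x y = 1 <-> repr x * repr y = repr y * repr x.
Proof. by have := formP (repr x) (repr y); rewrite !reprK. Qed.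

Definition ker_pred : {pred gsub F} :=
  fun x => `[< forall y : gsub F, form (val x) (val y) = 1 >].

Lemma ker_closed : group_closed ker_pred.
Proof.
split=> [|x y /asboolP Kx /asboolP Ky]; apply/asboolP=> z.
  have := formP 1 (repr (val z)); rewrite reprK mul1g mulg1 val1 gquot_pi1.
  by case=> _; apply.
have /form_reprP cx := Kx z; have /form_reprP cy := Ky z.
have := formP (repr (val x) * (repr (val y))^-1) (repr (val z)).
rewrite gmulfF gquot_piF !reprK => -[_]; apply.
by apply/esym/commuteM; [apply/esym|apply/commuteV/esym].
Qed.

HB.instance Definition _ :=
  isMulClosed.Build _ ker_pred (group_closedM ker_closed).
HB.instance Definition _ := isMul1Closed.Build _ ker_pred (fst ker_closed).
HB.instance Definition _ :=
  isInvClosed.Build _ ker_pred (group_closedV ker_closed).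

Lemma ker_normal x y : x \in ker_pred -> x ^ y \in ker_pred.
Proof. by rewrite conjgE gsub_abgC mulgK. Qed.

Definition form_ker : normal_subgroup (gsub F) := NormalSubgroup ker_normal.

Definition form_quot : groupType := gquot form_ker.

Definition quot_form (c d : form_quot) : sign :=
  form (val (repr c)) (val (repr d)).

Definition bf_pred : {pred PSp} := fun x =>
  `[< (exists2 y : gsub F, val y = x & y \in ker_pred) /\
      forall A : Sp, proj A = x -> A * A = 1 >].

Lemma bf_closed : group_closed bf_pred.
Proof.
split=> [|_ _ /asboolP[[x <- Kx] x2] /asboolP[[y <- Ky] y2]]; apply/asboolP.
  split; first by exists 1; rewrite ?val1 // (fst ker_closed).
  move=> A /(@gquotP _ (pm1 R n)) /gpredVr; rewrite mulg1 invgK => pA.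
  by apply/val_inj; case/orP: pA => /eqP /= ->; rewrite ?mulNmx mul1mx ?opprK.
split.
  exists (x * y^-1); last exact: (snd ker_closed _ _ Kx Ky).
  by rewrite gmulfF.
move=> A eA; pose X := repr (val x); pose Y := A^-1 * X.
have pX : proj X = val x by rewrite reprK.
have pY : proj Y = val y.
  by rewrite gquot_piM gquot_piV eA pX invgF -mulgA mulVg mulg1.
have cXY : X * Y = Y * X.
  by apply/formP; rewrite pX pY; move/asboolP: Kx; apply.
have -> : A = X * Y^-1 by rewrite /Y invgM invgK mulgA mulgV mul1g.
have -> : X * Y^-1 * (X * Y^-1) = (X * X) * (Y * Y)^-1.
  have cV : Y^-1 * X = X * Y^-1 by apply/esym/commuteV.
  by rewrite (invgM Y) mulgA -(mulgA X Y^-1 X) cV !mulgA.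
by rewrite x2 // y2 // mulgV.
Qed.

HB.instance Definition _ :=
  isMulClosed.Build _ bf_pred (group_closedM bf_closed).
HB.instance Definition _ := isMul1Closed.Build _ bf_pred (fst bf_closed).
HB.instance Definition _ :=
  isInvClosed.Build _ bf_pred (group_closedV bf_closed).

Lemma bf_abelian : {in bf_pred &, forall x y, x * y = y * x}.
Proof.
move=> x y /asboolP[[x' <- _] _] /asboolP[[y' <- _] _].
exact: (abgC (valP x') (valP y')).
Qed.

Definition BF : abelian_subgroup PSp := AbelianSubgroup bf_abelian.

(** [H^n] is the right module of column vectors; the right span of the columns
    of [b] is the set of the vectors [b *m x]. *)
Definition quat_dim (V : set 'cV[quat R]_n) (d : nat) : Prop :=
  exists b : 'M[quat R]_(n, d),
    injective (fun x : 'cV_d => b *m x)%R /\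
    V = [set (b *m x)%R | x in [set: 'cV_d]].

Definition signed (e : sign) (v : 'cV[quat R]_n) : 'cV[quat R]_n :=
  if e == 1 then v else (- v)%R.

Definition bf_eigenspace (chi : Sp -> sign) : set 'cV[quat R]_n :=
  [set v | forall A : Sp, proj A \in bf_pred ->
           (val A *m v)%R = signed (chi A) v].

Definition is_bf_eigenspace (V : set 'cV[quat R]_n) : Prop :=
  (exists chi, V = bf_eigenspace chi) /\ exists2 v, V v & v != 0%R.

(** [V] lists the distinct simultaneous eigenspaces of the preimage of [BF],
    those of dimension 2^(k-1) first (written [2 * d = 2^k], so that there are
    none when k = 0); for a maximal abelian [F] the other ones have
    dimension 2^k. *)
Structure eigen_decomposition (k s0 s1 : nat)
    (V : 'I_(s0 + s1) -> set 'cV[quat R]_n) : Prop := EigenDecomposition {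
  eigen_inj : injective V;
  eigenP : forall U, is_bf_eigenspace U <-> exists i, V i = U;
  eigen_dim : forall i : 'I_(s0 + s1), (i < s0)%N <->
    exists2 d, quat_dim (V i) d & (2 * d = 2 ^ k)%N
}.

Section Mu.
Variables (s0 s1 : nat) (V : 'I_(s0 + s1) -> set 'cV[quat R]_n).

(** For [A] above an element of a maximal abelian [F] and i < s0, the
    restriction of A^2 to V_i is id or -id; [mu i] is this sign. *)
Definition mu (i : 'I_s0) (x : gsub F) : sign :=
  if `[< forall A : Sp, proj A = val x ->
         forall v, V (lshift s1 i) v -> (val A *m (val A *m v))%R = v >]
  then 1 else sgnN.

Definition quot_mu (i : 'I_s0) (c : form_quot) : sign := mu i (repr c).

Definition smu_pred : {pred {perm 'I_s0}} :=
  fun g => `[< forall i, mu (g i) = mu i >].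

Lemma smu_closed : group_closed smu_pred.
Proof.
split=> [|g h /asboolP Hg /asboolP Hh]; apply/asboolP=> i; rewrite ?perm1 //.
by rewrite permM -[LHS]Hh permKV Hg.
Qed.

HB.instance Definition _ :=
  isMulClosed.Build {perm 'I_s0} smu_pred (group_closedM smu_closed).
HB.instance Definition _ :=
  isMul1Closed.Build {perm 'I_s0} smu_pred (fst smu_closed).
HB.instance Definition _ :=
  isInvClosed.Build {perm 'I_s0} smu_pred (group_closedV smu_closed).

Definition S_mu : groupType := gsub smu_pred.

Definition autmu_pred : {pred gaut form_quot} := fun f =>
  `[< (forall c d, quot_form (aut_fun f c) (aut_fun f d) = quot_form c d) /\
      exists g : {perm 'I_s0},
        forall i c, quot_mu (g i) (aut_fun f c) = quot_mu i c >].

Lemma autmu_closed : group_closed autmu_pred.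
Proof.
split=> [|f h /asboolP[fm [g fg]] /asboolP[hm [g' hg]]];
  apply/asboolP; split=> //.
- by exists 1 => i c; rewrite perm1.
- have /asboolP[_ hK _] := valP h.
  move=> c d; rewrite -[in RHS](hK c) -[in RHS](hK d).
  by rewrite [RHS]hm [LHS]fm.
- exists (g'^-1 * g) => i c; have /asboolP[_ hK _] := valP h.
  by rewrite permM [LHS]fg -hg permKV; congr quot_mu; apply: hK.
Qed.

HB.instance Definition _ :=
  isMulClosed.Build _ autmu_pred (group_closedM autmu_closed).
HB.instance Definition _ :=
  isMul1Closed.Build _ autmu_pred (fst autmu_closed).
HB.instance Definition _ :=
  isInvClosed.Build _ autmu_pred (group_closedV autmu_closed).

Definition Aut_mu : groupType := gsub autmu_pred.

(** [A] is the sum of the [e i * id_(V i)]. *)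
Definition diagonal (A : Sp) (e : 'I_(s0 + s1) -> sign) : Prop :=
  forall i v, V i v -> (val A *m v)%R = signed (e i) v.

Definition permute_coord (g : {perm 'I_s0}) (e : 'I_(s0 + s1) -> sign)
    (i : 'I_(s0 + s1)) : sign :=
  match split i with
  | inl j => e (lshift s1 (g j))
  | inr _ => e i
  end.

(** [a] is the action of S_mu on B_F by permutation of the first s0
    coordinates; as every lift of an element of B_F is diagonal, there is at
    most one such [a]. *)
Definition permutes_coordinates (a : gaction S_mu (gsub BF)) : Prop :=
  forall (g : S_mu) (x : gsub BF) (A : Sp) e,
    proj A = val x -> diagonal A e ->
    exists2 A' : Sp, proj A' = val (a g x)
                   & diagonal A' (permute_coord (val g) e).

End Mu.

End Form.

End Invariants.

(* Main.v *)
Require Import Defs.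
From HB Require Import structures.
From mathcomp Require Import all_boot all_order all_algebra all_fingroup.
From mathcomp Require Import generic_quotient.
From mathcomp Require Import boolp classical_sets reals.
From mathcomp Require Import complex ring lra.

(** Let Gamma be the preimage of F in Sp(n), inside the real star-algebra
    A = M_n(H) with the trace form Re tr(x y^* ).  An abelian subgroup which is
    maximal is its own centraliser, so Gamma is a group of unitaries whose
    commutators are signs and which contains every unitary commuting with it up
    to signs ([preim_maximal]).  In particular the unitaries of the commutant C
    of Gamma lie in Gamma, hence commute with each other.

    This determines C.  If p is a projection of C then 1 - 2p lies in the
    preimage of B_F; conversely an involution of B_F is 1 - 2p for such a p.
    So the V_i are the ranges of the minimal projections P_i of C, and these
    add up to 1 ([eigen_atoms]).  By the spectral theorem in A ([herm_eigen])
    the hermitian elements of C below P_i are the real multiples of P_i, and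
    since the unitaries commute the skew ones form at most a line R J_i with
    J_i^2 = -P_i ([exists_cell]).  Computing in two ways the trace of the
    average of x |-> u x u^* over F/ker m, which is the projection on the
    commutant, gives dim V_i = 2^(k-1) when J_i = 0 and 2^k otherwise
    ([superoperator_trace], [cell_type]): the first s0 blocks are those
    with J_i = 0.

    Next come enough unitaries normalising Gamma.  Fix lifts g_l of a basis of
    F/ker m, scaled so that g_l^2 = 1 on each block with J_i <> 0; on the other
    blocks g_l^2 is the sign mu_i.  If a second family g'_l has the same
    commutators and, after a permutation of the blocks, the same squares, then
    T |-> g'_l T g_l^-1 are commuting involutions of the space of maps
    V_i -> V_j.  They have a common eigenvector, whose eigenvalues are signs;
    as m is nondegenerate these signs are commutators with an element of Gamma,
    and are removed by multiplying with it.  The resulting intertwiner T is an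
    isometry up to a scalar because T^* T is a hermitian element of C
    ([intertwiner]).  Gluing blocks gives a unitary X with X g_l = g'_l X that
    permutes the P_i and the +-J_i as prescribed ([realization]).

    A unitary X normalising Gamma acts on F/ker m by an automorphism and on the
    lines R J_i, for i > s0, by a signed permutation: this is the right-hand map,
    and [realization] shows that it is onto.  If both actions are trivial,
    then X permutes the first s0 blocks by some sigma and conjugates g_l to
    z_l g_l with z_l in C; comparing squares block by block shows that sigma is
    in S_mu and z_l^2 = 1, so that X determines an element of
    Hom(F/ker m, B_F) and a sigma in S_mu ([corr_aut_ker]).  All such pairs
    occur, again by nondegeneracy of m and by [realization], and products of
    unitaries correspond to products in the semidirect product because the g_l
    are fixed once and for all ([corr_homM]).  Finally X corresponds to the
    trivial pair exactly when it centralises F ([corr_hom_cent]). *)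

Set Implicit Arguments.
Unset Strict Implicit.
Unset Printing Implicit Defensive.

Import Order.TTheory GRing.Theory Num.Theory.


(** * Real polynomials *)

Lemma rcf_poly_factor (R : rcfType) (w : {poly R}) : (1 < size w)%N ->
  (exists l v, w = v * ('X - l%:P))%R \/
  (exists a b v, b != 0 /\ w = v * (('X - a%:P) ^+ 2 + (b ^+ 2)%:P))%R.
Proof.
move=> sw; set f : {rmorphism R -> R[i]%C} := real_complex R.
have /closed_rootP[z rz] : size (map_poly f w) != 1 by rewrite size_map_poly gtn_eqF.
have [a [b ez]] : exists a b, z = (a +i* b)%C by case: z {rz} => a b; exists a, b.
have [b0|nb0] := eqVneq b 0%R.
  left; exists a; move: rz; rewrite ez b0 complexr0 (mapf_root f).
  by move/factor_theorem => [v ->]; exists v.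
right; exists a, b; set q := (_ + _)%R.
have sq : size q = 3.
  rewrite /q size_polyDl size_exp_XsubC //.
  by rewrite (leq_ltn_trans (size_polyC_leq1 _)).
have q0 : q != 0%R by rewrite -size_poly_gt0 sq.
have rq : root (map_poly f q) z.
  rewrite /q rmorphD rmorphXn /= map_polyXsubC map_polyC rootE !hornerE ez.
  by apply/eqP; congr Complex; rewrite /=; ring.
exists (w %/ q)%R; split=> //; rewrite {1}(divp_eq w q).
suff -> : (w %% q)%R = 0%R by rewrite addr0.
have: root (map_poly f (w %% q)%R) z.
  move: rz; rewrite {1}(divp_eq w q) rmorphD rmorphM /=.
  by rewrite rootE hornerD hornerM (eqP rq) mulr0 add0r.
have: (size (w %% q)%R <= 2)%N by rewrite -ltnS -sq ltn_modp.
move: (w %% q)%R => m sm rm; apply/polyP => i; rewrite coef0.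
have em : (map_poly f m).[z]%R = (f m`_0 + f m`_1 * z)%R.
  by rewrite (@horner_coef_wide _ 2) ?size_map_poly // big_ord_recl big_ord1
    !coef_map /= expr0 expr1 mulr1.
move: rm; rewrite rootE em ez; case/eqP=> e0 e1.
have m1 : (m`_1 = 0)%R.
  by apply/eqP; rewrite -(mulIr_eq0 _ (mulIf nb0)) -[X in _ == X]e1; apply/eqP; ring.
have m0 : (m`_0 = 0)%R by rewrite -[RHS]e0 m1; ring.
case: i => [|[|i]] //; apply/eqP; move/leq_sizeP: sm => /(_ i.+2 isT) -> //.
Qed.

(** * Real algebras with a positive trace *)

Local Open Scope ring_scope.

(** The matrix algebras M_d(H) over the quaternions, with the conjugate
    transpose, the real part of the trace and the real orthonormal basis made
    of the multiples of the matrix units by 1, i, j, k.  In M_d(R) the constant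
    of [frame_casimir] would be 1, and in M_d(C) the left-hand side would be a
    complex scalar: the identity says that the algebra is central simple over R
    and its constant 4 is the dimension of H. *)
Structure traced_algebra (R : rcfType) := TracedAlgebra {
  talg :> algType R;
  star : talg -> talg;
  tr : talg -> R;
  frame_index : finType;
  frame : frame_index -> talg;
  starD : forall x y, star (x + y) = star x + star y;
  starZ : forall a x, star (a *: x) = a *: star x;
  starM : forall x y, star (x * y) = star y * star x;
  starK : involutive star;
  trD : forall x y, tr (x + y) = tr x + tr y;
  trZ : forall a x, tr (a *: x) = a * tr x;
  trC : forall x y, tr (x * y) = tr (y * x);
  tr_star : forall x, tr (star x) = tr x;
  frame_casimir : forall x,
    \sum_t frame t * x * star (frame t) = (4 * tr x) *: 1;
  frame_parseval : forall x, \sum_t tr (x * star (frame t)) *: frame t = x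
}.

Arguments star {R t}.
Arguments tr {R t}.
Arguments frame {R t}.

Section TracedAlgebra.
Variables (R : rcfType) (A : traced_algebra R).
Implicit Types (x y s p q u v : A).

Definition herm s := star s = s.
Definition proj p := p * p = p /\ star p = p.
Definition unitary u := u * star u = 1 /\ star u * u = 1.

Lemma trN x : tr (- x) = - tr x. Proof. by rewrite -scaleN1r trZ mulN1r. Qed.
Lemma trB x y : tr (x - y) = tr x - tr y. Proof. by rewrite trD trN. Qed.
Lemma tr0 : tr (0 : A) = 0. Proof. by rewrite -(scale0r (1 : A)) trZ mul0r. Qed.
Lemma tr_sum (I : finType) (F : I -> A) : tr (\sum_i F i) = \sum_i tr (F i).
Proof. exact: (big_morph _ (@trD _ A) tr0). Qed.

Lemma starN x : star (- x) = - star x. Proof. by rewrite -scaleN1r starZ scaleN1r. Qed.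
Lemma starB x y : star (x - y) = star x - star y. Proof. by rewrite starD starN. Qed.
Lemma star0 : star (0 : A) = 0. Proof. by rewrite -(scale0r (1 : A)) starZ !scale0r. Qed.
Lemma star_sum (I : finType) (F : I -> A) : star (\sum_i F i) = \sum_i star (F i).
Proof. exact: (big_morph _ (@starD _ A) star0). Qed.

Lemma star1 : star (1 : A) = 1.
Proof. by rewrite -[LHS]mulr1 -{2}(starK (1 : A)) -starM mulr1 starK. Qed.

Lemma parseval x y : tr (x * star y) = \sum_t tr (x * star (frame t)) * tr (y * star (frame t)).
Proof.
rewrite -{1}(frame_parseval y) star_sum mulr_sumr tr_sum.
by apply: eq_bigr => t _; rewrite starZ -scalerAr trZ mulrC.
Qed.

Lemma tr_sqr_ge0 x : 0 <= tr (x * star x).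
Proof. by rewrite parseval sumr_ge0 // => t _; rewrite -expr2 sqr_ge0. Qed.

Lemma tr_sqr_eq0 x : tr (x * star x) = 0 -> x = 0.
Proof.
rewrite parseval => /psumr_eq0P e; rewrite -(frame_parseval x) big1 // => t _.
have /eqP := e (fun t _ => sqr_ge0 _) t isT.
by rewrite mulf_eq0 orbb => /eqP ->; rewrite scale0r.
Qed.

Lemma tr_sqr_gt0 x : x != 0 -> 0 < tr (x * star x).
Proof.
by move=> nx; rewrite lt0r tr_sqr_ge0 andbT; apply: contraNneq nx => /tr_sqr_eq0 ->.
Qed.

Lemma mul_star_eq0 x : x * star x = 0 -> x = 0.
Proof. by move=> e; apply: tr_sqr_eq0; rewrite e tr0. Qed.

Lemma tr_proj_gt0 p : proj p -> p != 0 -> 0 < tr p.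
Proof. by case=> pp ps /tr_sqr_gt0; rewrite ps pp. Qed.

(** By [frame_casimir] the sum of the p b (q q^* ) b^* over the frame is a
    positive multiple of p. *)
Lemma prime_algebra p q : p != 0 -> q != 0 -> exists x, p * x * q != 0.
Proof.
move=> np nq; apply: contrapT => /forallNP e.
have e0 x : p * x * q = 0 by apply/eqP/negPn/negP/e.
have := congr1 ( *%R p) (frame_casimir (q * star q)).
rewrite mulr_sumr big1 => [|t _]; last by rewrite !mulrA e0 !mul0r.
rewrite -scalerAr mulr1 => /esym/eqP; rewrite scaler_eq0 (negPf np) orbF.
by rewrite mulf_eq0 pnatr_eq0 /= gt_eqF // tr_sqr_gt0.
Qed.

(** The powers of s have linearly dependent coordinates in the frame. *)
Lemma finite_dimensional s : exists2 w : {poly R}, w != 0 & horner_alg s w = 0.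
Proof.
pose N := #|frame_index A|.
pose M := \matrix_(i < N.+1, j < N) tr (s ^+ i * star (frame (enum_val j))).
have: kermx M != 0.
  by rewrite -mxrank_eq0 mxrank_ker subn_eq0 -ltnNge (leq_ltn_trans (rank_leq_col M)).
case/rowV0Pn => u /sub_kermxP uM nu.
exists (rVpoly u).
  apply: contraNneq nu => e; rewrite -(rVpolyK u) e.
  by apply/eqP/rowP => i; rewrite !mxE coef0.
rewrite -(frame_parseval (horner_alg _ _)) big1 // => t _.
suff -> : tr (horner_alg s (rVpoly u) * star (frame t)) = 0 by rewrite scale0r.
have <- : (u *m M) 0 (enum_rank t) = 0 by rewrite uM mxE.
rewrite mxE /rVpoly poly_def rmorph_sum mulr_suml tr_sum; apply: eq_bigr => i _.
rewrite mxE enum_rankK insubT //= => lt_i; rewrite -mul_polyC rmorphM rmorphXn /=.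
rewrite horner_algC horner_algX mulr_algl -scalerAl trZ; congr (u _ _ * _).
exact/val_inj.
Qed.

End TracedAlgebra.

(** * The spectral theorem *)

Section Spectral.
Variables (R : rcfType) (A : traced_algebra R) (s p : A).
Hypotheses (s_herm : herm s) (p_proj : proj p) (sp : s * p = s) (p0 : p != 0).
Local Notation H w := (horner_alg s w).

Let ps : p * s = s.
Proof. by case: p_proj => _ pS; rewrite -[RHS]s_herm -[in RHS]sp starM pS s_herm. Qed.

Lemma horner_alg_comm (B : traced_algebra R) (x y : B) (w : {poly R}) : x * y = y * x ->
  horner_alg x w * y = y * horner_alg x w.
Proof.
move=> xy; elim/poly_ind: w => [|w c IH]; first by rewrite !rmorph0 mul0r mulr0.
rewrite rmorphD rmorphM /= horner_algX horner_algC mulrDl mulrDr -mulrA xy mulrA IH.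
by rewrite -!mulrA -!scalerAl -scalerAr mul1r mulr1.
Qed.

Let H_herm w : star (H w) = H w.
Proof.
elim/poly_ind: w => [|w c IH]; first by rewrite !rmorph0 star0.
rewrite rmorphD rmorphM /= horner_algX horner_algC starD starZ starM star1 IH.
by rewrite s_herm horner_alg_comm.
Qed.

Let Hp w : H w * p = p * H w.
Proof. by apply: horner_alg_comm; rewrite sp ps. Qed.

Let HpM w v : H w * p * (H v * p) = H (w * v) * p.
Proof. by case: p_proj => pp _; rewrite -!mulrA (mulrA p) -Hp -(mulrA _ p) pp mulrA -rmorphM. Qed.

Let Hp_herm w : star (H w * p) = H w * p.
Proof. by case: p_proj => _ pS; rewrite starM pS H_herm Hp. Qed.

Let HpZ c w : c *: (H w * p) = H (c%:P * w) * p.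
Proof. by rewrite rmorphM /= horner_algC mulr_algl -scalerAl. Qed.

Let Hp_sqr w : H (w * w) * p = 0 -> H w * p = 0.
Proof. by move=> e; apply: mul_star_eq0; rewrite Hp_herm HpM. Qed.

(** Every eigenvalue of a hermitian element is real, and the projection on the
    eigenspace is a polynomial in that element: with w the minimal polynomial
    and w = v (X - l), it is v(s) / v(l).  Positivity of the trace excludes both
    a factor (X - a)^2 + b^2 and a double root of w. *)
Lemma herm_eigen : exists l (q : A),
  [/\ proj q, q != 0, q * p = q, s * q = l *: q &
      forall y, s * y = y * s -> p * y = y * p -> q * y = y * q].
Proof.
have [pp pS] := p_proj.
(* w is an annihilator of s on the range of p, of least size *)
pose ann n := `[< exists w : {poly R}, [/\ w != 0, size w = n & H w * p = 0] >].
have exN : exists n, ann n.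
  have [w w0 Hw] := finite_dimensional s; exists (size w); apply/asboolP.
  by exists w; rewrite Hw mul0r.
case: (ex_minnP exN) => n /asboolP[w [w0 sw Hw]] min_n {exN}.
have nH (v : {poly R}) : v != 0 -> (size v < size w)%N -> H v * p != 0.
  move=> v0 lt_v; apply/eqP => Hv; move: lt_v; rewrite ltnNge sw min_n //.
  by apply/asboolP; exists v.
have [lt1|le1] := ltnP 1 (size w); last first.
  have [c ew] : exists c, w = c%:P by exists w`_0; apply: size1_polyC.
  move: Hw w0; rewrite ew horner_algC -scalerAl mul1r polyC_eq0 => /eqP.
  by rewrite scaler_eq0 (negPf p0) orbF => ->.
case: (rcf_poly_factor lt1) => [[l [v ew]]|[a [b [v [b0 ew]]]]]; last first.
  have v0 : v != 0 by apply: contraNneq w0 => v0; rewrite ew v0 mul0r.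
  have q_mon : ('X - a%:P) ^+ 2 + (b ^+ 2)%:P \is monic.
    rewrite monicE lead_coefDl ?lead_coef_exp ?lead_coefXsubC ?expr1n //.
    by rewrite size_exp_XsubC (leq_ltn_trans (size_polyC_leq1 _)).
  have sq : size (('X - a%:P) ^+ 2 + (b ^+ 2)%:P) = 3.
    rewrite size_polyDl size_exp_XsubC //.
    by rewrite (leq_ltn_trans (size_polyC_leq1 _)).
  have /eqP[] : H v * p != 0.
    apply: nH => //; rewrite ew size_Mmonic // sq addnC /=.
    by rewrite -[X in (X < _)%N]add0n ltn_add2r.
  (* with y = v(s) p, the square of (s - a) y plus that of b y is w(s) v(s) p = 0 *)
  apply: tr_sqr_eq0; apply/eqP; rewrite -(mulrI_eq0 _ (mulfI b0)).
  rewrite -(mulrI_eq0 _ (mulfI b0)) mulrA -expr2 Hp_herm HpM -trZ.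
  have e : H ('X - a%:P) * (H v * p) = H (('X - a%:P) * v) * p.
    by rewrite mulrA -rmorphM.
  suff : tr (H (('X - a%:P) * v) * p * star (H (('X - a%:P) * v) * p))
      + tr (b ^+ 2 *: (H (v * v) * p)) = 0.
    have := tr_sqr_ge0 (H v * p); rewrite Hp_herm HpM trZ => g1 e1.
    rewrite eq_le mulr_ge0 ?sqr_ge0 // andbT.
    by move: e1 (tr_sqr_ge0 (H (('X - a%:P) * v) * p)); lra.
  rewrite Hp_herm HpM -trD HpZ -mulrDl -rmorphD.
  have -> : ('X - a%:P) * v * (('X - a%:P) * v) + (b ^+ 2)%:P * (v * v) = v * w.
    by rewrite ew; ring.
  by rewrite rmorphM -mulrA Hw mulr0 tr0.
have v0 : v != 0 by apply: contraNneq w0 => v0; rewrite ew v0 mul0r.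
have nHv : H v * p != 0.
  by apply: nH => //; rewrite ew size_Mmonic ?monicXsubC // size_XsubC addn2.
have [r ev] : exists r, v = r * ('X - l%:P) + (v.[l])%:P.
  have : root (v - (v.[l])%:P) l by rewrite rootE !hornerE subrr.
  by case/factor_theorem => r er; exists r; rewrite -er subrK.
have c0 : v.[l] != 0.
  apply: contraNneq nHv => vl0; apply/eqP/Hp_sqr.
  have -> : v * v = r * w by rewrite [X in X * _]ev vl0 addr0 ew; ring.
  by rewrite rmorphM -mulrA Hw mulr0.
exists l, ((v.[l])^-1 *: (H v * p)).
have sH : s * (H v * p) = l *: (H v * p).
  apply/eqP; rewrite -subr_eq0 HpZ -[s in s * _]horner_algX mulrA -rmorphM -mulrBl.
  by rewrite -rmorphB -mulrBl mulrC -ew Hw.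
split.
- split; last by rewrite starZ Hp_herm.
  rewrite -scalerAl -scalerAr; congr (_ *: _); rewrite HpM.
  have -> : v * v = r * w + (v.[l])%:P * v by rewrite [X in X * _]ev ew; ring.
  by rewrite rmorphD mulrDl -HpZ rmorphM -mulrA Hw mulr0 add0r scalerA mulVf // scale1r.
- by rewrite scaler_eq0 negb_or invr_eq0 c0.
- by rewrite -scalerAl -mulrA pp.
- by rewrite -scalerAr sH !scalerA mulrC.
move=> y sy py; rewrite -scalerAl -scalerAr; congr (_ *: _).
by rewrite -mulrA py !mulrA horner_alg_comm.
Qed.

End Spectral.

(** * Groups of unitaries with scalar commutators *)

Lemma tr_cauchy (R : rcfType) (A : traced_algebra R) (x y : A) :
  tr (x * star y) ^+ 2 <= tr (x * star x) * tr (y * star y).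
Proof.
have [->|y0] := eqVneq y 0; first by rewrite star0 !mulr0 tr0 expr0n mulr0.
set c := tr (y * star y); set d := tr (x * star y).
have c0 : 0 < c by apply: tr_sqr_gt0.
have dE : tr (y * star x) = d by rewrite -tr_star starM starK.
have := tr_sqr_ge0 (c *: x - d *: y).
rewrite starB !starZ mulrBl !mulrBr -!scalerAl -!scalerAr !trB !trZ dE -/c -/d.
set a := tr _.
have -> : c * (c * a) - c * (d * d) - (d * (c * d) - d * (d * c)) = c * (a * c - d ^+ 2).
  by ring.
by rewrite pmulr_rge0 // subr_ge0.
Qed.

(** The trace of the compression x |-> p x p is 4 (tr p)^2 by [frame_casimir], and
    p is a fixed vector of this projection.  The bound prevents infinite
    decreasing sequences of projections. *)
Lemma tr_proj_ge (R : rcfType) (A : traced_algebra R) (p : A) : proj p -> p != 0 ->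
  1 <= 4 * tr p ^+ 2.
Proof.
move=> pP p0; have [pp pS] := pP; have t0 := tr_proj_gt0 pP p0.
rewrite -(ler_pM2r t0) mul1r.
have -> : 4 * tr p ^+ 2 = \sum_t tr (p * frame t * p * star (p * frame t * p)).
  have := congr1 (fun x => tr (p * x)) (frame_casimir p).
  rewrite /= -scalerAr mulr1 trZ -mulrA -expr2 => <-.
  rewrite mulr_sumr tr_sum; apply: eq_bigr => t _; rewrite !starM pS.
  by rewrite [LHS]trC -!mulrA [RHS]trC -!mulrA pp (mulrA p p) pp.
rewrite mulr_suml -{1}pp -{2}pS parseval; apply: ler_sum => t _.
have := tr_cauchy (p * frame t * p) p; rewrite pS pp.
have -> : tr (p * frame t * p * p) = tr (p * star (frame t)).
  by rewrite -(mulrA _ p p) pp trC mulrA pp -tr_star starM pS trC.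
by rewrite expr2.
Qed.

Section SignMaximal.
Variables (R : realType) (A : traced_algebra R) (G : A -> Prop).
Implicit Types (x y s p q u v : A).

(** The unitary groups on which commutators are signs, maximal for this
    property: the preimages in the unitary group of A of the maximal abelian
    subgroups of its quotient by -1. *)
Record sign_maximal : Prop := SignMaximal {
  sm_unit : forall u, G u -> unitary u;
  sm_comm : forall u v, G u -> G v -> exists e : bool, u * v = (-1) ^+ e *: (v * u);
  sm_max : forall u, unitary u ->
    (forall v, G v -> exists e : bool, u * v = (-1) ^+ e *: (v * u)) -> G u
}.

Hypothesis GP : sign_maximal.

Definition commutant x := forall g, G g -> x * g = g * x.

Lemma unitary_star u : unitary u -> unitary (star u).
Proof. by case=> u1 u2; split; rewrite starK. Qed.

Lemma unitaryM u v : unitary u -> unitary v -> unitary (u * v).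
Proof.
move=> [u1 u2] [v1 v2]; split; rewrite starM mulrA.
  by rewrite -(mulrA u) v1 mulr1.
by rewrite -(mulrA (star v)) u2 mulr1.
Qed.

Lemma unitary_mulIl u x y : unitary u -> u * x = u * y -> x = y.
Proof. by case=> _ u2 e; rewrite -[x]mul1r -[y]mul1r -u2 -!mulrA e. Qed.

Lemma unitary_mulIr u x y : unitary u -> x * u = y * u -> x = y.
Proof. by case=> u1 _ e; rewrite -[x]mulr1 -[y]mulr1 -u1 !mulrA e. Qed.

Lemma proj_compl p : proj p -> proj (1 - p).
Proof.
by case=> pp pS; split; rewrite ?starB ?star1 ?pS // mulrBl mul1r mulrBr mulr1 pp subrr subr0.
Qed.

Lemma proj_mul_compl p : proj p -> p * (1 - p) = 0 /\ (1 - p) * p = 0.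
Proof. by case=> pp _; rewrite mulrBr mulrBl mul1r mulr1 pp subrr. Qed.

(** Written without scalars, so that products expand by ring identities alone. *)
Definition reflection p := 1 - p - p.

Lemma reflection_herm p : proj p -> star (reflection p) = reflection p.
Proof. by case=> _ pS; rewrite !starB star1 pS. Qed.

Lemma reflection_sqr p : proj p -> reflection p * reflection p = 1.
Proof.
move=> pP; have [pp _] := pP; have [qq _] := proj_compl pP.
have [pq qp] := proj_mul_compl pP; rewrite /reflection.
by rewrite mulrBl mulrBr qq qp subr0 mulrBr pq pp sub0r opprK subrK.
Qed.

Lemma unitary_reflection p : proj p -> unitary (reflection p).
Proof. by move=> pP; split; rewrite reflection_herm ?reflection_sqr. Qed.

Lemma reflectionE p : reflection p = 1 - 2 *: p.
Proof. by rewrite /reflection -addrA -opprD scaler_nat mulr2n. Qed.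

Lemma cmD x y : commutant x -> commutant y -> commutant (x + y).
Proof. by move=> cx cy g Gg; rewrite mulrDl mulrDr cx ?cy. Qed.
Lemma cmN x : commutant x -> commutant (- x).
Proof. by move=> cx g Gg; rewrite mulNr mulrN cx. Qed.
Lemma cmB x y : commutant x -> commutant y -> commutant (x - y).
Proof. by move=> cx cy; apply/cmD/cmN. Qed.
Lemma cmZ a x : commutant x -> commutant (a *: x).
Proof. by move=> cx g Gg; rewrite -scalerAl -scalerAr cx. Qed.
Lemma cm1 : commutant 1.
Proof. by move=> g _; rewrite mul1r mulr1. Qed.
Lemma cm0 : commutant 0.
Proof. by move=> g _; rewrite mul0r mulr0. Qed.
Lemma cmM x y : commutant x -> commutant y -> commutant (x * y).
Proof. by move=> cx cy g Gg; rewrite -mulrA cy // mulrA cx // mulrA. Qed.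
Lemma cm_sum (I : finType) (F : I -> A) : (forall i, commutant (F i)) -> commutant (\sum_i F i).
Proof. by move=> cF g Gg; rewrite mulr_suml mulr_sumr; apply: eq_bigr => i _; apply: cF. Qed.

Lemma sm_star u : G u -> G (star u).
Proof.
move=> Gu; have uU := sm_unit GP Gu; apply: (sm_max GP) (unitary_star uU) _ => v Gv.
have [e uv] := sm_comm GP Gu Gv; exists e.
apply: (unitary_mulIl uU); apply: (unitary_mulIr uU).
have [u1 u2] := uU; rewrite -scalerAr -scalerAl !mulrA u1 mul1r.
by rewrite -(mulrA _ (star u)) u2 mulr1 uv scalerA -signr_addb addbb scale1r.
Qed.

Lemma smM u v : G u -> G v -> G (u * v).
Proof.
move=> Gu Gv; apply: (sm_max GP); first by apply: unitaryM; apply: (sm_unit GP).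
move=> g Gg; have [e ug] := sm_comm GP Gu Gg; have [e' vg] := sm_comm GP Gv Gg.
exists (e' (+) e); rewrite -mulrA vg -scalerAr (mulrA u) ug -scalerAl scalerA (mulrA g).
by rewrite signr_addb.
Qed.

Lemma cm_sm u : unitary u -> commutant u -> G u.
Proof. by move=> uU cu; apply: (sm_max GP) => // v Gv; exists false; rewrite scale1r cu. Qed.

Lemma cm_star x : commutant x -> commutant (star x).
Proof.
move=> cx g Gg; have := cx _ (sm_star Gg) => /(congr1 star).
by rewrite !starM starK.
Qed.

(** The unitary 1 - 2p lies in G. *)
Lemma cm_proj_central p x : commutant p -> proj p -> commutant x -> x * p = p * x.
Proof.
move=> cp pP cx; have Gr : G (reflection p).
  by apply: cm_sm; [apply: unitary_reflection|apply: cmB => //; apply: cmB => //; apply: cm1].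
have := cx _ Gr; rewrite reflectionE mulrBl mulrBr mul1r mulr1 => /addrI/oppr_inj.
by rewrite -scalerAl -scalerAr; apply: scalerI; rewrite pnatr_eq0.
Qed.

(** Minimal projections of the commutant, of which the V_i are the ranges *)
Record atom p : Prop := Atom {
  atom_proj : proj p;
  atom_neq0 : p != 0;
  atom_cm : commutant p;
  atom_min : forall q, proj q -> commutant q -> q * p = q -> q = 0 \/ q = p
}.

Lemma cm_projM p q : commutant p -> commutant q -> proj p -> proj q -> proj (p * q).
Proof.
move=> cp cq pP qP; have pq := cm_proj_central cq qP cp; case: pP qP => pp pS [qq qS].
split; last by rewrite starM pS qS pq.
by rewrite {2}pq mulrA -(mulrA p) qq -mulrA -pq mulrA pp.
Qed.

Lemma atom_orth p q : atom p -> atom q -> p = q \/ p * q = 0.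
Proof.
move=> [pP p0 cp minp] [qP q0 cq minq]; have pq := cm_proj_central cq qP cp.
have [pp _] := pP; have [qq _] := qP.
have P := cm_projM cp cq pP qP; have C := cmM cp cq.
have [|e|e] := minp _ P C; [by rewrite -mulrA -pq mulrA pp|by right|].
have [|e'|e'] := minq _ P C; [by rewrite -mulrA qq|by right|by left; rewrite -e e'].
Qed.

Lemma proj_sub p q : proj p -> proj q -> q * p = q -> proj (p - q).
Proof.
move=> [pp pS] [qq qS] qp; split; last by rewrite starB pS qS.
have pq : p * q = q by have := congr1 star qp; rewrite starM pS qS.
by rewrite mulrBl !mulrBr pp pq qp qq subrr subr0.
Qed.

(** By [tr_proj_ge] a nonzero projection has trace at least 1/2, so descending
    through smaller and smaller projections must end. *)
Lemma sub_atom q : proj q -> commutant q -> q != 0 -> exists2 p, atom p & p * q = p.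
Proof.
move=> qP cq q0; have [n] : exists n, 2 * tr q < n%:R.
  by exists (Num.bound (2 * tr q)); apply: archi_boundP; rewrite mulr_ge0 // ltW // tr_proj_gt0.
elim: n => [|n IH] in q qP cq q0 *.
  by rewrite ltNge mulr_ge0 // ltW // tr_proj_gt0.
move=> lt_q; have [|] := pselect (atom q); first by exists q => //; case: qP.
move=> natom; have [r [rP cr rq r0 nrq]] :
    exists r, [/\ proj r, commutant r, r * q = r, r != 0 & r != q].
  apply: contrapT => nr; apply: natom; split=> // r rP cr rq.
  have [->|r0] := eqVneq r 0; first by left.
  by have [->|nrq] := eqVneq r q; [right|case: nr; exists r].
have dP := proj_sub qP rP rq.
have [|p ap pr] := IH r rP cr r0; last by exists p; rewrite // -pr -mulrA rq.
have := tr_proj_ge dP; rewrite subr_eq0 eq_sym nrq => /(_ isT).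
have := tr_proj_gt0 dP; rewrite subr_eq0 eq_sym nrq => /(_ isT).
rewrite trB; set t := tr q - tr r => t0 t1.
have : 1 <= 2 * t by nra.
by rewrite /t; move: lt_q; rewrite -natr1; lra.
Qed.

Lemma sum_of_atoms q : proj q -> commutant q ->
  exists2 s : seq A, (forall p, p \in s -> atom p) & \sum_(p <- s) p = q.
Proof.
move=> qP cq; have [n] : exists n, 2 * tr q < n%:R.
  have [->|q0] := eqVneq q 0; first by exists 1%N; rewrite tr0 mulr0.
  by exists (Num.bound (2 * tr q)); apply: archi_boundP; rewrite mulr_ge0 // ltW // tr_proj_gt0.
elim: n => [|n IH] in q qP cq *; have [->|q0] := eqVneq q 0.
- by exists [::]; rewrite ?big_nil.
- by rewrite ltNge mulr_ge0 // ltW // tr_proj_gt0.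
- by exists [::]; rewrite ?big_nil.
move=> lt_q; have [p ap pq] := sub_atom qP cq q0.
have [|||s sA sq] := IH (q - p).
- exact: (proj_sub qP (atom_proj ap)).
- exact: (cmB cq (atom_cm ap)).
- have := tr_proj_ge (atom_proj ap) (atom_neq0 ap).
  have t0 := tr_proj_gt0 (atom_proj ap) (atom_neq0 ap) => t1.
  have : 1 <= 2 * tr p by nra.
  by rewrite trB; move: lt_q; rewrite -natr1; lra.
exists (p :: s); last by rewrite big_cons sq addrC subrK.
by move=> r; rewrite inE => /predU1P[->|/sA].
Qed.

End SignMaximal.

(** * The commutant on a minimal projection *)

Section Cells.
Variables (R : realType) (A : traced_algebra R) (G : A -> Prop).
Hypothesis GP : sign_maximal G.
Implicit Types (x y s p q u v J : A).
Local Notation commutant := (commutant G).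
Local Notation atom := (atom G).

(** The spectral projections of s belong to the commutant, so they are 0 or p. *)
Lemma atom_herm p s : atom p -> commutant s -> herm s -> s * p = s -> exists l, s = l *: p.
Proof.
move=> ap cs sS sp; have [l [q [qP q0 qp sq qC]]] := herm_eigen sS (atom_proj ap) sp (atom_neq0 ap).
have cq : commutant q by move=> g Gg; apply: qC; [apply: cs|apply: (atom_cm ap)].
case: (atom_min ap qP cq qp) => [e|e]; first by rewrite e eqxx in q0.
by exists l; rewrite -sp -e.
Qed.

(** For an atom p, the commutant restricted to p is a division algebra with
    abelian unitary group: it is R p when J = 0, and R p + R J, a copy of the
    complex numbers, otherwise. *)
Record cell p J : Prop := Cell {
  cell_atom : atom p;
  cell_cm : commutant J;
  cell_mul : J * p = J;
  cell_skew : star J = - J;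
  cell_sqr : J != 0 -> J * J = - p;
  cell_span : forall x, commutant x -> x * p = x -> exists a b, x = a *: p + b *: J
}.

Lemma cm_sm_commute x y : commutant x -> commutant y -> unitary x -> unitary y -> x * y = y * x.
Proof. by move=> cx cy _ yU; apply: cx; apply: cm_sm. Qed.

Lemma skew_unitary p J : proj p -> J * p = J -> p * J = J -> star J = - J -> J * J = - p ->
  unitary (1 - p + J).
Proof.
move=> pP Jp pJ JS JJ; have [qq qS] := proj_compl pP.
have q1 : (1 - p) * J = 0 by rewrite mulrBl mul1r pJ subrr.
have q2 : J * (1 - p) = 0 by rewrite mulrBr mulr1 Jp subrr.
have qp1 : 1 - p + p = 1 by rewrite subrK.
move: (1 - p) qq qS q1 q2 qp1 => q qq qS q1 q2 qp1.
split; rewrite starD qS JS mulrDl !mulrDr ?mulrN ?mulNr qq q1 q2 JJ opprK.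
  by rewrite oppr0 addr0 add0r.
by rewrite oppr0 addr0 add0r.
Qed.

Lemma atom_skew_sqr p x : atom p -> commutant x -> x * p = x -> star x = - x -> x != 0 ->
  exists2 c, 0 < c & x * x = - (c ^+ 2 *: p).
Proof.
move=> ap cx xp xS x0; have [|||l e] := @atom_herm p (x * x) ap.
- exact: cmM.
- by rewrite /herm starM xS mulrNN.
- by rewrite -mulrA xp.
have t0 := tr_sqr_gt0 x0; have := tr_proj_gt0 (atom_proj ap) (atom_neq0 ap).
rewrite xS mulrN e trN trZ in t0 * => p0.
have l0 : 0 < - l by move: t0; rewrite -mulNr pmulr_lgt0.
by exists (Num.sqrt (- l)); rewrite ?sqrtr_gt0 // sqr_sqrtr ?ltW // scaleNr opprK.
Qed.

Lemma atom_skew_unit p x : atom p -> commutant x -> x * p = x -> star x = - x -> x != 0 ->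
  exists c J, [/\ x = c *: J, c != 0, commutant J, J * p = J & star J = - J /\ J * J = - p].
Proof.
move=> ap cx xp xS x0; have [c c0 e] := atom_skew_sqr ap cx xp xS x0.
exists c, (c^-1 *: x); split.
- by rewrite scalerA divff ?gt_eqF // scale1r.
- by rewrite gt_eqF.
- exact: cmZ.
- by rewrite -scalerAl xp.
rewrite starZ xS scalerN; split=> //.
rewrite -scalerAl -scalerAr e !scalerN !scalerA; rewrite -[in RHS](scale1r p).
congr (- (_ *: _)); field; rewrite gt_eqF //.
Qed.

Lemma atom_comm p x : atom p -> commutant x -> x * p = p * x.
Proof. by move=> ap; exact: (cm_proj_central GP (atom_cm ap) (atom_proj ap)). Qed.

Lemma cell_commute p J x y : cell p J -> commutant x -> commutant y -> x * p = x -> y * p = y -> x * y = y * x.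
Proof.
move=> cP cx cy xp yp; have [[pp _] ap] := (atom_proj (cell_atom cP), cell_atom cP).
have [a [b xE]] := cell_span cP cx xp; have [a' [b' yE]] := cell_span cP cy yp.
have pJ : p * J = J by rewrite -(atom_comm ap (cell_cm cP)) (cell_mul cP).
have yJ : y * J = J * y.
  by rewrite yE mulrDl mulrDr -!scalerAl -!scalerAr pJ (cell_mul cP).
rewrite xE mulrDl mulrDr -!scalerAl -!scalerAr yJ; congr (_ *: _ + _).
exact/esym/(atom_comm ap cy).
Qed.

(** An element of the commutant below p is the sum of a hermitian one, which is a
    scalar, and a skew one.  If J and K are skew and normalised then 1 - p + J and
    1 - p + K are unitaries of the commutant, so they commute; hence J K is
    hermitian, a scalar, and K is a multiple of J. *)
Lemma exists_cell p : atom p -> exists J, cell p J.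
Proof.
move=> ap; have pP := atom_proj ap; have [pp pS] := pP; have cp := atom_cm ap.
have half x : x = 2^-1 *: (x + star x) + 2^-1 *: (x - star x).
  by rewrite -scalerDr addrACA subrr addr0 -mulr2n -scaler_nat scalerA mulVf ?scale1r ?pnatr_eq0.
pose sk x := [/\ commutant x, x * p = x & star x = - x].
have split_cm x : commutant x -> x * p = x -> exists a y, sk y /\ x = a *: p + y.
  move=> cx xp; have cxs := cm_star GP cx.
  have xsp : star x * p = star x by rewrite atom_comm // -[in LHS]pS -starM xp.
  have [|||a e] := @atom_herm p (2^-1 *: (x + star x)) ap.
  - exact/cmZ/cmD.
  - by rewrite /herm starZ starD starK addrC.
  - by rewrite -scalerAl mulrDl xp xsp.
  exists a, (2^-1 *: (x - star x)); split; last by rewrite -e -half.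
  split; first exact/cmZ/cmB.
    by rewrite -scalerAl mulrBl xp xsp.
  by rewrite starZ starB starK -scalerN opprB.
have [|no] := pselect (exists2 x, sk x & x != 0); last first.
  exists 0; split; rewrite ?mul0r ?star0 ?oppr0 ?eqxx //; first exact: cm0.
  move=> x cx xp; have [a [y [sy ->]]] := split_cm x cx xp; exists a, 0.
  suff -> : y = 0 by rewrite scaler0.
  by apply: contrapT => /eqP ny; apply: no; exists y.
case=> x [cx xp xS] x0; have [_ [J [_ _ cJ Jp [JS JJ]]]] := atom_skew_unit ap cx xp xS x0.
have pJ : p * J = J by rewrite -atom_comm.
exists J; split=> // y cy yp; have [a [z [[cz zp zS] ->]]] := split_cm y cy yp.
exists a; have [->|z0] := eqVneq z 0; first by exists 0; rewrite scale0r.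
have [c [K [-> c0 cK Kp [KS KK]]]] := atom_skew_unit ap cz zp zS z0.
have pK : p * K = K by rewrite -atom_comm.
have JK : J * K = K * J.
  have := cm_sm_commute _ _ (skew_unitary pP Jp pJ JS JJ) (skew_unitary pP Kp pK KS KK).
  have [qq _] := proj_compl pP.
  have qJ : (1 - p) * J = 0 by rewrite mulrBl mul1r pJ subrr.
  have qK : (1 - p) * K = 0 by rewrite mulrBl mul1r pK subrr.
  have Jq : J * (1 - p) = 0 by rewrite mulrBr mulr1 Jp subrr.
  have Kq : K * (1 - p) = 0 by rewrite mulrBr mulr1 Kp subrr.
  have C1 L : commutant L -> commutant (1 - p + L) by move=> cL; apply/cmD/cL/cmB/cp/cm1.
  move: (1 - p) qq qJ qK Jq Kq C1 => q qq qJ qK Jq Kq C1 /(_ (C1 _ cJ) (C1 _ cK)).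
  by rewrite !mulrDl !mulrDr qq qJ qK Jq Kq !add0r addr0 => /addrI.
have [|||b e] := @atom_herm p (J * K) ap.
- exact: cmM.
- by rewrite /herm starM JS KS mulrNN.
- by rewrite -mulrA Kp.
exists (- (c * b)); congr (_ + _).
have : J * (J * K) = b *: J by rewrite e -scalerAr Jp.
by rewrite mulrA JJ mulNr pK scaleNr -scalerA => <-; rewrite scalerN opprK.
Qed.
End Cells.

(** * Dimensions *)

(** Both sides are the trace of the operator x |-> sum_i u_i x u_i^* of A, computed
    in the frame: by [frame_casimir] from the left-hand side of the hypothesis, and
    by [frame_parseval] from its right-hand side. *)
Lemma superoperator_trace (R : rcfType) (A : traced_algebra R) (I K : finType)
    (u : I -> A) (b : K -> A) c :
  (forall x, \sum_i u i * x * star (u i) = c *: \sum_k tr (x * star (b k)) *: b k) ->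
  4 * \sum_i tr (u i) ^+ 2 = c * \sum_k tr (b k * star (b k)).
Proof.
move=> e; transitivity (\sum_t tr (\sum_i u i * frame t * star (u i) * star (frame t))).
  rewrite -tr_sum exchange_big tr_sum mulr_sumr; apply: eq_bigr => i _.
  under eq_bigr do rewrite -2!mulrA.
  rewrite -mulr_sumr; under eq_bigr do rewrite mulrA.
  rewrite frame_casimir -scalerAr mulr1 trZ tr_star expr2 mulrA; ring.
under eq_bigr do rewrite -mulr_suml e -scalerAl trZ mulr_suml tr_sum.
rewrite -mulr_sumr exchange_big; congr (_ * _); apply: eq_bigr => k _.
rewrite parseval; apply: eq_bigr => t _; rewrite -scalerAl trZ; congr (_ * _).
by rewrite -tr_star starM starK.
Qed.

Section Dimension.
Variables (R : realType) (A : traced_algebra R) (G : A -> Prop) (p J : A).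
Hypotheses (GP : sign_maximal G) (cP : cell G p J).
Variables (E : finType) (g : E -> A) (e0 : E).
Hypotheses (Gg : forall e, G (g e)) (g1 : g e0 = 1).
Hypothesis gM : forall h, G h -> exists2 s : E -> E, bijective s &
  forall e, exists z, [/\ commutant G z, unitary z & h * g e = g (s e) * z].
Hypothesis g_anti : forall e, e != e0 -> exists2 h, G h & h * g e = - (g e * h).

(** The g e represent the classes of F/ker m, so h permutes them up to the
    commutant, and the class of g e pairs nontrivially with some h unless e = e0. *)
Lemma tr_anticommute x e : commutant G x -> e != e0 -> tr (g e * x) = 0.
Proof.
move=> cx /g_anti[h Gh hg]; have [h1 h2] := sm_unit GP Gh.
have : tr (g e * x) = - tr (g e * x).
  rewrite -{1}[g e]mul1r -h2 -(mulrA _ h) hg mulrN mulNr trN -!mulrA -(cx h) //.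
  by rewrite [in LHS]trC -!mulrA h1 mulr1.
by lra.
Qed.

Let pP : proj p. Proof. exact: atom_proj (cell_atom cP). Qed.
Let pJ : p * J = J.
Proof. by rewrite -(atom_comm GP (cell_atom cP) (cell_cm cP)) (cell_mul cP). Qed.

Lemma cell_tr : tr J = 0.
Proof. by have := tr_star J; rewrite (cell_skew cP) trN; lra. Qed.

Let pos : 0 < tr p. Proof. by apply: tr_proj_gt0 => //; apply: atom_neq0 (cell_atom cP). Qed.

Let avg x := \sum_e g e * x * star (g e).

Let avg_cm x : p * x = x -> x * p = x -> J * x = x * J -> commutant G (avg x) /\ avg x * p = avg x.
Proof.
move=> px xp Jx; have cp := atom_cm (cell_atom cP); split; last first.
  rewrite /avg mulr_suml; apply: eq_bigr => e _.
  by rewrite -mulrA -(cp _ (sm_star GP (Gg e))) mulrA -(mulrA _ x) xp.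
move=> h Gh; have [s bs hs] := gM Gh; have hU := sm_unit GP Gh; have [h1 h2] := hU.
apply: (unitary_mulIr (unitary_star hU)); rewrite -mulrA h1 mulr1.
rewrite {1}/avg (reindex s) /=; last exact: onW_bij.
rewrite /avg mulr_sumr mulr_suml; apply: eq_bigr => e _.
have [z [cz [z1 z2] hg]] := hs e.
rewrite !mulrA hg -(mulrA _ (star _) (star h)) -starM hg starM !mulrA; congr (_ * _).
rewrite -!mulrA; congr (_ * _).
have [|a [b zp]] := cell_span cP (cmM cz cp); first by rewrite -mulrA (proj1 pP).
have zx : z * x = x * z.
  rewrite -px mulrA zp px -[in RHS]xp -(mulrA x) -(atom_comm GP (cell_atom cP) cz) zp.
  by rewrite mulrDl mulrDr -!scalerAl -!scalerAr px xp Jx.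
by rewrite mulrA zx -mulrA z1 mulr1.
Qed.

Let avg_tr x y : commutant G y -> tr (avg x * y) = #|E|%:R * tr (x * y).
Proof.
move=> cy; rewrite mulr_suml tr_sum -sum1_card natr_sum mulr_suml.
apply: eq_bigr => e _; have [u1 u2] := sm_unit GP (Gg e).
by rewrite mul1r -mulrA -(cy _ (sm_star GP (Gg e))) mulrA trC !mulrA u2 mul1r.
Qed.

(** The average of the g e x (g e)^* lies in the commutant, hence is a multiple of
    p.  Among the traces of the g e p only that of p is not 0. *)
Lemma cell_dim_real : J = 0 -> 4 * tr p ^+ 2 = #|E|%:R.
Proof.
move=> J0; have [pp pS] := pP; have pn := lt0r_neq0 pos.
have := @superoperator_trace _ A E 'I_1 (fun e => g e * p) (fun=> p) (#|E|%:R / tr p).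
rewrite (bigD1 e0) //= big1 => [|e ne]; last first.
  by rewrite tr_anticommute ?expr0n //; apply: atom_cm (cell_atom cP).
rewrite g1 mul1r addr0 big_ord1 /= pS pp divfK // => -> // x.
rewrite big_ord1 scalerA.
have -> : \sum_i g i * p * x * star (g i * p) = avg (p * x * p).
  by apply: eq_bigr => e _; rewrite starM pS !mulrA.
have [||| cA Ap] := @avg_cm (p * x * p).
- by rewrite !mulrA pp.
- by rewrite -mulrA pp.
- by rewrite J0 mul0r mulr0.
have [a [b eA]] := cell_span cP cA Ap; rewrite J0 scaler0 addr0 in eA.
rewrite eA; congr (_ *: _); apply: (mulIf pn).
have := avg_tr (p * x * p) (@cm1 _ _ G); rewrite eA !mulr1 trZ => ->.
by rewrite trC !mulrA pp trC mulrAC divfK.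
Qed.

(** As in the real case, but only elements commuting with J have an average in the
    commutant: x is first replaced by p x p - J x J. *)
Lemma cell_dim_complex : J != 0 -> tr p ^+ 2 = #|E|%:R.
Proof.
move=> J0; have [pp pS] := pP; have pn := lt0r_neq0 pos.
have JJ := cell_sqr cP J0; have JS := cell_skew cP; have Jp := cell_mul cP.
pose b2 (b : bool) := if b then J else p.
have sum1 : \sum_(eb : E * bool) tr (g eb.1 * b2 eb.2) ^+ 2 = tr p ^+ 2.
  rewrite -(pair_bigA _ (fun e b => tr (g e * b2 b) ^+ 2)) /= (bigD1 e0) //=.
  rewrite [X in _ + X]big1 => [|e ne]; rewrite big_bool /=; last first.
    rewrite !tr_anticommute ?expr0n ?addr0 //; last exact: cell_cm cP.
    exact: atom_cm (cell_atom cP).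
  by rewrite g1 !mul1r cell_tr expr0n /= add0r addr0.
have := @superoperator_trace _ A (E * bool)%type bool
  (fun eb => g eb.1 * b2 eb.2) b2 (2 * #|E|%:R / tr p).
rewrite sum1 big_bool /= JS mulrN JJ opprK pS pp.
move=> H; apply: (@mulfI _ 4); rewrite ?pnatr_eq0 // H; first by field.
move=> x; rewrite big_bool /= JS pS.
rewrite -(pair_bigA _ (fun e b => g e * b2 b * x * star (g e * b2 b))) /=.
pose T := p * x * p - J * x * J.
have -> : \sum_i \sum_j g i * b2 j * x * star (g i * b2 j) = avg T.
  apply: eq_bigr => e _; rewrite big_bool /= !starM pS JS /T mulrBr mulrBl addrC.
  by rewrite mulNr !mulrN !mulrA.
have pT : p * T = T by rewrite /T mulrBr !mulrA pp pJ.
have Tp : T * p = T by rewrite /T mulrBl -!mulrA pp Jp.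
have JT : J * T = T * J.
  rewrite /T mulrBr mulrBl !mulrA Jp JJ -!mulrA pJ JJ !mulNr !mulrN !opprK addrC.
  by [].
have [cA Ap] := avg_cm pT Tp JT.
have [a [b eA]] := cell_span cP cA Ap.
have tT : tr T = 2 * tr (x * p).
  rewrite /T trB trC mulrA pp trC [tr (J * x * J)]trC mulrA JJ mulNr trN trC; ring.
have tTJ : tr (T * J) = 2 * tr (x * J).
  rewrite -JT /T mulrBr trB !mulrA Jp JJ !mulNr trN opprK.
  rewrite [tr (_ * p)]trC mulrA pJ [tr (p * x * J)]trC !mulrA Jp trC; ring.
have ea : a * tr p = 2 * #|E|%:R * tr (x * p).
  have := avg_tr T (@cm1 _ _ G); rewrite eA !mulr1 trD !trZ cell_tr mulr0 addr0 tT => ->.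
  by ring.
have eb : b * tr p = - (2 * #|E|%:R * tr (x * J)).
  have := avg_tr T (cell_cm cP); rewrite eA mulrDl -!scalerAl pJ JJ trD !trZ trN cell_tr tTJ; lra.
rewrite eA scalerDr addrC !scalerA; congr (_ *: _ + _ *: _).
  by apply: (mulIf pn); rewrite eb mulrN trN; field.
by apply: (mulIf pn); rewrite ea; field.
Qed.

End Dimension.

(** * Intertwiners *)

Section Intertwiner.
Variables (R : realType) (A : traced_algebra R) (G : A -> Prop).
Hypothesis GP : sign_maximal G.
Implicit Types (x y p q J T : A).

(** This holds when the g l and the commutant generate G. *)
Definition generating d (g : 'I_d -> A) :=
  (forall l, G (g l)) /\
  forall x, (forall l, x * g l = g l * x) -> (forall z, commutant G z -> x * z = z * x) -> commutant G x.

Lemma corner_cm d (g : 'I_d -> A) p J x : generating g -> cell G p J ->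
  p * x = x -> x * p = x -> x * J = J * x -> (forall l, x * g l = g l * x) -> commutant G x.
Proof.
move=> [_ gen] cP px xp xJ xg; have cp := atom_cm (cell_atom cP).
apply: gen => // z cz; have zC := atom_comm GP (cell_atom cP) cz.
have [|a [b zp]] := cell_span cP (cmM cz cp).
  by rewrite -mulrA; case: (atom_proj (cell_atom cP)) => ->.
rewrite -{1}xp -{2}px (mulrA z) -(mulrA x) -zC zp mulrDl mulrDr.
by rewrite -!scalerAl -!scalerAr px xp xJ.
Qed.

Variables (p J p' J' : A) (e : bool).
Hypotheses (cP : cell G p J) (cP' : cell G p' J') (JJ' : (J == 0) = (J' == 0)).
Let pp : p * p = p. Proof. exact: (proj1 (atom_proj (cell_atom cP))). Qed.
Let pp' : p' * p' = p'. Proof. exact: (proj1 (atom_proj (cell_atom cP'))). Qed.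
Let pJ : p * J = J.
Proof. by rewrite -(atom_comm GP (cell_atom cP) (cell_cm cP)) (cell_mul cP). Qed.
Let pJ' : p' * J' = J'.
Proof. by rewrite -(atom_comm GP (cell_atom cP') (cell_cm cP')) (cell_mul cP'). Qed.

Definition semilinear T := [/\ p' * T = T, T * p = T & T * J = (-1) ^+ e *: (J' * T)].

(** In the complex case T = p' y p - (+-J' y J) intertwines J and J'.  If it were 0
    for all y, summing the equality p' f p f^* = +-J' f J f^* over the frame would give
    4 (tr p) p' = +-4 (tr J) J', which is 0 as J is skew. *)
Lemma exists_semilinear : exists2 T, T != 0 & semilinear T.
Proof.
have [J0|J0] := eqVneq J 0.
  have J'0 : J' = 0 by apply/eqP; rewrite -JJ' J0.
  have [x nx] := prime_algebra (atom_neq0 (cell_atom cP')) (atom_neq0 (cell_atom cP)).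
  exists (p' * x * p) => //; rewrite /semilinear J0 J'0 mulr0 mul0r scaler0.
  by rewrite !mulrA pp' -(mulrA (p' * x)) pp.
have J'0 : J' != 0 by rewrite -JJ'.
have JJ := cell_sqr cP J0; have JJ2 := cell_sqr cP' J'0.
pose S y := p' * y * p - (-1) ^+ e *: (J' * y * J).
suff [y ny] : exists y, S y != 0.
  exists (S y) => //; rewrite /semilinear /S; split.
  - by rewrite mulrBr -scalerAr !mulrA pp' pJ'.
  - by rewrite mulrBl -scalerAl -!mulrA pp (cell_mul cP).
  rewrite mulrBl mulrBr -scalerAl -scalerAr !mulrA (cell_mul cP') JJ2 -!mulrA JJ pJ.
  rewrite scalerBr scalerA -signr_addb addbb scale1r !mulNr !mulrN scalerN !opprK addrC.
  by rewrite !mulrA.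
apply: contrapT => /forallNP S0.
have e0 y : p' * y * p = (-1) ^+ e *: (J' * y * J).
  by apply/eqP; rewrite -subr_eq0; apply/negPn/negP/S0.
have := congr1 ( *%R p') (frame_casimir p).
rewrite mulr_sumr (_ : \sum_i _ = 0); last first.
  transitivity ((-1) ^+ e *: (J' * \sum_t frame t * J * star (frame t))).
    rewrite mulr_sumr scaler_sumr; apply: eq_bigr => t _.
    by rewrite !mulrA e0 -scalerAl.
  by rewrite frame_casimir (cell_tr cP) mulr0 scale0r mulr0 scaler0.
rewrite -scalerAr mulr1 => /esym/eqP; rewrite scaler_eq0 mulf_eq0 pnatr_eq0 /=.
rewrite (negPf (atom_neq0 (cell_atom cP'))) orbF gt_eqF //.
by apply: tr_proj_gt0; [apply: atom_proj (cell_atom cP)|apply: atom_neq0 (cell_atom cP)].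
Qed.

Variables (d : nat) (g g' : 'I_d -> A) (nu : 'I_d -> bool).
Hypotheses (gen : generating g) (gen' : generating g').
Hypothesis same_comm : forall l k (b : bool),
  g l * g k = (-1) ^+ b *: (g k * g l) -> g' l * g' k = (-1) ^+ b *: (g' k * g' l).
Hypothesis nondeg : forall chi : 'I_d -> bool,
  exists2 b, G b & forall l, g l * b = (-1) ^+ chi l *: (b * g l).
Hypotheses (sqr : forall l, g l * g l * p = (-1) ^+ nu l *: p)
           (sqr' : forall l, g' l * g' l * p' = (-1) ^+ nu l *: p').

Let gU l : g l * star (g l) = 1 /\ star (g l) * g l = 1.
Proof. exact: (sm_unit GP (proj1 gen l)). Qed.
Let gU' l : g' l * star (g' l) = 1 /\ star (g' l) * g' l = 1.
Proof. exact: (sm_unit GP (proj1 gen' l)). Qed.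
Let pC x : G x -> p * x = x * p. Proof. exact: (atom_cm (cell_atom cP)). Qed.
Let pC' x : G x -> p' * x = x * p'. Proof. exact: (atom_cm (cell_atom cP')). Qed.

(** The maps T |-> g' l T (g l)^-1 are commuting involutions, because the signs
    of the commutators and of the squares agree. *)
Lemma exists_eigenvector : exists T chi,
  [/\ T != 0, semilinear T & forall l, g' l * T = (-1) ^+ (chi l : bool) *: (T * g l)].
Proof.
suff H (s : seq 'I_d) : exists T chi, [/\ T != 0, semilinear T &
    forall l, l \in s -> g' l * T = (-1) ^+ (chi l : bool) *: (T * g l)].
  have [T [chi [T0 sT H0]]] := H (enum 'I_d).
  by exists T, chi; split=> // l; apply: H0; rewrite mem_enum.
elim: s => [|l s [T [chi [T0 sT Hs]]]].
  by have [T T0 sT] := exists_semilinear; exists T, (fun=> false).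
have [p'T Tp TJ] := sT.
pose U := g' l * T * star (g l).
have g'T : g' l * T = U * g l by rewrite /U -mulrA (proj2 (gU l)) mulr1.
have g'U : g' l * U = T * g l.
  have sq : g' l * (g' l * T) = T * g l * g l.
    transitivity (T * (g l * g l * p)).
      by rewrite sqr -scalerAr Tp mulrA -{1}p'T mulrA sqr' -scalerAl p'T.
    by rewrite -(pC (smM GP (proj1 gen l) (proj1 gen l))) mulrA Tp mulrA.
  by rewrite /U mulrA sq -mulrA (proj1 (gU l)) mulr1.
have sU : semilinear U.
  split; rewrite /U.
  - by rewrite !mulrA (pC' (proj1 gen' l)) -(mulrA _ p') p'T.
  - by rewrite -!mulrA -(pC (sm_star GP (proj1 gen l))) (mulrA T) Tp.
  - rewrite -mulrA -(cell_cm cP (sm_star GP (proj1 gen l))) mulrA -(mulrA (g' l)) TJ.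
    by rewrite -scalerAr -scalerAl !mulrA (cell_cm cP' (proj1 gen' l)).
have HU k : k \in s -> g' k * U = (-1) ^+ chi k *: (U * g k).
  move=> ks; have [b gg] := sm_comm GP (proj1 gen k) (proj1 gen l).
  rewrite /U !mulrA (same_comm gg) -!scalerAl -(mulrA (g' l) (g' k)) Hs // -scalerAr -scalerAl.
  rewrite scalerA mulrC -scalerA; congr (_ *: _); rewrite -!mulrA scalerAr scalerAr.
  congr (_ * (_ * _)).
  apply: (unitary_mulIr (sm_unit GP (proj1 gen l))).
  by rewrite -scalerAl -!mulrA (proj2 (gU l)) mulr1 gg -scalerAr mulrA (proj2 (gU l)) mul1r.
(* U = g' T g^-1, so T + U is fixed by the involution and T is negated by it when
   T + U = 0 *)
have [TU|TU] := eqVneq (T + U) 0.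
  have UT : U = - T by apply/eqP; rewrite -addr_eq0 addrC TU.
  exists T, (fun k => if k \in s then chi k else true); split=> // k; rewrite inE.
  case: ifP => [ks _|_]; first exact: Hs.
  by rewrite orbF => /eqP ->; rewrite g'T UT mulNr scaleN1r.
exists (T + U), (fun k => if k \in s then chi k else false); split=> //.
  have [p'U Up UJ] := sU.
  by split; rewrite ?mulrDl ?mulrDr ?p'T ?p'U ?Tp ?Up // TJ UJ scalerDr.
move=> k; rewrite inE; case: ifP => [ks _|_].
  by rewrite mulrDl mulrDr Hs // HU // scalerDr.
by rewrite orbF => /eqP ->; rewrite scale1r mulrDl mulrDr g'T g'U addrC.
Qed.

(** The signs of a common eigenvector are removed by an element of G.  Schur's
    lemma then makes the resulting intertwiner an isometry up to a scalar. *)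
Lemma intertwiner : exists T, [/\ semilinear T, star T * T = p, T * star T = p' &
  forall l, T * g l = g' l * T].
Proof.
have [T0 [chi [T00 [p'T0 T0p T0J] g'T0]]] := exists_eigenvector.
have [b Gb gb] := nondeg chi; have bU := sm_unit GP Gb.
(* g' T0 b = chi T0 g b and g b = chi b g: the signs cancel *)
pose T := T0 * b.
have T_neq0 : T != 0.
  by apply: contraNneq T00 => e0; apply/eqP/(unitary_mulIr bU); rewrite mul0r.
have p'T : p' * T = T by rewrite /T mulrA p'T0.
have Tp : T * p = T by rewrite /T -mulrA -(pC Gb) mulrA T0p.
have TJ : T * J = (-1) ^+ e *: (J' * T).
  by rewrite /T -mulrA -(cell_cm cP Gb) mulrA T0J -scalerAl mulrA.
have Tg l : T * g l = g' l * T.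
  rewrite /T mulrA g'T0 -scalerAl -(mulrA T0 (g l)) gb -scalerAr scalerA.
  by rewrite -signr_addb addbb scale1r mulrA.
have pS := proj2 (atom_proj (cell_atom cP)); have pS' := proj2 (atom_proj (cell_atom cP')).
have gT l : g l * star T = star T * g' l.
  apply: (unitary_mulIr (unitary_star (gU' l))).
  rewrite -!mulrA (proj1 (gU' l)) mulr1 -starM -Tg starM mulrA.
  by rewrite (proj1 (gU l)) mul1r.
have TJ' : J * star T = (-1) ^+ e *: (star T * J').
  have /(congr1 star) := TJ; rewrite starZ !starM (cell_skew cP) (cell_skew cP').
  by rewrite mulNr mulrN scalerN => /oppr_inj.
have TJ'' : star T * J' = (-1) ^+ e *: (J * star T).
  by rewrite TJ' scalerA -signr_addb addbb scale1r.
have pT' : p * star T = star T by have := congr1 star Tp; rewrite starM pS.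
have Tp' : star T * p' = star T by have := congr1 star p'T; rewrite starM pS'.
have [|||l Tl] := @atom_herm _ _ _ p (star T * T) (cell_atom cP).
- apply: (corner_cm gen cP); first by rewrite mulrA pT'.
  + by rewrite -mulrA Tp.
  + by rewrite -mulrA TJ mulrA TJ' -scalerAl -scalerAr mulrA.
  + by move=> k; rewrite -mulrA Tg !mulrA gT.
- by rewrite /herm starM starK.
- by rewrite -mulrA Tp.
have [|||m Tm] := @atom_herm _ _ _ p' (T * star T) (cell_atom cP').
- apply: (corner_cm gen' cP'); first by rewrite mulrA p'T.
  + by rewrite -mulrA Tp'.
  + rewrite -mulrA TJ'' -scalerAr (mulrA T J) TJ -scalerAl scalerA.
    by rewrite -signr_addb addbb scale1r -mulrA.
  + by move=> k; rewrite mulrA -Tg -!mulrA -gT.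
- by rewrite /herm starM starK.
- by rewrite -mulrA Tp'.
have l0 : 0 < l.
  have := tr_sqr_gt0 T_neq0; rewrite trC Tl trZ pmulr_lgt0 //.
  by apply: tr_proj_gt0; [apply: atom_proj (cell_atom cP)|apply: atom_neq0 (cell_atom cP)].
have r0 : Num.sqrt l != 0 by rewrite gt_eqF // sqrtr_gt0.
have rl : (Num.sqrt l)^-1 * (Num.sqrt l)^-1 * l = 1.
  by rewrite -{3}(sqr_sqrtr (ltW l0)); field.
have m_l : m = l.
  have: T * (star T * T) = m *: T by rewrite mulrA Tm -scalerAl p'T.
  rewrite Tl -scalerAr Tp => /eqP; rewrite -subr_eq0 -scalerBl scaler_eq0 (negPf T_neq0) orbF.
  by rewrite subr_eq0 => /eqP.
exists ((Num.sqrt l)^-1 *: T); split.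
- by split; rewrite -?scalerAl -?scalerAr ?p'T ?Tp // TJ !scalerA mulrC.
- by rewrite starZ -scalerAl -scalerAr scalerA Tl scalerA rl scale1r.
- by rewrite starZ -scalerAl -scalerAr scalerA Tm scalerA m_l rl scale1r.
by move=> k; rewrite -scalerAl -scalerAr Tg.
Qed.

End Intertwiner.

(** A unitary that permutes the atoms, transports the complex structures with
    prescribed signs and the family g to g'; it exists because these data
    satisfy the same relations on each atom. *)
Lemma realization (R : realType) (A : traced_algebra R) (G : A -> Prop) (I : finType)
    (P J : I -> A) (rho : I -> I) (eta : I -> bool) d (g g' : 'I_d -> A)
    (nu : I -> 'I_d -> bool) :
  sign_maximal G -> (forall i, cell G (P i) (J i)) ->
  (forall i j, i != j -> P i * P j = 0) -> \sum_i P i = 1 ->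
  bijective rho -> (forall i, (J (rho i) == 0) = (J i == 0)) ->
  generating G g -> generating G g' ->
  (forall l k (b : bool),
     g l * g k = (-1) ^+ b *: (g k * g l) -> g' l * g' k = (-1) ^+ b *: (g' k * g' l)) ->
  (forall chi : 'I_d -> bool,
     exists2 b, G b & forall l, g l * b = (-1) ^+ chi l *: (b * g l)) ->
  (forall i l, g l * g l * P (rho i) = (-1) ^+ nu i l *: P (rho i)) ->
  (forall i l, g' l * g' l * P i = (-1) ^+ nu i l *: P i) ->
  exists X, [/\ unitary X, forall i, P i * X = X * P (rho i),
    forall i, J i * X = (-1) ^+ eta i *: (X * J (rho i)) & forall l, X * g l = g' l * X].
Proof.
move=> GP cP Porth P1 bij_rho rhoJ gen gen' same_comm nondeg sqr sqr'.
have pp i : P i * P i = P i by exact: (proj1 (atom_proj (cell_atom (cP i)))).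
have pS i : star (P i) = P i by exact: (proj2 (atom_proj (cell_atom (cP i)))).
have JP i : J i * P i = J i := cell_mul (cP i).
have PJ i : P i * J i = J i.
  by rewrite -(atom_comm GP (cell_atom (cP i)) (cell_cm (cP i))) JP.
have PPr i (F : I -> A) : (forall k, P k * F k = F k) -> P i * \sum_k F k = F i.
  move=> PF; rewrite (bigD1 i) //= mulrDr PF mulr_sumr big1 ?addr0 // => k nk.
  by rewrite -PF mulrA Porth ?mul0r // eq_sym.
have rho_inj := bij_inj bij_rho.
have ex i : exists T, [/\ semilinear (P (rho i)) (J (rho i)) (P i) (J i) (eta i) T,
    star T * T = P (rho i), T * star T = P i & forall l, T * g l = g' l * T].
  exact: (intertwiner GP (eta i) (cP _) (cP _) (rhoJ i) gen gen' same_comm nondeg (sqr i) (sqr' i)).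
have [T HT] := choice ex; exists (\sum_i T i).
have PT i : P i * T i = T i by have [[]] := HT i.
have TP i : T i * P (rho i) = T i by have [[]] := HT i.
have PX i : P i * \sum_k T k = T i by apply: PPr.
have XP i : (\sum_k T k) * P (rho i) = T i.
  rewrite mulr_suml (bigD1 i) //= TP big1 ?addr0 // => k nk.
  by rewrite -TP -mulrA Porth ?mulr0 // (inj_eq rho_inj).
split.
- split.
    rewrite {1}mulr_suml -P1; apply: eq_bigr => i _.
    by rewrite -{1}(TP i) -mulrA -{1}(pS (rho i)) -starM XP; have [_ _ ->] := HT i.
  rewrite star_sum mulr_suml -P1 [RHS](reindex rho) /=; last exact: onW_bij.
  apply: eq_bigr => i _.
  by rewrite -{1}(PT i) starM pS -mulrA PX; have [_ ->] := HT i.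
- by move=> i; rewrite PX XP.
- move=> i; rewrite -{1}(JP i) -(PJ (rho i)) -mulrA PX (mulrA _ (P _)) XP.
  have [[_ _ ->]] := HT i; by rewrite scalerA -signr_addb addbb scale1r.
move=> l; rewrite mulr_suml mulr_sumr; apply: eq_bigr => i _.
by have [_ _ _ ->] := HT i.
Qed.

Section ComplexCell.
Variables (R : realType) (A : traced_algebra R) (G : A -> Prop) (p J : A).
Hypotheses (GP : sign_maximal G) (cP : cell G p J) (J0 : J != 0).
Local Notation "a +J* b" := (a *: p + b *: J) (at level 50).

Lemma cellM a b c d : (a +J* b) * (c +J* d) = (a * c - b * d) +J* (a * d + b * c).
Proof.
have [pp _] := atom_proj (cell_atom cP); have Jp := cell_mul cP.
have pJ : p * J = J by rewrite -(atom_comm GP (cell_atom cP) (cell_cm cP)).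
rewrite mulrDl !mulrDr -!scalerAl -!scalerAr pp pJ Jp (cell_sqr cP J0) !scalerA.
by rewrite scalerN !scalerDl scaleNr [X in _ + X]addrC addrACA.
Qed.

Lemma cell_star a b : star (a +J* b) = a +J* (- b).
Proof.
by rewrite starD !starZ (proj2 (atom_proj (cell_atom cP))) (cell_skew cP) scalerN scaleNr.
Qed.

Lemma cell_inj a b c d : a +J* b = c +J* d -> a = c /\ b = d.
Proof.
have pos : 0 < tr p.
  by apply: tr_proj_gt0; [exact: (atom_proj (cell_atom cP))|exact: (atom_neq0 (cell_atom cP))].
have tE u v : tr (u +J* v) = u * tr p.
  by rewrite trD !trZ (cell_tr cP) mulr0 addr0.
move=> e; have ac : a = c.
  by apply: (mulIf (lt0r_neq0 pos)); rewrite -(tE a b) e tE.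
split=> //; apply/eqP; rewrite -subr_eq0; move: e; rewrite ac => /addrI/eqP.
by rewrite -subr_eq0 -scalerBl scaler_eq0 (negPf J0) orbF.
Qed.

(** Every element a + i b of the unit circle has an inverse square root g + i d,
    with g = sqrt((1 + a)/2) and d = -b/(2g) unless a = -1. *)
Lemma cell_sqrt x : commutant G x -> unitary x -> exists z,
  [/\ commutant G z, z * p = z, z * star z = p & z * z * (x * p) = p].
Proof.
move=> cx [x1 x2]; have ap := cell_atom cP; have [pp pS] := atom_proj ap.
have cp := atom_cm ap; have Jp := cell_mul cP.
have [|a [b xE]] := cell_span cP (cmM cx cp); first by rewrite -mulrA pp.
have /cell_inj[ab _] : (a ^+ 2 + b ^+ 2) +J* 0 = 1 +J* 0.
  rewrite !scale0r !addr0 scale1r.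
  transitivity (x * p * star (x * p)).
    by rewrite xE cell_star cellM -[LHS]addr0 -(scale0r J); congr (_ *: _ + _ *: _); ring.
  rewrite starM pS mulrA -(mulrA x) pp -mulrA -(atom_comm GP ap (cm_star GP cx)).
  by rewrite mulrA x1 mul1r.
have pE : p = 1 +J* 0 :> A by rewrite scale1r scale0r addr0.
have fin (g d : R) : g ^+ 2 + d ^+ 2 = 1 -> (g ^+ 2 - d ^+ 2) * a - 2 * g * d * b = 1 ->
    (g ^+ 2 - d ^+ 2) * b + 2 * g * d * a = 0 -> exists z,
    [/\ commutant G z, z * p = z, z * star z = p & z * z * (x * p) = p].
  move=> e1 e2 e3; exists (g +J* d); split.
  - by apply: cmD; apply: cmZ => //; apply: (cell_cm cP).
  - by rewrite mulrDl -!scalerAl pp Jp.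
  - by rewrite cell_star cellM [RHS]pE; congr (_ *: _ + _ *: _); rewrite -?e1; ring.
  - rewrite xE !cellM [RHS]pE; congr (_ *: _ + _ *: _); first by rewrite -e2; ring.
    by rewrite -[RHS]e3; ring.
have [a1|a1] := eqVneq a (-1).
  have b0 : b = 0 by apply/eqP; rewrite -sqrf_eq0; apply/eqP; move: ab; rewrite a1; lra.
  by apply: (fin 0 1); rewrite ?a1 ?b0; ring.
have a2 : -1 < a.
  rewrite lt_neqAle eq_sym a1 /= leNgt; apply/negP => lt_a.
  have u0 : 0 < -1 - a by lra.
  have v0 : 0 < 1 - a by lra.
  have := mulr_gt0 u0 v0; have := sqr_ge0 b; lra.
pose g := Num.sqrt ((1 + a) / 2).
have g2 : g ^+ 2 = (1 + a) / 2 by rewrite sqr_sqrtr //; lra.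
have g0 : g != 0 by rewrite gt_eqF // sqrtr_gt0; lra.
have ab' : b ^+ 2 = (1 - a) * (1 + a) by move: ab; lra.
have d2 : (- b / (2 * g)) ^+ 2 = (1 - a) / 2.
  have n1a : 1 + a != 0 by rewrite gt_eqF //; lra.
  by rewrite expr_div_n sqrrN exprMn g2 ab'; field.
have gd : 2 * g * (- b / (2 * g)) = - b by field.
by apply: (fin g (- b / (2 * g))); rewrite ?gd ?g2 ?d2; lra.
Qed.

End ComplexCell.

(** Assembles a unitary from diagonal blocks w i, unitary in the corner of P i. *)
Lemma glue (R : rcfType) (A : traced_algebra R) (I : finType) (P w : I -> A) :
  (forall i, star (P i) = P i) -> (forall i j, i != j -> P i * P j = 0) -> \sum_i P i = 1 ->
  (forall i, P i * w i = w i) -> (forall i, w i * P i = w i) ->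
  (forall i, w i * star (w i) = P i) -> (forall i, star (w i) * w i = P i) ->
  [/\ unitary (\sum_i w i), forall i, P i * \sum_j w j = w i & forall i, (\sum_j w j) * P i = w i].
Proof.
move=> PS orth P1 Pw wP ww' w'w.
have PW i : P i * \sum_j w j = w i.
  rewrite mulr_sumr (bigD1 i) //= Pw big1 ?addr0 // => j nj.
  by rewrite -Pw mulrA orth ?mul0r // eq_sym.
have WP i : (\sum_j w j) * P i = w i.
  rewrite mulr_suml (bigD1 i) //= wP big1 ?addr0 // => j nj.
  by rewrite -wP -mulrA orth ?mulr0.
split=> //; split; rewrite star_sum.
  rewrite {1}mulr_suml -P1; apply: eq_bigr => i _.
  by rewrite -{1}wP -mulrA -[P i in LHS]PS -star_sum -starM WP ww'.
rewrite mulr_suml -P1; apply: eq_bigr => i _.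
by rewrite -{1}Pw starM PS -mulrA PW w'w.
Qed.

(** * Quaternionic matrices *)

Section QuaternionMatrices.
Variables (R : realType) (n : nat).

Definition qreal (a : R) : quat R := Quat a 0 0 0.

Definition qmat : Type := 'M[quat R]_n.+1.
HB.instance Definition _ := GRing.NzRing.on qmat.

Definition qmat_scale (a : R) (x : qmat) : qmat := (qreal a *: (x : 'M_n.+1)).

Lemma qrealC a (x : quat R) : x * qreal a = qreal a * x.
Proof. by congr Quat => /=; ring. Qed.

Lemma qrealM a b : qreal (a * b) = qreal a * qreal b.
Proof. by congr Quat => /=; ring. Qed.

Lemma qrealD a b : qreal (a + b) = qreal a + qreal b.
Proof. by congr Quat => /=; ring. Qed.

Lemma qmat_scaleA a b x : qmat_scale a (qmat_scale b x) = qmat_scale (a * b) x.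
Proof. by rewrite /qmat_scale scalerA qrealM. Qed.
Lemma qmat_scale1 : left_id 1 qmat_scale.
Proof. by move=> x; rewrite /qmat_scale scale1r. Qed.
Lemma qmat_scaleDr : right_distributive qmat_scale +%R.
Proof. by move=> a x y; rewrite /qmat_scale scalerDr. Qed.
Lemma qmat_scaleDl x : {morph qmat_scale^~ x : a b / a + b}.
Proof. by move=> a b; rewrite /qmat_scale qrealD scalerDl. Qed.

HB.instance Definition _ := GRing.Zmodule_isLmodule.Build R qmat
  qmat_scaleA qmat_scale1 qmat_scaleDr qmat_scaleDl.

Lemma qmat_scaleAl a (x y : qmat) : a *: (x * y) = a *: x * y.
Proof. exact: scalemxAl. Qed.
HB.instance Definition _ := GRing.Lmodule_isLalgebra.Build R qmat qmat_scaleAl.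

(** Real quaternions are central. *)
Lemma qmat_scaleAr a (x y : qmat) : a *: (x * y) = x * (a *: y).
Proof.
apply/matrixP => i j; rewrite !mxE mulr_sumr; apply: eq_bigr => k _.
by rewrite !mxE mulrA -qrealC mulrA.
Qed.
HB.instance Definition _ := GRing.Lalgebra_isAlgebra.Build R qmat qmat_scaleAr.

Lemma qmat_scaleE a (x : qmat) i j : (a *: x : qmat) i j = qreal a * x i j.
Proof. exact: mxE. Qed.

Definition qstar (x : qmat) : qmat := conjtr x.
Definition qtr (x : qmat) : R := qre (\tr x).
Definition qunit (u : 'I_4) : quat R :=
  nth 0 [:: Quat 1 0 0 0; Quat 0 1 0 0; Quat 0 0 1 0; Quat 0 0 0 1] u.
Definition qframe (t : 'I_n.+1 * 'I_n.+1 * 'I_4) : qmat :=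
  \matrix_(i, j) if (i == t.1.1) && (j == t.1.2) then qunit t.2 else 0.

Lemma qreD (x y : quat R) : qre (x + y) = qre x + qre y. Proof. by []. Qed.
Lemma qreM (x y : quat R) : qre (x * y) = qre (y * x). Proof. by rewrite /=; ring. Qed.
Lemma qconj_real a : qconj (qreal a) = qreal a. Proof. by congr Quat; rewrite oppr0. Qed.
Lemma qre_sum (I : finType) (F : I -> quat R) : qre (\sum_i F i) = \sum_i qre (F i).
Proof. exact: (big_morph _ qreD (erefl : qre 0 = 0)). Qed.

Lemma qtrE x : qtr x = \sum_i qre (x i i).
Proof. by rewrite /qtr /mxtrace qre_sum. Qed.

(** This holds for rectangular matrices, so that traces count dimensions. *)
Lemma qre_mxtraceC (m p : nat) (x : 'M[quat R]_(m, p)) (y : 'M_(p, m)) :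
  qre (\tr (x *m y)) = qre (\tr (y *m x)).
Proof.
rewrite /mxtrace !qre_sum; under eq_bigr do rewrite mxE qre_sum.
rewrite exchange_big; apply: eq_bigr => i _; rewrite mxE qre_sum.
by apply: eq_bigr => j _; apply: qreM.
Qed.

Lemma qstarD x y : qstar (x + y) = qstar x + qstar y.
Proof. by apply/matrixP => i j; rewrite !mxE qconjD. Qed.
Lemma qstarZ a x : qstar (a *: x) = a *: qstar x.
Proof. by apply/matrixP => i j; rewrite !mxE qconjM qconj_real qrealC. Qed.
Lemma qstarM x y : qstar (x * y) = qstar y * qstar x. Proof. exact: conjtrM. Qed.
Lemma qstarK : involutive qstar. Proof. exact: conjtrK. Qed.
Lemma qtrD x y : qtr (x + y) = qtr x + qtr y. Proof. by rewrite /qtr mxtraceD. Qed.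
Lemma qtrZ a x : qtr (a *: x) = a * qtr x.
Proof.
rewrite !qtrE mulr_sumr; apply: eq_bigr => i _; rewrite qmat_scaleE /=; ring.
Qed.
Lemma qtrC x y : qtr (x * y) = qtr (y * x). Proof. exact: qre_mxtraceC. Qed.
Lemma qtr_star x : qtr (qstar x) = qtr x.
Proof. by rewrite !qtrE; apply: eq_bigr => i _; rewrite mxE. Qed.

Lemma sum_qunit (F : quat R -> quat R) : \sum_u F (qunit u) =
  F (Quat 1 0 0 0) + (F (Quat 0 1 0 0) + (F (Quat 0 0 1 0) + F (Quat 0 0 0 1))).
Proof. by rewrite !big_ord_recl big_ord0 addr0. Qed.

Lemma qframe_mulE t x i j : (qframe t * x) i j = if i == t.1.1 then qunit t.2 * x t.1.2 j else 0.
Proof.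
rewrite mxE (bigD1 t.1.2) //= big1 ?addr0 => [|k nk]; rewrite mxE ?eqxx ?(negPf nk) ?andbF ?andbT ?mul0r //.
by case: ifP => // _; rewrite mul0r.
Qed.

Lemma qframe_casimir x : \sum_t qframe t * x * qstar (qframe t) = (4 * qtr x) *: 1.
Proof.
apply/matrixP => i j; rewrite summxE qmat_scaleE.
rewrite -(pair_bigA _ (fun xy u => (qframe (xy, u) * x * qstar (qframe (xy, u))) i j)) /=.
rewrite -(pair_bigA _ (fun a b => \sum_u (qframe (a, b, u) * x * qstar (qframe (a, b, u))) i j)) /=.
have e a b u : (qframe (a, b, u) * x * qstar (qframe (a, b, u))) i j =
    if (i == a) && (j == a) then qunit u * x b b * qconj (qunit u) else 0.
  rewrite mxE (bigD1 b) //= big1 ?addr0 => [|k nk]; last first.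
    by rewrite !mxE /= (negPf nk) andbF qconj0 mulr0.
  rewrite qframe_mulE !mxE /= eqxx andbT; case: (i == a); rewrite ?mul0r //=.
  by case: (j == a); rewrite ?qconj0 ?mulr0.
rewrite (bigD1 i) //= [X in _ + X]big1 ?addr0 => [|a na]; last first.
  by rewrite big1 // => b _; rewrite big1 // => u _; rewrite e eq_sym (negPf na).
rewrite [in RHS]mxE; case: (eqVneq i j) e => [<-|nij] e; last first.
  by rewrite mulr0 big1 // => b _; rewrite big1 // => u _; rewrite e eqxx eq_sym (negPf nij).
rewrite mulr1 qtrE (_ : qreal _ = \sum_b qreal (4 * qre (x b b))); last first.
  rewrite mulr_sumr; apply: (big_morph _ qrealD); by [].
apply: eq_bigr => b _; under eq_bigr do rewrite e eqxx.
rewrite (sum_qunit (fun u => u * x b b * qconj u)); congr Quat => /=; ring.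
Qed.

Lemma qframe_parseval x : \sum_t qtr (x * qstar (qframe t)) *: qframe t = x.
Proof.
apply/matrixP => i j; rewrite summxE.
rewrite -(pair_bigA _ (fun xy u => (qtr (x * qstar (qframe (xy, u))) *: qframe (xy, u)) i j)) /=.
rewrite -(pair_bigA _ (fun a b => \sum_u (qtr (x * qstar (qframe (a, b, u))) *: qframe (a, b, u)) i j)) /=.
rewrite (bigD1 i) //= [X in _ + X]big1 ?addr0 => [|a na]; last first.
  rewrite big1 // => b _; rewrite big1 // => u _.
  by rewrite qmat_scaleE mxE /= eq_sym (negPf na) mulr0.
rewrite (bigD1 j) //= [X in _ + X]big1 ?addr0 => [|b nb]; last first.
  by rewrite big1 // => u _; rewrite qmat_scaleE mxE /= [j == b]eq_sym (negPf nb) andbF mulr0.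
transitivity (\sum_u qreal (qre (x i j * qconj (qunit u))) * qunit u).
  apply: eq_bigr => u _; rewrite qmat_scaleE mxE /= !eqxx /=; congr (qreal _ * _).
  rewrite qtrC qtrE (bigD1 j) //= big1 ?addr0 => [|k nk].
    rewrite mxE (bigD1 i) //= big1 ?addr0 => [|k nk]; rewrite !mxE /= ?eqxx ?(negPf nk).
      by move: (x i j) (qunit u) => [? ? ? ?] [? ? ? ?] /=; ring.
    by rewrite qconj0 mul0r.
  by rewrite mxE big1 // => l _; rewrite !mxE (negPf nk) andbF qconj0 mul0r.
rewrite (sum_qunit (fun u => qreal (qre (x i j * qconj u)) * u)).
by case: (x i j) => a b c d; congr Quat => /=; ring.
Qed.

Definition qalgebra : traced_algebra R := TracedAlgebra qstarD qstarZ qstarM qstarK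
  qtrD qtrZ qtrC qtr_star qframe_casimir qframe_parseval.

End QuaternionMatrices.

(** * Exact sequences from correspondences *)

Section Correspondences.
Local Open Scope group_scope.
Local Open Scope quotient_scope.

(** Neither map of the exact sequence is given by a formula: the elements of K and
    of T / N are only related through the choice of representatives in T.  It is
    enough that these relations are multiplicative and that r relates 1 exactly to
    the elements of N. *)
Variables (T : groupType) (N : normal_subgroup T) (K S : groupType).
Variables (r : K -> T -> Prop) (p : T -> S -> Prop).
Hypotheses (r_total : forall k, exists x, r k x)
  (rM : forall k k' x x', r k x -> r k' x' -> r (k * k') (x * x'))
  (r1 : forall x, r 1 x <-> x \in (N : groupClosed T))
  (r_inj : forall k k' x, r k x -> r k' x -> k = k').
Hypotheses (p_total : forall x, exists s, p x s)
  (p_fun : forall x s s', p x s -> p x s' -> s = s')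
  (pM : forall x x' s s', p x s -> p x' s' -> p (x * x') (s * s'))
  (p_onto : forall s, exists x, p x s)
  (p_ker : forall x, p x 1 <-> exists k, r k x).

Let r_coset k x y : r k x -> r k y -> \pi_(gquot N) x = \pi_(gquot N) y.
Proof.
move=> rx ry; have [z rz] := r_total k^-1; apply/gquotP.
have zx : z * x \in (N : groupClosed T) by apply/r1; rewrite -(mulVg k); apply: rM.
have zy : z * y \in (N : groupClosed T) by apply/r1; rewrite -(mulVg k); apply: rM.
by rewrite -[x^-1](mulgK z^-1) invgK -invgM -mulgA gpredM ?gpredVr.
Qed.

(** For k related to x and to y, take z related to the inverse of k: then z x and
    z y are in N, and so is x^-1 y. *)
Lemma exact_sequence_of_correspondences :
  exists (i : {multiplicative K -> gquot N}) (q : {multiplicative gquot N -> S}),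
    short_exact i q.
Proof.
have [f rf] := choice r_total; have [h ph] := choice p_total.
pose i k := \pi_(gquot N) (f k); pose q (c : gquot N) := h (repr c).
have iM : {morph i : k k' / k * k'}.
  by move=> k k'; rewrite -gquot_piM; apply: (@r_coset (k * k')) => //; apply: rM.
have p_coset x y s : \pi_(gquot N) x = \pi_(gquot N) y -> p x s -> p y s.
  move=> /gquotP Nxy px; have /p_ker p1 : exists k, r k (x^-1 * y) by exists 1; apply/r1.
  by have := pM px p1; rewrite mulg1 mulgA mulgV mul1g.
have qE x s : p x s -> q (\pi_(gquot N) x) = s.
  by move=> px; apply: (p_fun (ph _)); apply: p_coset px; rewrite reprK.
have qM : {morph q : c c' / c * c'}.
  elim/gquot_ind => x; elim/gquot_ind => y; rewrite -gquot_piM.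
  by apply: qE; apply: pM; rewrite /q; apply: p_coset (ph _); rewrite reprK.
pose i' : {multiplicative K -> gquot N} := HB.pack i (isMultiplicative.Build _ _ i iM).
pose q' : {multiplicative gquot N -> S} := HB.pack q (isMultiplicative.Build _ _ q qM).
exists i', q'; split.
- move=> k k' /gquotP Nx; apply: (@r_inj k k' (f k')) => //.
  have := rM (rf k) ((r1 _).2 Nx); rewrite mulg1 mulgA mulgV mul1g //.
- elim/gquot_ind => x; split=> [q1|[k ek]].
    have /p_ker[k rk] : p x 1 by rewrite -q1; apply: p_coset (ph _); rewrite reprK.
    by exists k; apply: r_coset rk.
  by apply: qE; apply: p_coset ek _; apply/p_ker; exists k.
by move=> s; have [x px] := p_onto s; exists (\pi_(gquot N) x); apply: qE.
Qed.

End Correspondences.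

(** * Maximal abelian subgroups are self-centralising *)

Section Bicommutant.
Local Open Scope group_scope.
Variables (T : groupType) (F : abelian_subgroup T) (x : T).

Definition bicommutant_pred : {pred T} := fun y =>
  `[< forall c, (forall s, s \in (F : groupClosed T) \/ s = x -> c * s = s * c) -> y * c = c * y >].

Lemma bicommutant_closed : group_closed bicommutant_pred.
Proof.
split=> [|y z /asboolP Cy /asboolP Cz]; apply/asboolP => c Cc.
  by rewrite mul1g mulg1.
apply/esym; apply: (@commuteM _ c); first exact/esym/Cy.
exact/commuteV/esym/Cz.
Qed.

HB.instance Definition _ :=
  isMulClosed.Build T bicommutant_pred (group_closedM bicommutant_closed).
HB.instance Definition _ := isMul1Closed.Build T bicommutant_pred (fst bicommutant_closed).
HB.instance Definition _ :=
  isInvClosed.Build T bicommutant_pred (group_closedV bicommutant_closed).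

(** As F and x commute, the bicommutant of their union is abelian. *)
Lemma maximal_abelian_centraliser : maximal_abelian F ->
  (forall y, y \in (F : groupClosed T) -> x * y = y * x) -> x \in (F : groupClosed T).
Proof.
move=> maxF xC.
have S_comm s t : s \in (F : groupClosed T) \/ s = x -> t \in (F : groupClosed T) \/ t = x -> s * t = t * s.
  move=> [Fs|->] [Ft|->] //; [exact: (abgC Fs Ft)|by rewrite xC|exact: xC].
have CC y : y \in bicommutant_pred -> forall s, s \in (F : groupClosed T) \/ s = x -> y * s = s * y.
  by move=> /asboolP Cy s Ss; apply: Cy => t St; apply: S_comm.
have bC : {in bicommutant_pred &, forall y z, y * z = z * y}.
  by move=> y z /asboolP Cy Bz; apply: Cy; apply: CC.
apply: (maxF (AbelianSubgroup bC)) => [y Fy|]; apply/asboolP => c Cc; apply/esym/Cc; [by left|by right].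
Qed.

End Bicommutant.

(** The inclusion x F x^-1 <= F is enough: it says that x^-1 y x commutes with F for
    y in F. *)
Lemma normaliserP (T : groupType) (F : abelian_subgroup T) (x : T) : maximal_abelian F ->
  x \in Defs.normaliser F <-> (forall y, y \in (F : groupClosed T) -> x * y * x^-1 \in (F : groupClosed T))%g.
Proof.
move=> maxF; have conjE y : (x * y * x^-1 = y ^ x^-1)%g by rewrite conjgE invgK mulgA.
split=> [/asboolP Nx y Fy|Fx]; first by rewrite conjE -Nx conjgKV.
apply/asboolP => y; apply/idP/idP => [/Fx|Fy]; first by rewrite conjE conjgK.
apply: (maximal_abelian_centraliser maxF) => z Fz.
have e : (y * z ^ x^-1 = z ^ x^-1 * y)%g by rewrite -conjE; apply: (abgC Fy (Fx z Fz)).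
by rewrite -(conjgKV x z) -!conjMg e.
Qed.

(** * The preimage of a maximal abelian subgroup *)

Section Preimage.
Local Open Scope quotient_scope.
Variables (R : realType) (n : nat) (F : abelian_subgroup (PSp R n.+1)).
Hypothesis maxF : maximal_abelian F.
Local Notation Sp := (Sp R n.+1).
Local Notation A := (qalgebra R n).
Local Notation pr := (\pi_(gquot (pm1 R n.+1))).
Local Notation inF x := (x \in (F : groupClosed (PSp R n.+1))).
Implicit Types X Y Z : Sp.

Definition mx (X : Sp) : A := val X.

Lemma mx_inj : injective mx. Proof. exact: val_inj. Qed.
Lemma mxM X Y : mx (X * Y)%g = mx X * mx Y. Proof. by []. Qed.
Lemma mxV X : mx X^-1%g = star (mx X). Proof. by []. Qed.

Lemma mx_unitary X : unitary (mx X).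
Proof. by rewrite /unitary -mxV -!mxM mulgV mulVg. Qed.

Lemma unitary_mx (u : A) : unitary u -> exists X, mx X = u.
Proof. by case=> /eqP u1 _; exists (exist (@sp_pred R n.+1) u u1). Qed.

Lemma pm1P Z : Z \in (pm1 R n.+1 : groupClosed _) <-> exists e : bool, mx Z = (-1) ^+ e *: 1.
Proof.
split=> [/orP[/eqP e|/eqP e]|[[] e]].
- by exists false; rewrite scale1r.
- by exists true; rewrite scaleN1r.
- by apply/orP; right; apply/eqP; rewrite -[LHS]/(mx Z) e scaleN1r.
- by apply/orP; left; apply/eqP; rewrite -[LHS]/(mx Z) e scale1r.
Qed.

Lemma prP X Y : pr X = pr Y <-> exists e : bool, mx Y = (-1) ^+ e *: mx X.
Proof.
split=> [/gquotP/pm1P[e eXY]|[e eXY]].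
  by exists e; rewrite -[Y in LHS](mulKVg X) mxM eXY -scalerAr mulr1.
by apply/gquotP/pm1P; exists e; rewrite mxM eXY mxV -scalerAr (proj2 (mx_unitary X)).
Qed.

Lemma prM X Y : pr (X * Y)%g = (pr X * pr Y)%g. Proof. exact: gquot_piM. Qed.
Lemma prV X : pr X^-1%g = (pr X)^-1%g. Proof. exact: gquot_piV. Qed.

Definition preim (a : A) : Prop := exists2 X, mx X = a & inF (pr X).

Lemma preimP X : preim (mx X) <-> inF (pr X).
Proof. by split=> [[Y /mx_inj ->]|]; [|exists X]. Qed.

Lemma pr_comm X Y : (pr X * pr Y = pr Y * pr X)%g <->
  exists e : bool, mx X * mx Y = (-1) ^+ e *: (mx Y * mx X).
Proof. by rewrite -!prM; split=> [/esym/prP|e]; [|apply/esym/prP]. Qed.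

Lemma preim_maximal : sign_maximal preim.
Proof.
split=> [_ [X <- _]|_ _ [X <- FX] [Y <- FY]|u /unitary_mx[X <-] uC]; first exact: mx_unitary.
  exact/pr_comm/(abgC FX FY).
apply/preimP/(maximal_abelian_centraliser maxF) => y.
elim/gquot_ind: y => Y FY; apply/pr_comm/uC; exact/preimP.
Qed.

End Preimage.

(** * The symplectic space F/ker m *)

Lemma signZ_inj (R : rcfType) (A : traced_algebra R) (u : A) (a b : bool) :
  u != 0 -> (-1) ^+ a *: u = (-1) ^+ b *: u -> a = b.
Proof.
move=> u0; have nu : - u != u.
  by rewrite eq_sym -addr_eq0 -mulr2n -scaler_nat scaler_eq0 pnatr_eq0.
by case: a b => [] [] //=; rewrite ?scaleN1r ?scale1r => /eqP; rewrite ?(negPf nu) // eq_sym (negPf nu).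
Qed.

Section Classes.
Local Open Scope quotient_scope.
Variables (R : realType) (n : nat) (F : abelian_subgroup (PSp R n.+1)).
Hypothesis maxF : maximal_abelian F.
Local Notation Sp := (Sp R n.+1).
Local Notation A := (qalgebra R n).
Local Notation pr := (\pi_(gquot (pm1 R n.+1))).
Local Notation inF x := (x \in (F : groupClosed (PSp R n.+1))).
Local Notation Q := (form_quot F).
Local Notation G := (preim F).
Implicit Types X Y Z : Sp.

Let GP : sign_maximal G := preim_maximal maxF.

(** The class of X in F/ker m; total, with the class of 1 as default outside of the
    preimage of F. *)
Definition cls X : Q := \pi_(gquot (form_ker F)) (insubd (1%g : gsub F) (pr X)).

Definition elt X (FX : inF (pr X)) : gsub F := exist _ (pr X) FX.

Lemma cls_val X (x : gsub F) : pr X = val x -> cls X = \pi_(gquot (form_ker F)) x.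
Proof. by move=> e; rewrite /cls e valKd. Qed.

Lemma cls_elt X (FX : inF (pr X)) : cls X = \pi_(gquot (form_ker F)) (elt FX).
Proof. exact: cls_val. Qed.

Lemma cls_onto (c : Q) : exists2 X, inF (pr X) & cls X = c.
Proof.
elim/gquot_ind: c => x; exists (repr (val x)); rewrite ?reprK; first exact: (valP x).
by apply: cls_val; rewrite reprK.
Qed.

Lemma inF_M X Y : inF (pr X) -> inF (pr Y) -> inF (pr (X * Y)%g).
Proof. by move=> FX FY; rewrite prM; apply: gpredM. Qed.
Lemma inF_V X : inF (pr X) -> inF (pr X^-1%g).
Proof. by move=> FX; rewrite prV; apply: gpredVr. Qed.

Lemma inF_1 : inF (pr 1%g).
Proof. by rewrite (gquot_pi1 (pm1 R n.+1)) gpred1. Qed.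

Lemma clsM X Y : inF (pr X) -> inF (pr Y) -> cls (X * Y)%g = (cls X * cls Y)%g.
Proof.
move=> FX FY; rewrite (cls_elt FX) (cls_elt FY).
by rewrite -gquot_piM; apply: cls_val; rewrite prM gmulfM.
Qed.

Lemma cls1 : cls 1%g = 1%g.
Proof. by rewrite (cls_val (x := 1%g)) // val1. Qed.

Lemma clsV X : inF (pr X) -> cls X^-1%g = (cls X)^-1%g.
Proof.
move=> FX; apply: (mulgI (cls X)); rewrite -clsM ?inF_V // !mulgV.
exact: cls1.
Qed.

Lemma cmP X : commutant G (mx X) <-> forall Y, inF (pr Y) -> (X * Y = Y * X)%g.
Proof.
split=> [cX Y FY|cX _ [Y <- FY]]; last by rewrite -!mxM cX.
by apply: mx_inj; rewrite !mxM cX //; apply/preimP.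
Qed.

Lemma kerP X (FX : inF (pr X)) : elt FX \in ker_pred (F := F) <-> commutant G (mx X).
Proof.
rewrite cmP; split=> [/asboolP K Y FY|cX]; first by apply/formP; apply: (K (elt FY)).
apply/asboolP => y; rewrite /= -[val y]reprK; apply/formP/cX.
by rewrite reprK; apply: (valP y).
Qed.

Lemma cls_eq1 X : inF (pr X) -> cls X = 1%g <-> commutant G (mx X).
Proof.
move=> FX; rewrite -(kerP FX) (cls_elt FX).
have -> : 1%g = \pi_(gquot (form_ker F)) 1%g :> Q by [].
split=> [/esym/gquotP|K]; first by rewrite invg1 mul1g.
by apply/esym/gquotP; rewrite invg1 mul1g.
Qed.

Lemma cm_inF X : commutant G (mx X) -> inF (pr X).
Proof. by move=> cX; apply/preimP/(cm_sm GP) => //; apply: mx_unitary. Qed.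

Lemma cls_eq X Y : inF (pr X) -> inF (pr Y) ->
  cls X = cls Y <-> commutant G (mx (X^-1 * Y)%g).
Proof.
move=> FX FY; rewrite -cls_eq1 ?inF_M ?inF_V // clsM ?inF_V // clsV //.
by split=> [->|e]; [rewrite mulVg|apply: (mulgI (cls X)^-1%g); rewrite e mulVg].
Qed.

Lemma mx_neq0 X : mx X != 0.
Proof.
apply/eqP => Z0; have := proj1 (mx_unitary X).
by rewrite Z0 mul0r => /eqP; rewrite eq_sym oner_eq0.
Qed.

Lemma quot_formE X Y : inF (pr X) -> inF (pr Y) ->
  mx X * mx Y = (-1) ^+ (quot_form (cls X) (cls Y) : bool) *: (mx Y * mx X).
Proof.
move=> FX FY; have [e XY] : exists e : bool, mx X * mx Y = (-1) ^+ e *: (mx Y * mx X).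
  exact: (sm_comm GP ((preimP F X).2 FX) ((preimP F Y).2 FY)).
rewrite XY; congr (_ ^+ _ *: _).
have commE : quot_form (cls X) (cls Y) = 1%g <-> (X * Y = Y * X)%g.
  rewrite /quot_form -[val (repr (cls X))]reprK -[val (repr (cls Y))]reprK formP.
  have lift_eq Z : inF (pr Z) -> exists2 z, commutant G (mx z) & repr (val (repr (cls Z))) = (Z * z)%g.
    move=> FZ; set Z' := repr _; have FZ' : inF (pr Z') by rewrite reprK; apply: (valP (repr (cls Z))).
    exists (Z^-1 * Z')%g; last by rewrite mulKVg.
    by apply/cls_eq => //; rewrite (cls_val (X := Z') (x := repr (cls Z))) reprK.
  have [z /cmP cz ->] := lift_eq X FX; have [w /cmP cw ->] := lift_eq Y FY.
  have Fw : inF (pr w) by apply/cm_inF/cmP.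
  have e1 : (X * z * (Y * w) = X * Y * (z * w))%g by rewrite !mulgA -(mulgA X z) cz // mulgA.
  have e2 : (Y * w * (X * z) = Y * X * (z * w))%g.
    by rewrite !mulgA -(mulgA Y w) cw // -!mulgA (cz w Fw) mulgA.
  by rewrite e1 e2; split=> [/mulIg|->].
case: e XY => XY; case: (quot_form _ _) commE => [] commE //.
  have /(congr1 (@mx R n)) : (X * Y = Y * X)%g by apply/commE.
  by rewrite !mxM XY -[RHS]scale1r => /(signZ_inj (b := false) (mx_neq0 (Y * X)%g)).
have : true = 1%g :> sign by apply/commE/mx_inj; rewrite !mxM XY scale1r.
by [].
Qed.

Lemma quot_form_nondeg (c : Q) : (forall d, quot_form d c = 1%g) -> c = 1%g.
Proof.
have [X FX <-] := cls_onto c => X1; apply/cls_eq1 => // _ [Y <- FY].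
by apply/esym; rewrite quot_formE // X1 scale1r.
Qed.

Lemma quot_formMr (b c d : Q) : quot_form b (c * d)%g = (quot_form b c (+) quot_form b d)%g.
Proof.
have [X FX <-] := cls_onto b; have [Y FY <-] := cls_onto c; have [Z FZ <-] := cls_onto d.
apply: (signZ_inj (mx_neq0 (Y * Z * X)%g)); transitivity (mx X * mx (Y * Z)%g).
  by rewrite -clsM // (quot_formE FX (inF_M FY FZ)).
rewrite !mxM mulrA (quot_formE FX FY) -scalerAl -(mulrA (mx Y) (mx X)) (quot_formE FX FZ).
by rewrite -scalerAr scalerA -signr_addb mulrA.
Qed.

Lemma quot_formMl (b c d : Q) : quot_form (b * c)%g d = (quot_form b d (+) quot_form c d)%g.
Proof.
have [X FX <-] := cls_onto b; have [Y FY <-] := cls_onto c; have [Z FZ <-] := cls_onto d.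
apply: (signZ_inj (mx_neq0 (Z * (X * Y))%g)); transitivity (mx (X * Y)%g * mx Z).
  by rewrite -clsM // (quot_formE (inF_M FX FY) FZ).
rewrite !mxM -(mulrA (mx X) (mx Y)) (quot_formE FY FZ) -scalerAr (mulrA (mx X)) (quot_formE FX FZ).
by rewrite -scalerAl scalerA addbC -signr_addb -mulrA.
Qed.

End Classes.

(** * Bases of elementary abelian 2-groups *)

Section Spans.
Local Open Scope group_scope.

Lemma multiplicative1 (V W : groupType) (f : {multiplicative V -> W}) : f 1 = 1.
Proof. by apply: (mulgI (f 1)); rewrite -gmulfM !mulg1. Qed.

(** Generation as an induction principle. *)
Definition spans (V : groupType) d (b : 'I_d -> V) := forall P : V -> Prop,
  P 1 -> (forall u v, P u -> P v -> P (u * v)) -> (forall l, P (b l)) -> forall v, P v.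

Definition delta d (l : 'I_d) : {ffun 'I_d -> sign} := [ffun j => (j == l) : sign].

Lemma delta_spans d : spans (@delta d).
Proof.
move=> P P1 PM Pd e; have [m] := ubnP #|[set l | e l]|.
elim: m e => // m IH e; have [e0|[l el]] := set_0Vmem [set l | e l].
  move=> _; suff -> : e = 1 by [].
  by apply/ffunP => l; have /finset.setP/(_ l) := e0; rewrite !inE ffunE; case: (e l).
rewrite ltnS => le_m; have -> : e = delta l * (delta l * e).
  by apply/ffunP => j; rewrite !ffunE mulgA /mulg /= addbb addFb.
apply: PM => //; apply: IH; apply: leq_trans le_m.
rewrite (cardsD1 l [set l | e l]) el ltnS; apply: subset_leq_card; apply/fintype.subsetP => j.
rewrite !inE !ffunE /mulg /=; case: eqVneq => [->|_]; last by [].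
by move: el; rewrite inE => ->.
Qed.

Lemma spans_bij (V W : groupType) d (b : 'I_d -> V) (f : V -> W) :
  {morph f : u v / u * v} -> f 1 = 1 -> (forall w, exists v, f v = w) -> spans b -> spans (f \o b).
Proof.
move=> fM f1 f_onto sb P P1 PM Pb w; have [v <-] := f_onto w.
by apply: (sb (P \o f)) => [|u v' /= Pu Pv|] //=; rewrite ?f1 // fM; apply: PM.
Qed.

(** A basis element of an elementary abelian 2-group can be sent to any element
    of an abelian group of exponent 2. *)
Lemma hom_extension (Q T : groupType) d (f : {multiplicative {ffun 'I_d -> sign} -> Q})
    (B : abelian_subgroup T) (y : 'I_d -> gsub B) :
  bijective f -> (forall x : gsub B, x * x = 1) ->
  exists phi : ghom Q B, forall l, val phi (f (delta l)) = y l.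
Proof.
move=> [g fK gK] BB; pose c (e : {ffun 'I_d -> sign}) l := if e l then y l else 1.
pose h e s := foldr (fun l acc => c e l * acc) 1 s.
have BC := @gsub_abgC _ B.
have hM e e' s : h (e * e') s = h e s * h e' s.
  elim: s => [|l s IH] /=; first by rewrite mulg1.
  rewrite IH !mulgA; congr (_ * _); rewrite -!mulgA [h e s * _]BC !mulgA; congr (_ * _).
  have ee' : (e * e') l = e l (+) e' l by rewrite ffunE.
  by rewrite /c ee'; case: (e l) (e' l) => [] []; rewrite /= ?mulg1 ?mul1g ?BB.
have hd l s : uniq s -> h (delta l) s = if l \in s then y l else 1.
  elim: s => //= j s IH /andP[njs us]; rewrite IH // inE /c ffunE eq_sym.
  have [elj|nlj] /= := eqVneq l j; last by rewrite mul1g.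
  by rewrite elj (negPf njs) mulg1.
have gM : {morph g : u v / u * v} by move=> u v; rewrite -{1}(gK u) -{1}(gK v) -gmulfM fK.
have homP : hom_pred (B := B) (fun q => h (g q) (enum 'I_d)).
  by apply/asboolP => u v; rewrite gM hM.
exists (exist (@hom_pred Q T B) _ homP); move=> i /=; rewrite fK hd ?enum_uniq //.
by rewrite mem_enum.
Qed.

End Spans.

(** * Quaternionic vector spaces *)

Section QuaternionicBases.
Variable R : realType.

Lemma quat_inv (h : quat R) : h != 0 -> exists h', h * h' = 1.
Proof.
case: h => a b c d nq; pose N := a ^+ 2 + b ^+ 2 + c ^+ 2 + d ^+ 2.
have N0 : N != 0.
  apply: contraNneq nq; rewrite /N => /eqP.
  rewrite !paddr_eq0 ?addr_ge0 ?sqr_ge0 // !sqrf_eq0.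
  by case/andP => /andP[/andP[/eqP-> /eqP->] /eqP->] /eqP->.
exists (Quat (a / N) (- b / N) (- c / N) (- d / N)).
have NE : (a ^+ 2 + b ^+ 2 + c ^+ 2 + d ^+ 2) / N = 1 by rewrite -/N divff.
move: N NE N0 => N NE N0; congr Quat; rewrite /=; first by rewrite -[RHS]NE; field.
all: by field.
Qed.

(** If v is not in the span of b, an equality v a = b y with a <> 0 would give
    v = b y a^-1. *)
Lemma basis_extend m d (b : 'M[quat R]_(m, d)) (v : 'cV_m) :
  injective (fun x : 'cV_d => b *m x) -> exists d' (b' : 'M[quat R]_(m, d')),
    injective (fun x : 'cV_d' => b' *m x) /\
    forall w : 'cV_m, (exists x : 'cV_d', w = b' *m x) <-> (exists (x : 'cV_d) (a : 'M_1), w = b *m x + v *m a).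
Proof.
move=> b_inj; have [[x vE]|nv] := pselect (exists x, v = b *m x).
  exists d, b; split=> // w; split=> [[y ->]|[y [a ->]]].
    by exists y, 0; rewrite mulmx0 addr0.
  by exists (y + x *m a); rewrite mulmxDr mulmxA -vE.
exists (d + 1)%N, (row_mx b v); split=> [x y /=|w].
  rewrite -[x]vsubmxK -[y]vsubmxK !mul_row_col.
  set x1 := usubmx x; set x2 := dsubmx x; set y1 := usubmx y; set y2 := dsubmx y => e.
  have e' : v *m (x2 - y2) = b *m (y1 - x1).
    rewrite !mulmxBr; apply/eqP; rewrite subr_eq addrAC eq_sym subr_eq; apply/eqP.
    by rewrite -e addrC.
  have [xy2|nxy] := eqVneq (x2 - y2) 0.
    move: e; have -> : x2 = y2 by apply/eqP; rewrite -subr_eq0 xy2.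
    by move/addIr/b_inj ->.
  case: nv; have [h hE] : exists h, (x2 - y2) 0 0 * h = 1.
    apply: quat_inv; apply: contraNneq nxy => e0; apply/eqP/matrixP => i j.
    by rewrite !ord1 e0 mxE.
  exists ((y1 - x1) *m const_mx h); rewrite mulmxA -e' -mulmxA.
  rewrite (_ : _ *m const_mx h = 1%:M) ?mulmx1 //.
  by apply/matrixP => i j; rewrite !ord1 mxE big_ord1 [const_mx _ _ _]mxE hE mxE.
split=> [[x ->]|[x [a ->]]]; last by exists (col_mx x a); rewrite mul_row_col.
by exists (usubmx x), (dsubmx x); rewrite -mul_row_col vsubmxK.
Qed.

Lemma column_basis m (l : nat) (c : 'M[quat R]_(m, l)) : exists d (b : 'M[quat R]_(m, d)),
  injective (fun x : 'cV_d => b *m x) /\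
  forall w : 'cV_m, (exists x : 'cV_d, w = b *m x) <-> (exists x : 'cV_l, w = c *m x).
Proof.
elim: l c => [|l IH] c.
  by exists 0%N, c; split=> // x y _; apply/matrixP => -[].
move: c; rewrite -[l.+1]/(1 + l)%N => c.
have [d [b [b_inj bE]]] := IH (rsubmx c).
have [d' [b' [b'_inj b'E]]] := basis_extend (lsubmx c) b_inj.
exists d', b'; split=> // w; rewrite b'E -{2}[c]hsubmxK.
split=> [[x [a ->]]|[x ->]].
  have [y ey] : exists y : 'cV_l, b *m x = rsubmx c *m y by apply/bE; exists x.
  by exists (col_mx a y); rewrite mul_row_col ey addrC.
rewrite -[x]vsubmxK mul_row_col.
have [y ey] : exists y : 'cV_d, rsubmx c *m dsubmx x = b *m y by apply/bE; exists (dsubmx x).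
by exists y, (usubmx x); rewrite ey addrC.
Qed.

End QuaternionicBases.

Section Vectors.
Variables (R : realType) (n : nat).
Local Notation A := (qalgebra R n).
Implicit Types (x y p q : A) (v : 'cV[quat R]_n.+1).

Definition app x v : 'cV[quat R]_n.+1 := ((x : 'M_n.+1) *m v)%R.

Lemma appM x y v : app (x * y) v = app x (app y v).
Proof. exact/esym/mulmxA. Qed.
Lemma app1 v : app 1 v = v. Proof. exact: mul1mx. Qed.
Lemma app0v v : app 0 v = 0. Proof. exact: mul0mx. Qed.
Lemma appN x v : app (- x) v = - app x v. Proof. exact: mulNmx. Qed.
Lemma appB x y v : app (x - y) v = app x v - app y v. Proof. exact: mulmxBl. Qed.
Lemma app_sum (I : Type) (s : seq I) (F : I -> A) v :
  app (\sum_(i <- s) F i) v = \sum_(i <- s) app (F i) v.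
Proof. exact: mulmx_suml. Qed.

Lemma app_ext x y : (forall v, app x v = app y v) -> x = y.
Proof.
move=> e; apply/matrixP => i j; have := congr1 (fun w : 'cV_n.+1 => w i 0) (e (delta_mx j 0)).
rewrite /= !mxE (bigD1 j) //= [RHS](bigD1 j) //= !mxE !eqxx !mulr1.
by rewrite !big1 ?addr0 // => k nk; rewrite mxE (negPf nk) mulr0.
Qed.

Definition range p : set 'cV[quat R]_n.+1 := [set v | app p v = v]%classic.

Lemma range_sub p q : p * p = p -> (range p `<=` range q)%classic -> q * p = p.
Proof.
by move=> pp pq; apply: app_ext => v; rewrite appM; apply: pq; rewrite /range /= -appM pp.
Qed.

Lemma range_inj p q : proj p -> proj q -> range p = range q -> p = q.
Proof.
move=> [pp pS] [qq qS] e.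
have qp : q * p = p by apply: range_sub => // v; rewrite e.
have pq : p * q = q by apply: range_sub => // v; rewrite e.
by rewrite -qp -qS -pS -starM pq qS.
Qed.

Lemma double_inj v w : v + v = w + w -> v = w.
Proof.
move=> e; apply/matrixP => i j; have := congr1 (fun u : 'cV_n.+1 => u i j) e.
by rewrite !mxE; case: (v i j) (w i j) => [? ? ? ?] [? ? ? ?] [*]; congr Quat; lra.
Qed.

Lemma oppv_neq v : v != 0 -> - v != v.
Proof.
by apply: contraNneq => e; apply/eqP/double_inj; rewrite -{1}e addNr addr0.
Qed.

Lemma signed_inj (e e' : sign) v : v != 0 -> signed e v = signed e' v -> e = e'.
Proof.
move=> v0; have nv := oppv_neq v0.
by case: e e' => [] [] //= /eqP; rewrite /signed /= ?(negPf nv) // eq_sym (negPf nv).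
Qed.

(** The range of p is spanned by its columns. *)
Lemma range_dim p : proj p -> exists d, quat_dim (range p) d.
Proof.
move=> [pp _]; have [d [b [b_inj bE]]] := column_basis (p : 'M_n.+1).
exists d, b; split=> //; apply/seteqP; split=> v /=.
  by move=> pv; have [x ->] : exists x : 'cV_d, v = b *m x; [apply/bE; exists v|exists x].
case=> x _ <-; have [y ->] : exists y : 'cV_n.+1, b *m x = (p : 'M_n.+1) *m y by apply/bE; exists x.
by rewrite /range /= -/(app p y) -appM pp.
Qed.

(** If the columns of b are a basis of the range of p then p = b c with
    c b = 1, so the real parts of the traces of p and of c b agree. *)
Lemma range_dim_tr p d : proj p -> quat_dim (range p) d -> tr p = d%:R.
Proof.
move=> [pp _] [b [b_inj rE]].
have ex j : exists x : 'cV_d, col j (p : 'M_n.+1) = b *m x.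
  have : range p (col j (p : 'M_n.+1)).
    by rewrite /range /= colE -/(app p _) -appM pp.
  by rewrite rE => -[x _ <-]; exists x.
have [f fE] := choice ex; pose c : 'M_(d, n.+1) := \matrix_(i, j) f j i 0.
have pE : (p : 'M_n.+1) = b *m c.
  apply/matrixP => i j; have := congr1 (fun w : 'cV_n.+1 => w i 0) (fE j).
  by rewrite !mxE => ->; apply: eq_bigr => k _; rewrite !mxE.
have cb : c *m b = 1%:M.
  apply/matrixP => i j; have rb : range p (b *m delta_mx j 0) by rewrite rE; exists (delta_mx j 0).
  have : c *m b *m delta_mx j 0 = delta_mx j (0 : 'I_1).
    by apply: b_inj; rewrite /= !mulmxA -pE -mulmxA.
  by rewrite -colE => /matrixP/(_ i 0); rewrite !mxE eqxx andbT eq_sym.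
by rewrite /= /qtr pE qre_mxtraceC cb mxtrace1 -[LHS]/(qre (d%:R : quat R)); elim: (d) => // m IH; rewrite -natr1 qreD IH natr1.
Qed.

End Vectors.

(** * Eigenspaces of B_F and minimal projections *)

Section Decomposition.
Local Open Scope quotient_scope.
Variables (R : realType) (n : nat) (F : abelian_subgroup (PSp R n.+1)).
Hypothesis maxF : maximal_abelian F.
Local Notation Sp := (Sp R n.+1).
Local Notation A := (qalgebra R n).
Local Notation pr := (\pi_(gquot (pm1 R n.+1))).
Local Notation inF x := (x \in (F : groupClosed (PSp R n.+1))).
Local Notation Q := (form_quot F).
Local Notation G := (preim F).
Local Notation commutant := (commutant G).
Local Notation atom := (atom G).
Implicit Types (X Y Z : Sp) (p q : A).

Let GP : sign_maximal G := preim_maximal maxF.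

Lemma bfP X : pr X \in bf_pred F <-> commutant (mx X) /\ mx X * mx X = 1.
Proof.
split=> [/asboolP[[y ey Ky] sq]|[cX XX]].
  have FX : inF (pr X) by rewrite -ey; apply: (valP y).
  split; last by rewrite -mxM sq.
  by apply/(kerP FX); rewrite (_ : elt FX = y) //; apply/val_inj.
have FX := cm_inF maxF cX; apply/asboolP; split; first by exists (elt FX); rewrite // kerP.
move=> Y /esym/prP[e eY]; apply: mx_inj; rewrite mxM eY -scalerAl -scalerAr XX scalerA.
by rewrite -signr_addb addbb scale1r.
Qed.

Lemma reflection_bf p : atom p -> exists X, mx X = reflection p /\ pr X \in bf_pred F.
Proof.
move=> ap; have pP := atom_proj ap; have cp := atom_cm ap.
have [X eX] := unitary_mx (unitary_reflection pP); exists X; split=> //.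
apply/bfP; rewrite eX reflection_sqr //; split=> //.
exact/cmB/cp/cmB/cp/cm1.
Qed.

(** X is a hermitian involution, so (1 - X) / 2 is a projection of the commutant and
    p is either below it or orthogonal to it. *)
Lemma bf_atom X p : atom p -> pr X \in bf_pred F -> exists e : bool, mx X * p = (-1) ^+ e *: p.
Proof.
move=> ap /bfP[cX XX]; have [pp _] := atom_proj ap; have cp := atom_cm ap.
have XS : star (mx X) = mx X by rewrite -[LHS]mulr1 -XX mulrA (proj2 (mx_unitary X)) mul1r.
pose q := 2^-1 *: (1 - mx X).
have qP : proj q.
  split; last by rewrite starZ starB star1 XS.
  rewrite -scalerAl -scalerAr mulrBl !mulrBr mulr1 mul1r mulr1 XX.
  rewrite opprB -mulr2n -scaler_nat !scalerA.
  by congr (_ *: _); rewrite mulfVK ?pnatr_eq0.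
have cq : commutant q by apply/cmZ/cmB/cX/cm1.
have pq := cm_proj_central GP cp (atom_proj ap) cq.
have [|e0|e1] := atom_min ap (cm_projM GP cq cp qP (atom_proj ap)) (cmM cq cp).
- by rewrite -mulrA pp.
- exists false; rewrite scale1r; apply/eqP; rewrite eq_sym -subr_eq0.
  move: e0 => /eqP; rewrite -scalerAl scaler_eq0 invr_eq0 pnatr_eq0 /=.
  by rewrite mulrBl mul1r.
- exists true; rewrite scaleN1r; move: e1; rewrite -scalerAl => /(congr1 ( *:%R 2)).
  rewrite scalerA divff ?pnatr_eq0 // scale1r mulrBl mul1r scaler_nat mulr2n.
  by move=> /addrI e; rewrite -[LHS]opprK e.
Qed.

Lemma app_refl p v : app (reflection p) v = v - app p v - app p v.
Proof. by rewrite !appB app1. Qed.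

(** As p is minimal, B_F acts on the range of p by scalars; conversely the element
    1 - 2p of B_F is -1 on the range of p and 1 on a complement. *)
Lemma atom_eigenspace p chi v : atom p -> app p v = v -> v != 0 ->
  (forall X, pr X \in bf_pred F -> app (mx X) v = signed (chi X) v) ->
  bf_eigenspace F chi = range p.
Proof.
move=> ap pv v0 chi_v; have [X [eX BX]] := reflection_bf ap.
have chiX w : signed (chi X) w = - w.
  have := chi_v X BX; rewrite eX app_refl pv subrr sub0r /signed.
  by case: ifP => // _ /eqP; rewrite (negPf (oppv_neq v0)).
apply/seteqP; split=> w /=.
  move=> /(_ X BX); rewrite chiX -[(_ *m w)%R]/(app (mx X) w) eX app_refl => e.
  apply: double_inj; move/eqP: e; rewrite -addrA -opprD eq_sym eqr_oppLR opprB.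
  by rewrite eq_sym subr_eq => /eqP.
move=> pw Y BY; have [e Yp] := bf_atom ap BY.
have Yv u : app p u = u -> app (mx Y) u = signed (e : sign) u.
  move=> pu; rewrite -{1}pu -appM Yp /signed; case: e {Yp}; last by rewrite scale1r.
  by rewrite scaleN1r appN pu.
rewrite -[LHS]/(app (mx Y) w) Yv //; congr signed; apply: (signed_inj v0).
by rewrite -Yv // chi_v.
Qed.

Lemma atom_is_eigenspace p : atom p -> is_bf_eigenspace F (range p).
Proof.
move=> ap; have [v v0] : exists v, app p v != 0.
  apply: contrapT => /forallNP e; have /eqP[] := atom_neq0 ap.
  by apply: app_ext => v; rewrite app0v; apply/eqP/negPn/negP/e.
have pv : app p (app p v) = app p v by rewrite -appM (proj1 (atom_proj ap)).
split; last by exists (app p v).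
pose chi X : sign := mx X * p != p.
exists chi; apply/esym/(atom_eigenspace ap pv v0) => X BX.
have [e eX] := bf_atom ap BX; have -> : chi X = e.
  rewrite /chi eX; case: e {eX}; rewrite ?scale1r ?eqxx //.
  by apply/eqP; rewrite -[RHS]scale1r => /(signZ_inj (a := true) (b := false) (atom_neq0 ap)).
rewrite -[in LHS]pv -appM eX /signed; case: e {eX}; last by rewrite scale1r pv.
by rewrite scaleN1r appN pv.
Qed.

(** 1 is a sum of minimal projections, so one of them does not kill v; as 1 - 2p acts
    on v by a sign, v is in the range of p. *)
Lemma eigenspace_atom U : is_bf_eigenspace F U -> exists2 p, atom p & U = range p.
Proof.
case=> -[chi eU] [v Uv v0].
have [|s sA s1] := @sum_of_atoms _ _ G 1 _ (@cm1 _ _ G).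
  by split; rewrite ?mulr1 ?star1.
have [p sp pv] : exists2 p, p \in s & app p v != 0.
  apply: contrapT => e; move: v0; rewrite -[v]app1 -s1 app_sum big_seq big1 ?eqxx // => p sp.
  by apply/eqP/negPn/negP => pv; apply: e; exists p.
have ap := sA _ sp; exists p => //; rewrite eU; rewrite eU in Uv.
have [X [eX BX]] := reflection_bf ap.
apply: (atom_eigenspace ap _ v0) => //.
have := Uv X BX; rewrite -[LHS]/(app (mx X) v) eX app_refl /signed; case: ifP => _ /eqP.
  rewrite -addrA -[X in _ == X]addr0 (inj_eq (addrI _)) -opprD oppr_eq0 => /eqP e.
  by case/eqP: pv; apply: double_inj; rewrite e addr0.
rewrite -addrA -opprD eq_sym eqr_oppLR opprB eq_sym subr_eq => /eqP; exact: double_inj.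
Qed.

Section EigenDecomposition.
Variables (k s0 s1 : nat) (V : 'I_(s0 + s1) -> set 'cV[quat R]_n.+1).
Hypotheses (hk : F2_rank Q (2 * k)) (hV : eigen_decomposition F k V).

(** A minimal projection below 1 - sum P i would have one of the V i as its range. *)
Lemma eigen_atoms : exists P : 'I_(s0 + s1) -> A,
  [/\ forall i, atom (P i), forall i, V i = range (P i),
      forall i j, i != j -> P i * P j = 0 & \sum_i P i = 1].
Proof.
have ex i : exists p, atom p /\ V i = range p.
  by have [|p ap e] := @eigenspace_atom (V i); [apply/(eigenP hV); exists i|exists p].
have [P HP] := choice ex; have aP i : atom (P i) := proj1 (HP i).
have VP i : V i = range (P i) := proj2 (HP i).
have orth i j : i != j -> P i * P j = 0.
  move=> nij; case: (atom_orth GP (aP i) (aP j)) => // e.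
  by case/eqP: nij; apply: (eigen_inj hV); rewrite !VP e.
have PP i : P i * P i = P i := proj1 (atom_proj (aP i)).
have PS i : star (P i) = P i := proj2 (atom_proj (aP i)).
have sumP i : P i * \sum_j P j = P i.
  by rewrite mulr_sumr (bigD1 i) //= PP big1 ?addr0 // => j nj; apply: orth; rewrite eq_sym.
exists P; split=> //; apply/eqP; rewrite eq_sym -subr_eq0; apply/negPn/negP => nq.
have sumProj : proj (\sum_j P j).
  split; last by rewrite star_sum; apply: eq_bigr => i _.
  by rewrite {1}mulr_suml; apply: eq_bigr => i _; apply: sumP.
have cq : commutant (1 - \sum_j P j).
  by apply: cmB; [exact: cm1|apply: cm_sum => i; exact: (atom_cm (aP i))].
have [p ap pq] := sub_atom (proj_compl sumProj) cq nq.
have [i ei] := (eigenP hV (range p)).1 (atom_is_eigenspace ap).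
have epi : p = P i by apply: range_inj; [exact: (atom_proj ap)|exact: (atom_proj (aP i))|rewrite -ei VP].
by case/eqP: (atom_neq0 ap); rewrite -pq epi mulrBr mulr1 sumP subrr.
Qed.

(** The type of a cell is read off the dimension of the range of its atom. *)
Lemma cell_type p J : cell G p J ->
  J = 0 <-> exists2 d, quat_dim (range p) d & (2 * d = 2 ^ k)%N.
Proof.
move=> cP; have [f bf] := hk; have [h fK hK] := bf.
have ex e : exists X, inF (pr X) /\ cls F X = f e.
  by have [X FX eX] := cls_onto (f e); exists X.
have [L HL] := choice ex; have FL e : inF (pr (L e)) := proj1 (HL e).
have clsL e : cls F (L e) = f e := proj2 (HL e).
(* the lift of the trivial class must be 1 exactly *)
pose g e := if e == 1%g then 1 else mx (L e).
have Gg e : G (g e).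
  by rewrite /g; case: ifP => _; [exists 1%g; rewrite // inF_1|apply/preimP].
have hM : {morph h : u v / (u * v)%g} by move=> u v; rewrite -{1}(hK u) -{1}(hK v) -gmulfM fK.
have gL e : exists2 Y, mx Y = g e & inF (pr Y) /\ cls F Y = f e.
  rewrite /g; case: eqP => [->|_]; last by exists (L e).
  by exists 1%g; rewrite // cls1 multiplicative1; split=> //; apply: inF_1.
have card_E : #|{ffun 'I_(2 * k) -> sign}|%:R = (2 ^+ k) ^+ 2 :> R.
  by rewrite card_ffun card_bool card_ord natrX mulnC exprM.
have gM x : G x -> exists2 s : {ffun 'I_(2 * k) -> sign} -> {ffun 'I_(2 * k) -> sign},
    bijective s & forall e, exists z, [/\ commutant z, unitary z & x * g e = g (s e) * z].
  case=> X <- FX; exists (fun e => h (cls F X) * e)%g.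
    by exists (fun e => (h (cls F X))^-1 * e)%g => e; rewrite ?mulKg ?mulVKg.
  move=> e; have [Y <- [FY eY]] := gL e; have [Z eZ [FZ clsZ]] := gL (h (cls F X) * e)%g.
  exists (mx (Z^-1 * (X * Y))%g); split.
  - by apply: (cls_eq FZ (inF_M FX FY)).1; rewrite clsZ clsM // eY gmulfM hK.
  - exact: mx_unitary.
  - by rewrite -eZ -!mxM mulKVg.
have g_anti e : e != 1%g -> exists2 x, G x & x * g e = - (g e * x).
  move=> ne; have [Y <- [FY eY]] := gL e.
  have [d /eqP nd] : exists d, quot_form d (cls F Y) <> 1%g.
    apply: contrapT => /forallNP e1; case/eqP: ne; apply: (can_inj fK).
    rewrite multiplicative1 -eY; apply: (quot_form_nondeg maxF) => d.
    by apply: contrapT => /e1.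
  have [X FX eX] := cls_onto d; exists (mx X); first exact/preimP.
  rewrite (quot_formE maxF FX FY) eX; case: (quot_form _ _) nd => // _.
  exact: scaleN1r.
have g1 : g 1%g = 1 by rewrite /g eqxx.
have [d0 dim0] := range_dim (atom_proj (cell_atom cP)).
have trd := range_dim_tr (atom_proj (cell_atom cP)) dim0.
have dim_real := cell_dim_real GP cP Gg g1 gM g_anti.
have dim_complex := cell_dim_complex GP cP Gg g1 gM g_anti.
rewrite card_E in dim_real dim_complex.
split=> [J0|[d dim_d]].
  exists d0 => //; apply/eqP; rewrite -(eqr_nat R) natrX natrM -trd.
  rewrite -(@eqrXn2 _ 2) ?exprn_ge0 ?mulr_ge0 //; last by rewrite trd.
  by rewrite -dim_real // exprMn -natrX.
have trd' := range_dim_tr (atom_proj (cell_atom cP)) dim_d.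
move=> d2; apply: contrapT => /eqP /dim_complex; rewrite trd' => /eqP.
rewrite eqrXn2 ?exprn_ge0 // -natrX eqr_nat => /eqP dk.
by move: d2; rewrite dk -[RHS]mul1n => /eqP; rewrite eqn_pmul2r ?expn_gt0.
Qed.


End EigenDecomposition.

End Decomposition.

(** * The Weyl group *)

Section Lifts.
Local Open Scope quotient_scope.
Variables (R : realType) (n : nat) (F : abelian_subgroup (PSp R n.+1)).
Hypothesis maxF : maximal_abelian F.
Local Notation Sp := (Sp R n.+1).
Local Notation A := (qalgebra R n).
Local Notation pr := (\pi_(gquot (pm1 R n.+1))).
Local Notation inF x := (x \in (F : groupClosed (PSp R n.+1))).
Local Notation Q := (form_quot F).
Local Notation G := (preim F).
Local Notation commutant := (commutant G).
Local Notation cls := (cls F).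
Variables (s0 s1 : nat) (V : 'I_(s0 + s1) -> set 'cV[quat R]_n.+1).
Variables (P J : 'I_(s0 + s1) -> A).
Hypotheses (cP : forall i, cell G (P i) (J i)) (VP : forall i, V i = range (P i)).
Hypotheses (orth : forall i j, i != j -> P i * P j = 0) (P1 : \sum_i P i = 1).
Hypothesis typeP : forall i : 'I_(s0 + s1), (i < s0)%N <-> J i = 0.
Implicit Types (X Y Z : Sp) (c : Q).

Let GP : sign_maximal G := preim_maximal maxF.
Let aP i : atom G (P i) := cell_atom (cP i).
Let PP i : P i * P i = P i := proj1 (atom_proj (aP i)).
Let PS i : star (P i) = P i := proj2 (atom_proj (aP i)).
Let cmPi i : commutant (P i) := atom_cm (aP i).
Let cmJ i : commutant (J i) := cell_cm (cP i).
Let JP i : J i * P i = J i := cell_mul (cP i).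

(** ** Normalised lifts *)

Lemma J_lshift i : J (lshift s1 i) = 0.
Proof. by apply/typeP; rewrite /= ltn_ord. Qed.

Lemma J_rshift j : J (rshift s0 j) != 0.
Proof. by apply/eqP => /typeP; rewrite /= ltnNge leq_addr. Qed.

Lemma sqr_cm X : inF (pr X) -> commutant (mx X * mx X).
Proof.
move=> FX _ [Y <- FY]; rewrite -mulrA (quot_formE maxF FX FY) -scalerAr (mulrA (mx X) (mx Y)).
by rewrite (quot_formE maxF FX FY) -scalerAl scalerA -signr_addb addbb scale1r mulrA.
Qed.

Lemma sqr_unitary X : unitary (mx X * mx X).
Proof. by rewrite -mxM; apply: mx_unitary. Qed.

Lemma real_cell_unitary x i : J i = 0 -> commutant x -> unitary x -> exists e : bool, x * P i = (-1) ^+ e *: P i.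
Proof.
move=> Ji cx [x1 x2]; have [|a [b]] := cell_span (cP i) (cmM cx (cmPi i)).
  by rewrite -mulrA PP.
rewrite Ji scaler0 addr0 => xE.
have : a ^+ 2 *: P i = P i.
  transitivity (x * P i * star (x * P i)).
    by rewrite xE starZ PS -scalerAl -scalerAr PP scalerA.
  rewrite starM PS mulrA -(mulrA x) PP -mulrA -(atom_comm GP (aP i) (cm_star GP cx)).
  by rewrite mulrA x1 mul1r.
move/eqP; rewrite -subr_eq0 -[X in _ - X]scale1r -scalerBl scaler_eq0.
rewrite (negPf (atom_neq0 (aP i))) orbF subr_eq0 sqrf_eq1.
by case/orP => /eqP ea; [exists false|exists true]; rewrite xE ea.
Qed.

(** For normalised X the square of X on V i is the sign given by nu: this is mu_i for
    i < s0 and 1 otherwise. *)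
Definition nu X i : bool := mx X * mx X * P i != P i.

Definition normalised X := forall i, J i != 0 -> mx X * mx X * P i = P i.

Lemma nuP X i : inF (pr X) -> normalised X -> mx X * mx X * P i = (-1) ^+ nu X i *: P i.
Proof.
move=> FX nX; have [J0|/nX e] := eqVneq (J i) 0; last by rewrite /nu e eqxx scale1r.
rewrite /nu; have [e ->] := real_cell_unitary J0 (sqr_cm FX) (sqr_unitary X).
case: e; last by rewrite scale1r eqxx scale1r.
suff -> : (-1) ^+ true *: P i != P i by [].
apply/eqP; rewrite -[X in _ = X]scale1r.
by move/(signZ_inj (a := true) (b := false) (atom_neq0 (aP i))).
Qed.

(** On a block with J i <> 0, the square of a lift is in the unit circle of R + R J i,
    where it has an inverse square root; the product of these roots is in Gamma. *)
Lemma normalised_lift c : exists X, [/\ inF (pr X), cls X = c & normalised X].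
Proof.
have [X FX eX] := cls_onto c.
have ex i : exists z, [/\ commutant z, z * P i = z, z * star z = P i &
    J i != 0 -> z * z * (mx X * mx X * P i) = P i].
  have [J0|J0] := eqVneq (J i) 0; first by exists (P i); split; rewrite ?PS.
  have [z [cz zP zz zX]] := cell_sqrt GP (cP i) J0 (sqr_cm FX) (sqr_unitary X).
  by exists z.
have [w Hw] := choice ex.
have cw i : commutant (w i) by case: (Hw i).
have wP i : w i * P i = w i by case: (Hw i).
have ww i : w i * star (w i) = P i by case: (Hw i).
have Pw i : P i * w i = w i by rewrite -(atom_comm GP (aP i)).
have w'w i : star (w i) * w i = P i.
  rewrite -(cell_commute GP (cP i) (cw i) (cm_star GP (cw i))) //.
  by rewrite -{2}(Pw i) starM PS.
have [WU PW WP] := glue PS orth P1 Pw wP ww w'w.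
have cW : commutant (\sum_i w i) by apply: cm_sum.
have [Z eZ] := unitary_mx WU.
have FZ : inF (pr Z) by apply: cm_inF; rewrite ?eZ.
exists (X * Z)%g; split; first exact: inF_M.
  rewrite clsM // eX; have /(cls_eq1 FZ) -> : commutant (mx Z) by rewrite eZ.
  by rewrite mulg1.
move=> i J0; rewrite mxM eZ; set W := \sum_j w j.
have [_ _ _ /(_ J0) e] := Hw i; rewrite -[RHS]e.
have cww : commutant (w i * w i) by apply: cmM.
have GX : G (mx X) by apply/preimP.
have XW : W * mx X = mx X * W by apply: cW.
transitivity (mx X * mx X * (w i * w i)).
  have -> : mx X * W * (mx X * W) = mx X * mx X * (W * W).
    by rewrite -!mulrA; congr (_ * _); rewrite !mulrA XW.
  have WPi : W * P i = w i := WP i.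
  by rewrite -(mulrA (mx X * mx X)) -(mulrA W) WPi -{1}(Pw i) (mulrA W) WPi.
by rewrite [RHS]mulrA (cww _ (smM GP GX GX)) -[RHS]mulrA -(mulrA (w i)) wP.
Qed.

Lemma nu_class X Y i : inF (pr X) -> inF (pr Y) -> cls X = cls Y -> J i = 0 -> nu X i = nu Y i.
Proof.
move=> FX FY /(cls_eq FX FY) cz J0; set Z := (X^-1 * Y)%g in cz.
have -> : Y = (X * Z)%g by rewrite /Z mulKVg.
have [e Ze] := real_cell_unitary J0 cz (mx_unitary Z).
rewrite /nu; suff -> : mx (X * Z)%g * mx (X * Z)%g * P i = mx X * mx X * P i by [].
have ZX : mx Z * mx X = mx X * mx Z := cz _ ((preimP F X).2 FX).
have -> : mx (X * Z)%g * mx (X * Z)%g = mx X * mx X * (mx Z * mx Z).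
  rewrite (mxM X Z) -(mulrA (mx X) (mx Z)) (mulrA (mx Z) (mx X)) ZX.
  by rewrite -(mulrA (mx X) (mx Z)) (mulrA (mx X) (mx X)).
by rewrite -mulrA -(mulrA (mx Z)) Ze -scalerAr Ze scalerA -signr_addb addbb scale1r.
Qed.

Lemma mu_nu (x : gsub F) X i : pr X = val x -> mu V i x = nu X (lshift s1 i).
Proof.
move=> eX; set i' := lshift s1 i.
have FX : inF (pr X) by rewrite eX; apply: (valP x).
rewrite /mu /nu; case: asboolP => H; apply/esym.
  apply/negbTE; rewrite negbK; apply/eqP/app_ext => v; rewrite !appM.
  by apply: (H X eX); rewrite -/i' VP /range /= -appM PP.
apply/eqP => e; case: H => Y eY v; rewrite -/i' VP /range /= => Pv.
have [b eb] : exists b : bool, mx Y = (-1) ^+ b *: mx X by apply/prP; rewrite eX eY.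
have := congr1 (fun y : A => app y v) e; rewrite !appM Pv => XXv.
by rewrite -[LHS]/(app (mx Y) (app (mx Y) v)) -appM eb -scalerAl -scalerAr scalerA -signr_addb addbb scale1r appM.
Qed.

Lemma quot_mu_nu X i : inF (pr X) -> quot_mu V i (cls X) = nu X (lshift s1 i).
Proof.
move=> FX; rewrite /quot_mu; set Y := repr (val (repr (cls X))).
have FY : inF (pr Y) by rewrite reprK; apply: (valP (repr (cls X))).
have eY : pr Y = val (repr (cls X)) by rewrite reprK.
rewrite (mu_nu i eY); apply: nu_class => //; last exact: J_lshift.
by rewrite (cls_val eY) reprK.
Qed.

Lemma mu_quot (x : gsub F) i : mu V i x = quot_mu V i (\pi_(gquot (form_ker F)) x).
Proof.
have eX : pr (repr (val x)) = val x by rewrite reprK.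
rewrite (mu_nu i eX) -quot_mu_nu; last by rewrite eX; apply: (valP x).
by rewrite (cls_val eX).
Qed.


(** ** Spanning families *)

Lemma cls_ind d (b : 'I_d -> Q) (g : 'I_d -> Sp) (Pr : Sp -> Prop) :
  spans b -> (forall l, inF (pr (g l))) -> (forall l, cls (g l) = b l) ->
  (forall Z, commutant (mx Z) -> Pr Z) ->
  (forall X Y, inF (pr X) -> inF (pr Y) -> Pr X -> Pr Y -> Pr (X * Y)%g) ->
  (forall l, Pr (g l)) -> forall X, inF (pr X) -> Pr X.
Proof.
move=> sb Fg gb Pcm PM Pg X FX.
suff H c : forall Y, inF (pr Y) -> cls Y = c -> Pr Y by apply: (H (cls X)).
move: c; apply: sb => [Y FY /(cls_eq1 FY)/Pcm //|u v Pu Pv Y FY eY|l Y FY eY].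
  have [Z FZ eZ] := cls_onto u; rewrite -[Y](mulKVg Z).
  apply: (PM) => //; [exact/inF_M/FY/inF_V|exact: Pu|apply: Pv; first exact/inF_M/FY/inF_V].
  by rewrite clsM ?inF_V // clsV // eY eZ mulKg.
rewrite -[Y](mulKVg (g l)); apply: PM => //; first exact/inF_M/FY/inF_V.
by apply/Pcm/(cls_eq (Fg l) FY); rewrite gb eY.
Qed.

Lemma generating_lifts d (b : 'I_d -> Q) (g : 'I_d -> Sp) :
  spans b -> (forall l, inF (pr (g l))) -> (forall l, cls (g l) = b l) ->
  generating G (fun l => mx (g l)).
Proof.
move=> sb Fg gb; split=> [l|x xg xcm _ [X <- FX]]; first exact/preimP.
apply: (cls_ind (Pr := fun X => x * mx X = mx X * x) sb Fg gb) FX => //.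
  by move=> Z; apply: xcm.
by move=> Y Z _ _ xY xZ; rewrite (mxM Y Z) mulrA xY -mulrA xZ mulrA.
Qed.

(** The map e |-> m(-, e) is injective on a finite set, hence onto. *)
Lemma form_dual d (f : {multiplicative {ffun 'I_d -> sign} -> Q}) (chi : 'I_d -> bool) :
  bijective f -> exists c, forall l, quot_form (f (delta l)) c = chi l.
Proof.
move=> bf; have [h fK hK] := bf.
pose phi (e : {ffun 'I_d -> sign}) : {ffun 'I_d -> sign} := [ffun l => quot_form (f (delta l)) (f e)].
have phi_inj : injective phi.
  move=> e e' /ffunP ee'; apply: (can_inj fK); apply/eqP; rewrite -divg_eq1; apply/eqP.
  apply: (quot_form_nondeg maxF) => c.
  have f_onto : forall w : Q, exists v, f v = w by move=> w; exists (h w).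
  move: c; apply: (spans_bij (f := f) (@gmulfM _ _ f) (multiplicative1 f) f_onto (@delta_spans d)).
  - by rewrite -(mulg1 1%g) quot_formMl // addbb.
  - by move=> u v eu ev; rewrite quot_formMl // eu ev.
  - move=> l /=; have := ee' l; rewrite !ffunE => e1.
    have qV : quot_form (f (delta l)) (f e')^-1%g = quot_form (f (delta l)) (f e').
      have := quot_formMr maxF (f (delta l)) (f e') (f e')^-1%g.
      rewrite mulgV; have := quot_formMr maxF (f (delta l)) 1%g 1%g; rewrite mulg1 addbb => ->.
      by move: (quot_form (f (delta l)) (f e')^-1%g) (quot_form (f (delta l)) (f e')) => [] [].
    by rewrite quot_formMr // qV e1 addbb.
have [psi _ psiK] := injF_bij phi_inj.
exists (f (psi [ffun l => chi l])) => l.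
by have /ffunP/(_ l) := psiK [ffun l => chi l]; rewrite !ffunE.
Qed.

(** ** Diagonal elements *)

Definition sign_mx (e : 'I_(s0 + s1) -> sign) : A := \sum_i (-1) ^+ (e i : bool) *: P i.

Lemma sign_mx_glue e : [/\ unitary (sign_mx e), forall i, P i * sign_mx e = (-1) ^+ (e i : bool) *: P i
  & forall i, sign_mx e * P i = (-1) ^+ (e i : bool) *: P i].
Proof.
by apply: (glue PS orth P1) => i; rewrite ?starZ ?PS -?scalerAl -?scalerAr ?PP // scalerA -signr_addb addbb scale1r.
Qed.

Lemma sign_mx_cm e : commutant (sign_mx e).
Proof. by apply: cm_sum => i; apply: cmZ. Qed.

Lemma blocks_eq x y : (forall i, x * P i = y * P i) -> x = y.
Proof. by move=> e; rewrite -[x]mulr1 -[y]mulr1 -P1 !mulr_sumr; apply: eq_bigr => i _. Qed.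

Lemma sign_mxM e e' : sign_mx e * sign_mx e' = sign_mx (fun i => e i * e' i)%g.
Proof.
apply: blocks_eq => i; have [_ _ D] := sign_mx_glue e; have [_ _ D'] := sign_mx_glue e'.
have [_ _ ->] := sign_mx_glue (fun i => e i * e' i)%g.
by rewrite -mulrA D' -scalerAr D scalerA -signr_addb addbC.
Qed.

Lemma sign_mx_sqr e : sign_mx e * sign_mx e = 1.
Proof.
rewrite sign_mxM -P1; apply: eq_bigr => i _.
by rewrite (_ : (e i * e i)%g = false) ?scale1r // /mulg /= addbb.
Qed.

Definition sign_sp e : Sp := sval (cid (unitary_mx (let: And3 u _ _ := sign_mx_glue e in u))).

Lemma mx_sign_sp e : mx (sign_sp e) = sign_mx e.
Proof. by rewrite /sign_sp; case: cid. Qed.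

Lemma sign_sp_bf e : pr (sign_sp e) \in bf_pred F.
Proof. by apply/(bfP maxF); rewrite mx_sign_sp sign_mx_sqr; split=> //; apply: sign_mx_cm. Qed.

Lemma bf_sign_mx X : pr X \in bf_pred F -> exists e, mx X = sign_mx e.
Proof.
move=> BX; have [e He] := choice (fun i => bf_atom maxF (aP i) BX).
by exists e; apply: blocks_eq => i; rewrite He; have [_ _ ->] := sign_mx_glue e.
Qed.

Definition sign_bf e : gsub (BF F) := exist _ (pr (sign_sp e)) (sign_sp_bf e).

Lemma sign_spM e e' : sign_sp (fun i => e i * e' i)%g = (sign_sp e * sign_sp e')%g.
Proof. by apply: mx_inj; rewrite mxM !mx_sign_sp sign_mxM. Qed.

Lemma sign_bfM e e' : sign_bf (fun i => e i * e' i)%g = (sign_bf e * sign_bf e')%g.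
Proof. by apply/val_inj; rewrite /= sign_spM prM. Qed.

Lemma sign_bf_onto (x : gsub (BF F)) : exists e, sign_bf e = x.
Proof.
have Bx : pr (repr (val x)) \in bf_pred F by rewrite reprK; apply: (valP x).
have [e he] := bf_sign_mx Bx; exists e; apply/val_inj => /=.
by rewrite -[RHS]reprK; congr (pr _); apply: mx_inj; rewrite mx_sign_sp.
Qed.

Lemma sign_mx_inj e e' : sign_mx e = sign_mx e' -> e = e'.
Proof.
move=> ee'; apply/funext => i; apply: (signZ_inj (atom_neq0 (aP i))).
by have [_ _ <-] := sign_mx_glue e; have [_ _ <-] := sign_mx_glue e'; rewrite ee'.
Qed.

Lemma sign_bf_eq e e' : sign_bf e = sign_bf e' -> exists b : sign, e' = fun i => (b * e i)%g.
Proof.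
move=> /(congr1 val) /= /prP[b]; rewrite !mx_sign_sp => eb; exists b; apply: sign_mx_inj.
rewrite eb /sign_mx scaler_sumr; apply: eq_bigr => i _.
by rewrite scalerA -signr_addb.
Qed.

Lemma diagonalP X e : Defs.diagonal V X e <-> mx X = sign_mx e.
Proof.
split=> [dX|eX i v].
  apply: blocks_eq => i; have [_ _ ->] := sign_mx_glue e; apply: app_ext => v; rewrite appM.
  have := dX i (app (P i) v); rewrite VP /range /= -appM PP => /(_ erefl) H.
  rewrite -[LHS]/(val X *m _)%R H /signed; case: (e i) => /=; rewrite ?scale1r ?scaleN1r ?appN //.
rewrite VP /range /= => Pv; rewrite -[LHS]/(app (mx X) v) -{1}Pv -appM eX.
have [_ _ ->] := sign_mx_glue e; rewrite /signed; case: (e i) => /=; rewrite ?scale1r ?scaleN1r ?appN Pv //.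
Qed.

(** ** Unitaries permuting the blocks *)

Definition block_map (g : 'I_s0 -> 'I_s0) (t : 'I_s1 -> 'I_s1) (i : 'I_(s0 + s1)) : 'I_(s0 + s1) :=
  match split i with inl j => lshift s1 (g j) | inr j => rshift s0 (t j) end.

Lemma block_map_lshift g t i : block_map g t (lshift s1 i) = lshift s1 (g i).
Proof. by rewrite /block_map (unsplitK (inl i)). Qed.
Lemma block_map_rshift g t j : block_map g t (rshift s0 j) = rshift s0 (t j).
Proof. by rewrite /block_map (unsplitK (inr j)). Qed.

Lemma split_ind (Pr : 'I_(s0 + s1) -> Prop) : (forall i, Pr (lshift s1 i)) ->
  (forall j, Pr (rshift s0 j)) -> forall i, Pr i.
Proof. by move=> Pl Prr i; rewrite -(splitK i); case: (split i). Qed.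

Lemma block_map_bij (g : {perm 'I_s0}) (t : {perm 'I_s1}) : bijective (block_map g t).
Proof.
by exists (block_map g^-1%g t^-1%g); apply: split_ind => i;
  rewrite ?block_map_lshift ?block_map_rshift ?permK ?permKV.
Qed.

Lemma permute_coordE (g : {perm 'I_s0}) (e : 'I_(s0 + s1) -> sign) :
  permute_coord g e = e \o block_map g id.
Proof.
apply/funext; apply: split_ind => i; rewrite /= ?block_map_lshift ?block_map_rshift /permute_coord.
  by rewrite (unsplitK (inl i)).
by rewrite (unsplitK (inr i)).
Qed.

Definition permutes X (rho : 'I_(s0 + s1) -> 'I_(s0 + s1)) (eta : 'I_(s0 + s1) -> bool) :=
  (forall i, P i * mx X = mx X * P (rho i)) /\
  (forall i, J i * mx X = (-1) ^+ eta i *: (mx X * J (rho i))).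

Let PJ i : P i * J i = J i.
Proof. by rewrite -(atom_comm GP (aP i) (cmJ i)) JP. Qed.

Lemma permutes_cm X rho eta z : permutes X rho eta -> bijective rho -> commutant z ->
  commutant (mx X * z * star (mx X)).
Proof.
move=> [XP XJ] brho cz; have [u1 u2] := mx_unitary X.
rewrite -[z]mulr1 -P1 (reindex rho) /=; last exact: onW_bij.
rewrite mulr_sumr mulr_sumr mulr_suml; apply: cm_sum => i.
have [|a [b ->]] := cell_span (cP (rho i)) (cmM cz (cmPi (rho i))); first by rewrite -mulrA PP.
rewrite mulrDr mulrDl -!scalerAr -!scalerAl -XP -mulrA u1 mulr1.
apply: cmD; apply: cmZ => //.
have -> : mx X * J (rho i) = (-1) ^+ eta i *: (J i * mx X).
  by rewrite XJ scalerA -signr_addb addbb scale1r.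
by rewrite -scalerAl -mulrA u1 mulr1; apply: cmZ.
Qed.

Lemma permutes_cm_comm X z : permutes X id (fun=> false) -> commutant z -> z * mx X = mx X * z.
Proof.
move=> [XP XJ] cz; rewrite -[z]mulr1 -P1 mulr_sumr mulr_suml mulr_sumr.
apply: eq_bigr => i _.
have [|a [b ->]] := cell_span (cP i) (cmM cz (cmPi i)); first by rewrite -mulrA PP.
by rewrite mulrDr mulrDl -!scalerAr -!scalerAl XP XJ scale1r.
Qed.

Lemma permutes_sign_sp X (sigma : {perm 'I_s0}) eta e : permutes X (block_map sigma id) eta ->
  (X * sign_sp e * X^-1)%g = sign_sp (permute_coord sigma e).
Proof.
move=> [XP _]; apply: mx_inj; rewrite !mxM mxV !mx_sign_sp permute_coordE.
have brho := block_map_bij sigma 1%g.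
have e1 : block_map sigma id = block_map sigma (1%g : {perm 'I_s1}).
  by apply/funext; apply: split_ind => i; rewrite ?block_map_lshift ?block_map_rshift ?perm1.
rewrite {1}/sign_mx (reindex (block_map sigma id)) /=; last by rewrite e1; apply: onW_bij.
rewrite mulr_sumr mulr_suml /sign_mx; apply: eq_bigr => i _.
by rewrite -scalerAr -scalerAl -XP -mulrA (proj1 (mx_unitary X)) mulr1.
Qed.

(** ** The normaliser *)

Section Normaliser.
Variable X : Sp.
Hypothesis NX : pr X \in Defs.normaliser F.

Lemma norm_inF Y : inF (pr Y) -> inF (pr (X * Y * X^-1)%g).
Proof. by move=> FY; rewrite !prM prV; apply: (normaliserP (pr X) maxF).1. Qed.

Lemma norm_inFV Y : inF (pr Y) -> inF (pr (X^-1 * Y * X)%g).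
Proof.
by move=> FY; rewrite !prM prV -mulgA -conjgE; have /asboolP -> := NX.
Qed.

Lemma norm_cm z : commutant z -> commutant (star (mx X) * z * mx X).
Proof.
move=> cz _ [Y <- FY]; have := cz _ ((preimP _ _).2 (norm_inF FY)).
have [u1 u2] := mx_unitary X; rewrite !mxM mxV => e.
apply: (unitary_mulIl (mx_unitary X)); apply: (unitary_mulIr (unitary_star (mx_unitary X))).
rewrite !mulrA u1 mul1r -!mulrA u1 mulr1 !mulrA.
by move: e; rewrite !mulrA => ->.
Qed.

Lemma norm_cmV z : commutant z -> commutant (mx X * z * star (mx X)).
Proof.
move=> cz _ [Y <- FY]; have := cz _ ((preimP _ _).2 (norm_inFV FY)).
have [u1 u2] := mx_unitary X; rewrite !mxM mxV => e.
apply: (unitary_mulIl (unitary_star (mx_unitary X))); apply: (unitary_mulIr (mx_unitary X)).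
rewrite !mulrA u2 mul1r -!mulrA u2 mulr1 !mulrA.
by move: e; rewrite !mulrA => ->.
Qed.

(** X^-1 (P i) X is again a minimal projection, hence one of the P j. *)
Lemma norm_atom i : exists j, P i * mx X = mx X * P j.
Proof.
have [u1 u2] := mx_unitary X; pose q := star (mx X) * P i * mx X.
have Xq : mx X * q = P i * mx X by rewrite /q !mulrA u1 mul1r.
have q0 : q != 0.
  apply: contraNneq (atom_neq0 (aP i)) => q0; apply/eqP.
  by rewrite -[P i]mulr1 -u1 mulrA -Xq q0 mulr0 mul0r.
have qP : proj q.
  split; last by rewrite /q !starM starK PS mulrA.
  by rewrite {1}/q -mulrA Xq mulrA -(mulrA (star (mx X))) PP.
have aq : atom G q.
  split=> //; first exact: norm_cm.
  move=> r [rr rS] cr rq; have cr' := norm_cmV cr.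
  have rE : r = star (mx X) * (mx X * r * star (mx X)) * mx X.
    by rewrite !mulrA u2 mul1r -mulrA u2 mulr1.
  have qX : star (mx X) * P i = q * star (mx X) by rewrite /q -!mulrA u1 mulr1.
  have [||e|e] := atom_min (aP i) _ cr'.
  - split; last by rewrite !starM starK rS mulrA.
    by rewrite -!mulrA (mulrA (star (mx X)) (mx X)) u2 mul1r (mulrA r) rr.
  - by rewrite -!mulrA qX (mulrA r) rq.
  - by left; rewrite rE e mulr0 mul0r.
  - by right; rewrite rE e.
have [j nj] : exists j, q * P j != 0.
  apply: contrapT => /forallNP e; case/eqP: q0; rewrite -[q]mulr1 -P1 mulr_sumr big1 // => j _.
  by apply/eqP/negPn/negP/e.
exists j; rewrite -Xq; case: (atom_orth GP aq (aP j)) => [-> //|e].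
by rewrite e eqxx in nj.
Qed.

(** X^-1 (J i) X is skew in R + R J j, and squares to -1 when J i <> 0: it can only be
    J j or -J j. *)
Lemma norm_cell i : exists j (e : bool), [/\ P i * mx X = mx X * P j,
  J i * mx X = (-1) ^+ e *: (mx X * J j) & (J i == 0) = (J j == 0)].
Proof.
have [u1 u2] := mx_unitary X; have [j XP] := norm_atom i; exists j.
pose K := star (mx X) * J i * mx X.
have XK : mx X * K = J i * mx X by rewrite /K !mulrA u1 mul1r.
have cK : commutant K by apply: norm_cm.
have KP : K * P j = K by rewrite /K -!mulrA -XP (mulrA (J i)) JP.
have KS : star K = - K by rewrite /K !starM starK (cell_skew (cP i)) !mulNr !mulrN mulrA.
have [a [b eK]] := cell_span (cP j) cK KP.
have a0 : a = 0.
  have trJ k : tr (J k) = 0 := cell_tr (cP k).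
  have : a * tr (P j) = 0.
    have := tr_star K; rewrite KS trN eK trD !trZ trJ mulr0 addr0; lra.
  move/eqP; rewrite mulf_eq0 => /orP[/eqP //|].
  by rewrite gt_eqF // tr_proj_gt0 ?(atom_neq0 (aP j)) //; apply: atom_proj (aP j).
rewrite a0 scale0r add0r in eK.
have K0 : (K == 0) = (J i == 0).
  apply/eqP/eqP => [e|e]; last by rewrite /K e mulr0 mul0r.
  by apply: (unitary_mulIr (mx_unitary X)); rewrite mul0r -XK e mulr0.
have [Ji|Ji] := eqVneq (J i) 0.
  suff Jj : J j = 0 by exists false; rewrite Ji Jj mul0r mulr0 scaler0 eqxx.
  pose L := mx X * J j * star (mx X).
  have LX : L * mx X = mx X * J j by rewrite /L -!mulrA u2 mulr1.
  have LP : L * P i = L.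
    have e : star (mx X) * P i = P j * star (mx X).
      by apply: (unitary_mulIl (mx_unitary X)); rewrite !mulrA u1 mul1r -XP -mulrA u1 mulr1.
    by rewrite /L -!mulrA e (mulrA (J j)) JP.
  have LS : star L = - L by rewrite /L !starM starK (cell_skew (cP j)) !mulNr !mulrN mulrA.
  have [a' [b' eL]] := cell_span (cP i) (norm_cmV (cmJ j)) LP.
  have L0 : L = 0.
    move: LS; rewrite -/L in eL; rewrite eL Ji scaler0 addr0 starZ PS => /eqP.
    by rewrite -addr_eq0 -mulr2n -scaler_nat scaler_eq0 pnatr_eq0 => /eqP.
  by apply: (unitary_mulIl (mx_unitary X)); rewrite -LX L0 mul0r mulr0.
have Kn : K != 0 by rewrite K0.
have Jj : J j != 0 by apply: contraNneq Kn => e; rewrite eK e scaler0.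
have KK : K * K = - P j.
  rewrite {1}/K -mulrA XK mulrA -(mulrA (star (mx X))) (cell_sqr (cP i) Ji) mulrN mulNr.
  by rewrite -mulrA XP mulrA u2 mul1r.
have /eqP : b ^+ 2 *: P j = P j.
  by move: KK; rewrite eK -scalerAl -scalerAr scalerA (cell_sqr (cP j) Jj) scalerN => /oppr_inj.
rewrite -subr_eq0 -[X in _ - X]scale1r -scalerBl scaler_eq0.
rewrite (negPf (atom_neq0 (aP j))) orbF subr_eq0 sqrf_eq1 => /orP[] /eqP eb.
  exists false; split; rewrite ?(negPf Jj) //.
  by rewrite -XK eK eb !scale1r.
exists true; split; rewrite ?(negPf Jj) //.
by rewrite -XK eK eb !scaleN1r mulrN.
Qed.

End Normaliser.

Lemma P_inj i j : P i = P j -> i = j.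
Proof.
move=> e; apply: contrapT => /eqP /orth; rewrite e PP => /eqP.
by rewrite (negPf (atom_neq0 (aP j))).
Qed.

Lemma conj_P_inj X i j k : P i * mx X = mx X * P j -> P k * mx X = mx X * P j -> i = k.
Proof.
by move=> ei ek; apply/P_inj/(unitary_mulIr (mx_unitary X)); rewrite ei ek.
Qed.

Definition extend_sign (eps : 'I_s1 -> sign) (i : 'I_(s0 + s1)) : bool :=
  match split i with inl _ => false | inr j => eps j end.

Lemma extend_sign_lshift eps i : extend_sign eps (lshift s1 i) = false.
Proof. by rewrite /extend_sign (unsplitK (inl i)). Qed.
Lemma extend_sign_rshift eps j : extend_sign eps (rshift s0 j) = eps j.
Proof. by rewrite /extend_sign (unsplitK (inr j)). Qed.

Lemma norm_permutes X : pr X \in Defs.normaliser F ->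
  exists (sigma : {perm 'I_s0}) (tau : {perm 'I_s1}) (eps : 'I_s1 -> sign),
    permutes X (block_map sigma tau) (extend_sign eps).
Proof.
move=> NX; have [rho Hrho] := choice (norm_cell NX); have [eta Heta] := choice Hrho.
have XP i : P i * mx X = mx X * P (rho i) by case: (Heta i).
have XJ i : J i * mx X = (-1) ^+ eta i *: (mx X * J (rho i)) by case: (Heta i).
have Xtype i : (J i == 0) = (J (rho i) == 0) by case: (Heta i).
have rho_inj : injective rho.
  by move=> i k e; apply: (@conj_P_inj X i (rho i) k) => //; rewrite e.
have exl i : exists i', rho (lshift s1 i) = lshift s1 i'.
  have := Xtype (lshift s1 i); rewrite J_lshift eqxx; move: (rho _).
  by apply: split_ind => [i' _|j]; [exists i'|rewrite (negPf (J_rshift j))].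
have exr j : exists j', rho (rshift s0 j) = rshift s0 j'.
  have := Xtype (rshift s0 j); rewrite (negPf (J_rshift j)); move: (rho _).
  by apply: split_ind => [i'|j' _]; [rewrite J_lshift eqxx|exists j'].
have [g gE] := choice exl; have [t tE] := choice exr.
have g_inj : injective g by move=> i i' e; apply/(@lshift_inj s0 s1)/rho_inj; rewrite !gE e.
have t_inj : injective t by move=> i i' e; apply/(@rshift_inj s0 s1)/rho_inj; rewrite !tE e.
exists (perm g_inj), (perm t_inj), (fun j => eta (rshift s0 j)).
split; apply: split_ind => i.
- by rewrite block_map_lshift permE XP gE.
- by rewrite block_map_rshift permE XP tE.
- by rewrite block_map_lshift !J_lshift mul0r mulr0 scaler0.
- by rewrite block_map_rshift permE extend_sign_rshift XJ tE.
Qed.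

(** ** The action of S_mu on B_F *)

Lemma sign_bf_const (b : sign) e : sign_bf (fun i => b * e i)%g = sign_bf e.
Proof.
apply/val_inj => /=; apply/prP; exists b; rewrite !mx_sign_sp /sign_mx scaler_sumr.
by apply: eq_bigr => i _; rewrite scalerA -signr_addb /mulg /= addbA addbb.
Qed.

(** Coordinates of x as a sum of the +-P i: defined up to a global sign. *)
Definition coord (x : gsub (BF F)) := sval (cid (sign_bf_onto x)).
Lemma coordK x : sign_bf (coord x) = x. Proof. by rewrite /coord; case: cid. Qed.

Definition bf_act (sigma : S_mu F V) (x : gsub (BF F)) : gsub (BF F) :=
  sign_bf (permute_coord (val sigma) (coord x)).

Lemma bf_actE sigma e : bf_act sigma (sign_bf e) = sign_bf (permute_coord (val sigma) e).
Proof.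
have [b eb] := sign_bf_eq (coordK (sign_bf e)); rewrite /bf_act [in RHS]eb !permute_coordE.
exact/esym/(sign_bf_const b (coord (sign_bf e) \o block_map (val sigma) id)).
Qed.

Lemma bf_act_morph sigma : {morph bf_act sigma : x y / (x * y)%g}.
Proof.
move=> x y; rewrite -(coordK x) -(coordK y) -sign_bfM !bf_actE -sign_bfM; congr sign_bf.
by rewrite !permute_coordE.
Qed.

Lemma bf_act1 x : bf_act 1%g x = x.
Proof.
rewrite -[in LHS](coordK x) bf_actE permute_coordE -[RHS]coordK; congr sign_bf.
apply/funext; apply: split_ind => i; rewrite /= ?block_map_lshift ?block_map_rshift //.
by rewrite perm1.
Qed.

Lemma bf_actM sigma tau x : bf_act (sigma * tau)%g x = bf_act sigma (bf_act tau x).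
Proof.
rewrite -[in LHS](coordK x) bf_actE -[x in RHS]coordK !bf_actE !permute_coordE; congr sign_bf.
apply/funext; apply: split_ind => i; rewrite /= ?block_map_lshift ?block_map_rshift //.
by rewrite permM.
Qed.

Definition bf_action : gaction (S_mu F V) (gsub (BF F)) :=
  GAction bf_act_morph bf_act1 bf_actM.

Lemma bf_action_permutes : permutes_coordinates bf_action.
Proof.
move=> sigma x X e eX /diagonalP eD; exists (sign_sp (permute_coord (val sigma) e)); last first.
  by apply/diagonalP; rewrite mx_sign_sp.
have -> : x = sign_bf e by apply/val_inj; rewrite -eX /=; congr (pr _); apply: mx_inj; rewrite mx_sign_sp.
by rewrite -[bf_action _ _]/(bf_act sigma (sign_bf e)) bf_actE.
Qed.

Lemma bf_actP X (sigma : S_mu F V) eta x : permutes X (block_map (val sigma) id) eta ->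
  (pr X * val x * (pr X)^-1)%g = val (bf_act sigma x).
Proof.
move=> /permutes_sign_sp Xd; rewrite -(coordK x) bf_actE /= -Xd.
by rewrite !prM prV.
Qed.

(** ** The two correspondences *)

Variables (d : nat) (f : {multiplicative {ffun 'I_d -> sign} -> Q}).
Hypothesis bf : bijective f.
Variable g : 'I_d -> Sp.
Local Notation b l := (f (delta l)).
Hypotheses (Fg : forall l, inF (pr (g l))) (gb : forall l, cls (g l) = b l)
  (gn : forall l, normalised (g l)).

Lemma basis_spans : spans (fun l => b l).
Proof.
have [h fK hK] := bf.
apply: (spans_bij (f := f) (@gmulfM _ _ f) (multiplicative1 f)); last exact: delta_spans.
by move=> w; exists (h w).
Qed.

Lemma conj_normalised X Y i j : P i * mx X = mx X * P j -> nu (X * Y * X^-1)%g i = nu Y j.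
Proof.
move=> XP; have [u1 u2] := mx_unitary X; rewrite /nu.
have e : mx (X * Y * X^-1)%g * mx (X * Y * X^-1)%g * P i = mx X * (mx Y * mx Y * P j) * star (mx X).
  have XP' : star (mx X) * P i = P j * star (mx X).
    by apply: (unitary_mulIl (mx_unitary X)); rewrite !mulrA u1 mul1r -XP -mulrA u1 mulr1.
  rewrite !mxM mxV -!mulrA XP' (mulrA (star (mx X)) (mx X)) u2 mul1r //.
rewrite e; congr (~~ _); apply/eqP/eqP => [e'|->].
  apply: (unitary_mulIl (mx_unitary X)); apply: (unitary_mulIr (unitary_star (mx_unitary X))).
  by rewrite e' -XP -mulrA u1 mulr1.
by rewrite -XP -mulrA u1 mulr1.
Qed.

(** The g l are fixed, so that S_mu can be lifted to the unitaries commuting with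
    them: this is what splits the kernel as a semidirect product. *)
Definition corr_hom X (phi : ghom Q (BF F)) (sigma : S_mu F V) :=
  permutes X (block_map (val sigma) id) (fun=> false) /\
  forall l, pr (X * g l * X^-1)%g = (val (val phi (b l)) * pr (g l))%g.

(** The action of X on the lines R (J j) is a signed permutation. *)
Definition corr_aut X (h : Q -> Q) (eps : {ffun 'I_s1 -> sign}) (tau : {perm 'I_s1}) :=
  (forall Y, inF (pr Y) -> cls (X * Y * X^-1)%g = h (cls Y)) /\
  (forall j, J (rshift s0 j) * mx X = (-1) ^+ (eps j : bool) *: (mx X * J (rshift s0 (tau j)))).

Lemma block_map_id_bij (sigma : {perm 'I_s0}) : bijective (block_map sigma id).
Proof.
have -> : block_map sigma id = block_map sigma (1%g : {perm 'I_s1}); last exact: block_map_bij.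
by apply/funext; apply: split_ind => i; rewrite ?block_map_lshift ?block_map_rshift ?perm1.
Qed.

Lemma bf_in_F (x : gsub (BF F)) : inF (val x).
Proof. by have /asboolP[[y <- _] _] := valP x; apply: (valP y). Qed.

Lemma bf_cls X (x : gsub (BF F)) : pr X = val x -> commutant (mx X).
Proof. by move=> eX; have := valP x; rewrite -eX => /(bfP maxF)[]. Qed.

Lemma conjM X Y Z : (X * (Y * Z) * X^-1 = X * Y * X^-1 * (X * Z * X^-1))%g.
Proof. by rewrite !mulgA mulgKV. Qed.

Lemma norm_intro X (h : Q -> Q) rho eta : permutes X rho eta -> bijective rho ->
  {morph h : u v / (u * v)%g} -> h 1%g = 1%g ->
  (forall l, inF (pr (X * g l * X^-1)%g)) -> (forall l, cls (X * g l * X^-1)%g = h (b l)) ->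
  pr X \in Defs.normaliser F /\ forall Y, inF (pr Y) -> cls (X * Y * X^-1)%g = h (cls Y).
Proof.
move=> pX brho hM h1 FX clsX.
have H Y : inF (pr Y) -> inF (pr (X * Y * X^-1)%g) /\ cls (X * Y * X^-1)%g = h (cls Y).
  move: Y; apply: (cls_ind basis_spans Fg gb) => [Z cZ|Y Z FY FZ [FY' eY] [FZ' eZ]|l].
  - have c : commutant (mx (X * Z * X^-1)%g) by apply: (permutes_cm pX brho cZ).
    have FZ := cm_inF maxF cZ; split; first exact: (cm_inF maxF c).
    by rewrite ((cls_eq1 (cm_inF maxF c)).2 c) ((cls_eq1 FZ).2 cZ).
  - rewrite conjM; split; first exact: inF_M.
    by rewrite (clsM FY' FZ') (clsM FY FZ) eY eZ hM.
  - by rewrite clsX gb.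
split=> [|Y /H[] //]; apply/(normaliserP _ maxF); elim/gquot_ind => Y /H[].
by rewrite !prM prV.
Qed.

Lemma corr_hom_norm X phi sigma : corr_hom X phi sigma ->
  pr X \in Defs.normaliser F /\ corr_aut X id 1%g 1%g.
Proof.
move=> [pX Xg]; have cg l : exists2 Z, commutant (mx Z) & pr (X * g l * X^-1)%g = pr (Z * g l)%g.
  exists (repr (val (val phi (b l)))); first by apply: (bf_cls (x := val phi (b l))); rewrite reprK.
  by rewrite Xg prM reprK.
have FX l : inF (pr (X * g l * X^-1)%g).
  by have [Z cZ ->] := cg l; apply: inF_M => //; apply: cm_inF.
have [] := norm_intro (h := id) pX (block_map_id_bij _) _ _ FX _; [by []|by []| |].
  move=> l; have [Z cZ e] := cg l; have FZ := cm_inF maxF cZ.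
  rewrite /cls e -[LHS]/(cls (Z * g l)%g) clsM // gb.
  by rewrite ((cls_eq1 FZ).2 cZ) mul1g.
move=> NX clsX; split=> //; split=> // j.
have := proj2 pX (rshift s0 j); rewrite block_map_rshift perm1 ffunE; exact.
Qed.

(** X Y g Y^-1 X^-1 = (X psi X^-1) phi g, and conjugation by X permutes the
    coordinates of psi by sigma. *)
Lemma corr_homM X Y phi psi sigma tau : corr_hom X phi sigma -> corr_hom Y psi tau ->
  corr_hom (X * Y)%g (phi * hom_act bf_action sigma psi)%g (sigma * tau)%g.
Proof.
move=> [[XP XJ] Xg] [[YP YJ] Yg]; split.
  have st : block_map (val (sigma * tau)%g) id = block_map (val tau) id \o block_map (val sigma) id.
    by apply/funext; apply: split_ind => i; rewrite /= ?block_map_lshift ?block_map_rshift ?permM.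
  split=> i; rewrite mxM st; first by rewrite mulrA XP -mulrA YP mulrA.
  by rewrite mulrA XJ scale1r -mulrA YJ !scale1r mulrA.
move=> l; transitivity (pr X * (val (val psi (b l)) * pr (g l)) * (pr X)^-1)%g.
  by rewrite -Yg -prV -!prM; congr (pr _); rewrite invgM !mulgA.
have -> (x y z : PSp R n.+1) : (z * (x * y) * z^-1 = (z * x * z^-1) * (z * y * z^-1))%g.
  by rewrite !mulgA mulgKV.
rewrite (bf_actP (sigma := sigma) (eta := fun=> false)) //.
have := Xg l; rewrite !prM prV => ->; rewrite mulgA; congr (_ * _)%g.
exact: (abgC (bf_in_F _) (bf_in_F _)).
Qed.

Lemma corr_autM X Y h h' eps eps' tau tau' : pr Y \in Defs.normaliser F ->
  corr_aut X h eps tau -> corr_aut Y h' eps' tau' ->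
  corr_aut (X * Y)%g (h \o h') (eps * sign_act tau eps')%g (tau * tau')%g.
Proof.
move=> NY [Xc XJ] [Yc YJ]; split=> [Z FZ|j] /=.
  have -> : (X * Y * Z * (X * Y)^-1 = X * (Y * Z * Y^-1) * X^-1)%g by rewrite invgM !mulgA.
  by rewrite Xc ?Yc //; apply: norm_inF.
rewrite mxM mulrA XJ -scalerAl -mulrA YJ -scalerAr scalerA -signr_addb permM mulrA.
by rewrite !ffunE.
Qed.

Lemma corr_aut_fun X Y h h' eps eps' tau tau' : pr X = pr Y ->
  corr_aut X h eps tau -> corr_aut Y h' eps' tau' -> [/\ h = h', eps = eps' & tau = tau'].
Proof.
move=> eXY [Xc XJ] [Yc YJ]; have [e eY] := (prP X Y).1 eXY.
have H j : (-1) ^+ (eps j : bool) *: J (rshift s0 (tau j)) =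
    (-1) ^+ (eps' j : bool) *: J (rshift s0 (tau' j)).
  apply: (unitary_mulIl (mx_unitary X)); rewrite -!scalerAr -XJ.
  have := YJ j; rewrite eY -scalerAr -scalerAl scalerA mulrC -scalerA.
  by move/(scalerI (negbT (signr_eq0 R e))).
have tj j : tau j = tau' j.
  apply: contrapT => /eqP nt; have nt' : rshift s0 (tau j) != rshift s0 (tau' j) by rewrite (inj_eq (@rshift_inj s0 s1)).
  have := congr1 (fun x : A => P (rshift s0 (tau j)) * x) (H j).
  rewrite /= -!scalerAr PJ -(PJ (rshift s0 (tau' j))) mulrA orth // mul0r scaler0 => /eqP.
  by rewrite scaler_eq0 signr_eq0 (negPf (J_rshift _)).
split; last exact/permP.
  apply/funext => c; have [Z FZ <-] := cls_onto c.
  by rewrite -Xc // -Yc // /cls !prM !prV eXY.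
apply/ffunP => j; have := H j; rewrite tj; exact: (signZ_inj (J_rshift _)).
Qed.


Lemma norm_cls X Y Z : pr X \in Defs.normaliser F -> inF (pr Y) -> inF (pr Z) ->
  cls Y = cls Z -> cls (X * Y * X^-1)%g = cls (X * Z * X^-1)%g.
Proof.
move=> NX FY FZ /(cls_eq FY FZ) cYZ; apply/cls_eq; try exact: norm_inF.
have -> : ((X * Y * X^-1)^-1 * (X * Z * X^-1) = X * (Y^-1 * Z) * X^-1)%g.
  by rewrite !invgM invgK !mulgA mulgKV.
exact: (norm_cmV NX cYZ).
Qed.

Lemma conj_form X Y Z : pr X \in Defs.normaliser F -> inF (pr Y) -> inF (pr Z) ->
  quot_form (cls (X * Y * X^-1)%g) (cls (X * Z * X^-1)%g) = quot_form (cls Y) (cls Z).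
Proof.
move=> NX FY FZ; have FY' := norm_inF NX FY; have FZ' := norm_inF NX FZ.
apply: (signZ_inj (mx_neq0 ((X * Z * X^-1) * (X * Y * X^-1))%g)).
rewrite mxM -(quot_formE maxF FY' FZ') -!mxM -!conjM !mxM (quot_formE maxF FY FZ).
by rewrite -scalerAr -scalerAl.
Qed.

(** If X maps block i to block sigma i then g and X g X^-1 have the same square on
    these blocks, which is the compatibility with mu. *)
Lemma corr_aut_total X : pr X \in Defs.normaliser F ->
  exists (h : Aut_mu F V) eps tau, corr_aut X (aut_fun (val h)) eps tau.
Proof.
move=> NX; have NX' : pr X^-1%g \in Defs.normaliser F by rewrite prV gpredVr.
have [sigma [tau [eps [XP XJ]]]] := norm_permutes NX.
have ex c : exists Y, inF (pr Y) /\ cls Y = c by have [Y FY eY] := cls_onto c; exists Y.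
have [L FL] := choice ex; have FLc c : inF (pr (L c)) := proj1 (FL c).
have cL c : cls (L c) = c := proj2 (FL c).
pose h c := cls (X * L c * X^-1)%g; pose h' c := cls (X^-1 * L c * X^-1^-1)%g.
have hE Y : inF (pr Y) -> cls (X * Y * X^-1)%g = h (cls Y).
  by move=> FY; apply: norm_cls.
have h'E Y : inF (pr Y) -> cls (X^-1 * Y * X^-1^-1)%g = h' (cls Y).
  by move=> FY; apply: norm_cls.
have hK : cancel h h'.
  by move=> c; rewrite -h'E ?norm_inF // invgK !mulgA mulVg mul1g mulgKV cL.
have h'K : cancel h' h.
  by move=> c; rewrite -hE ?norm_inF // invgK !mulgA mulgV mul1g mulgK cL.
have hM : {morph h : u v / (u * v)%g}.
  move=> u v; rewrite -[in LHS](cL u) -[in LHS](cL v) -clsM // -hE ?inF_M // conjM.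
  by rewrite clsM ?norm_inF.
have autP : aut_pred (h, h') by apply/asboolP.
have muP : (exist (@aut_pred Q) (h, h') autP : gaut Q) \in autmu_pred V.
  apply/asboolP; split=> [c e|]; first by have := conj_form NX (FLc c) (FLc e); rewrite !cL.
  exists sigma^-1%g => i c.
  rewrite -[aut_fun _ c]/(cls (X * L c * X^-1)%g) -[c in RHS]cL.
  rewrite (quot_mu_nu _ (norm_inF NX (FLc c))) (quot_mu_nu _ (FLc c)).
  have := XP (lshift s1 (sigma^-1%g i)); rewrite block_map_lshift permKV; exact: conj_normalised.
exists (exist (fun x => x \in autmu_pred V) _ muP), [ffun j => eps j], tau.
split=> [|j]; first exact: hE.
by have := XJ (rshift s0 j); rewrite block_map_rshift extend_sign_rshift ffunE.
Qed.

(** [realization] for Gamma: an automorphism of F/ker m preserving m and compatible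
    with mu preserves commutators and squares of normalised lifts. *)
Lemma realize (h : Q -> Q) (g' : 'I_d -> Sp) (sigma : {perm 'I_s0}) (tau : {perm 'I_s1}) eps :
  {morph h : u v / (u * v)%g} -> h 1%g = 1%g -> (forall c, exists c', h c' = c) ->
  (forall c c', quot_form (h c) (h c') = quot_form c c') ->
  (forall i c, quot_mu V i (h c) = quot_mu V (sigma i) c) ->
  (forall l, inF (pr (g' l))) -> (forall l, cls (g' l) = h (b l)) -> (forall l, normalised (g' l)) ->
  exists X, permutes X (block_map sigma tau) (extend_sign eps) /\ forall l, (X * g l * X^-1)%g = g' l.
Proof.
move=> hM h1 h_onto h_form h_mu Fg' g'b g'n; have brho := block_map_bij sigma tau.
have gen := generating_lifts basis_spans Fg gb.
have gen' := generating_lifts (spans_bij hM h1 h_onto basis_spans) Fg' g'b.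
have same l k (e : bool) : mx (g l) * mx (g k) = (-1) ^+ e *: (mx (g k) * mx (g l)) ->
    mx (g' l) * mx (g' k) = (-1) ^+ e *: (mx (g' k) * mx (g' l)).
  rewrite (quot_formE maxF (Fg l) (Fg k)) (quot_formE maxF (Fg' l) (Fg' k)) !g'b h_form !gb.
  by rewrite -mxM => /(signZ_inj (mx_neq0 _)) ->.
have dual (chi : 'I_d -> bool) : exists2 y, G y & forall l, mx (g l) * y = (-1) ^+ chi l *: (y * mx (g l)).
  have [c cE] := form_dual chi bf; have [Y FY eY] := cls_onto c.
  exists (mx Y) => [|l]; first exact/preimP.
  by rewrite (quot_formE maxF (Fg l) FY) gb eY cE.
have nuE i l : nu (g l) (block_map sigma tau i) = nu (g' l) i.
  move: i; apply: split_ind => i; rewrite ?block_map_lshift ?block_map_rshift.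
    by rewrite -!quot_mu_nu // g'b gb h_mu.
  by rewrite /nu gn ?g'n ?J_rshift // !eqxx.
have Jtype i : (J (block_map sigma tau i) == 0) = (J i == 0).
  move: i; apply: split_ind => i; rewrite ?block_map_lshift ?block_map_rshift ?J_lshift //.
  by rewrite !(negPf (J_rshift _)).
have [||x [xU xP xJ xg]] := realization (extend_sign eps) (nu := fun i l => nu (g' l) i)
  GP cP orth P1 brho Jtype gen gen' same dual.
- by move=> i l; rewrite -nuE; apply: (nuP _ (Fg l) (gn l)).
- by move=> i l; apply: (nuP _ (Fg' l) (g'n l)).
have [X eX] := unitary_mx xU; rewrite -eX in xP xJ xg; exists X; split=> // l.
by apply: mx_inj; rewrite mxM mxM mxV xg -mulrA (proj1 (mx_unitary X)) mulr1.
Qed.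


Lemma corr_hom_sigma (sigma : S_mu F V) : exists X, corr_hom X 1%g sigma.
Proof.
have sigmaE i c : quot_mu V i c = quot_mu V (val sigma i) c.
  have [Y FY <-] := cls_onto c; have /asboolP/(_ i) := valP sigma.
  by move/(congr1 (fun m => m (elt FY))); rewrite !(mu_quot (elt FY)) -(cls_elt FY) => ->.
have id_onto c : exists c' : Q, id c' = c by exists c.
have [X [pX Xg]] := @realize id g (val sigma) 1%g (fun=> false) (fun _ _ => erefl) erefl
  id_onto (fun _ _ => erefl) sigmaE Fg gb gn.
exists X; split; last by move=> l; rewrite Xg mul1g.
have -> : block_map (val sigma) id = block_map (val sigma) (1%g : {perm 'I_s1}).
  by apply/funext; apply: split_ind => i; rewrite ?block_map_lshift ?block_map_rshift ?perm1.
by have -> : (fun=> false) = extend_sign (fun=> false) by apply/funext => i; rewrite /extend_sign; case: split.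
Qed.

(** On each block, m being nondegenerate, the signs prescribed by phi are
    commutators with an element of F. *)
Lemma corr_hom_phi (phi : ghom Q (BF F)) : exists X, corr_hom X phi 1%g.
Proof.
have [e he] := choice (fun l => sign_bf_onto (val phi (b l))).
have ex i : exists Y, inF (pr Y) /\ forall l, mx (g l) * mx Y = (-1) ^+ (e l i : bool) *: (mx Y * mx (g l)).
  have [c cE] := form_dual (fun l => e l i : bool) bf; have [Y FY eY] := cls_onto c.
  by exists Y; split=> // l; rewrite (quot_formE maxF (Fg l) FY) gb eY cE.
have [B HB] := choice ex; have FB i : inF (pr (B i)) := proj1 (HB i).
have gB i l : mx (g l) * mx (B i) = (-1) ^+ (e l i : bool) *: (mx (B i) * mx (g l)) := proj2 (HB i) l.
have PB i : P i * mx (B i) = mx (B i) * P i by apply/cmPi/preimP.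
have [||||xU Px xP] := @glue _ _ _ P (fun i => mx (B i) * P i) PS orth P1.
- by move=> i; rewrite mulrA PB -mulrA PP.
- by move=> i; rewrite -mulrA PP.
- by move=> i; rewrite starM PS mulrA -(mulrA (mx (B i))) PP -PB -mulrA (proj1 (mx_unitary (B i))) mulr1.
- by move=> i; rewrite starM PS -mulrA (mulrA (star _)) (proj2 (mx_unitary (B i))) mul1r PP.
have [X eX] := unitary_mx xU; exists X; rewrite -eX in Px xP.
split; first split => i.
- have -> : block_map (val (1%g : S_mu F V)) id i = i.
    by move: i; apply: split_ind => i; rewrite ?block_map_lshift ?block_map_rshift ?perm1.
  by rewrite Px xP.
- have -> : block_map (val (1%g : S_mu F V)) id i = i.
    by move: i; apply: split_ind => i; rewrite ?block_map_lshift ?block_map_rshift ?perm1.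
  rewrite scale1r -{1}JP -mulrA Px -(PJ i) [RHS]mulrA xP -[RHS]mulrA PJ mulrA.
  have -> : J i * mx (B i) = mx (B i) * J i by apply/cmJ/preimP.
  by rewrite -mulrA JP.
move=> l; rewrite -he /= -prM; congr (pr _); apply: mx_inj; rewrite !mxM mxV mx_sign_sp.
apply: (unitary_mulIr (mx_unitary X)); rewrite -mulrA (proj2 (mx_unitary X)) mulr1.
apply: blocks_eq => i; have gP : P i * mx (g l) = mx (g l) * P i by apply/cmPi/preimP.
have BgP : mx (B i) * mx (g l) * P i = P i * (mx (B i) * mx (g l)).
  by rewrite -mulrA -gP mulrA -PB -mulrA.
have [_ _ D] := sign_mx_glue (e l); transitivity (P i * (mx (B i) * mx (g l))).
  by rewrite -(mulrA (mx X)) -gP mulrA xP -mulrA gP mulrA BgP.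
rewrite -[RHS]mulrA xP -[RHS]mulrA (mulrA (mx (g l)) (mx (B i))) gB -scalerAl BgP.
by rewrite -scalerAr (mulrA (sign_mx (e l))) D -scalerAl scalerA -signr_addb addbb scale1r.
Qed.

Lemma corr_hom_total (phi : ghom Q (BF F)) (sigma : S_mu F V) : exists X, corr_hom X phi sigma.
Proof.
have [X cX] := corr_hom_phi phi; have [Y cY] := corr_hom_sigma sigma; exists (X * Y)%g.
have := corr_homM cX cY; rewrite mul1g.
have -> : hom_act bf_action (1%g : S_mu F V) 1%g = 1%g :> ghom Q (BF F).
  by apply/val_inj/funext => c /=; rewrite bf_act1.
by rewrite mulg1.
Qed.

Lemma corr_hom_fun X Y phi psi sigma tau : pr X = pr Y ->
  corr_hom X phi sigma -> corr_hom Y psi tau -> phi = psi /\ sigma = tau.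
Proof.
move=> eXY [[XP XJ] Xg] [[YP YJ] Yg]; split.
  apply/val_inj/funext; apply: basis_spans => [|u v eu ev|l].
  - have hom1 (h : ghom Q (BF F)) : val h 1%g = 1%g.
      have /asboolP hM := valP h; apply: (mulgI (val h 1%g)).
      by rewrite -hM !mulg1.
    by rewrite !hom1.
  - by have /asboolP-> := valP phi; have /asboolP-> := valP psi; rewrite eu ev.
  - by apply/val_inj/(mulIg (pr (g l))); rewrite -Xg -Yg !prM !prV eXY.
apply/val_inj/permP => i; apply/(@lshift_inj s0 s1)/P_inj/(unitary_mulIl (mx_unitary X)).
have := XP (lshift s1 i); rewrite block_map_lshift => <-.
have [e eY] := (prP X Y).1 eXY; have := YP (lshift s1 i).
rewrite block_map_lshift eY -scalerAr -scalerAl => /(scalerI (negbT (signr_eq0 R e))) //.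
Qed.

Lemma corr_hom_cent X : pr X \in Defs.normaliser F ->
  corr_hom X 1%g 1%g <-> forall y, inF y -> (y ^ pr X = y)%g.
Proof.
have block_map1 : block_map (val (1%g : S_mu F V)) id = id.
  by apply/funext; apply: split_ind => i; rewrite ?block_map_lshift ?block_map_rshift ?perm1.
move=> NX; split=> [[]|cX].
  rewrite block_map1 => pX Xg; elim/gquot_ind => Y FY.
  suff H : (pr X * pr Y = pr Y * pr X)%g by rewrite conjgE -H mulKg.
  move: Y FY; apply: (cls_ind basis_spans Fg gb) => [Z cZ|Y Z _ _ eY eZ|l].
  - rewrite -!prM; congr (pr _); apply: mx_inj; rewrite !mxM.
    exact/esym/(permutes_cm_comm pX).
  - by rewrite prM mulgA eY -mulgA eZ mulgA.
  - by have := Xg l; rewrite mul1g !prM prV => {2}<-; rewrite mulgKV.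
have FX : inF (pr X).
  by apply: (maximal_abelian_centraliser maxF) => y Fy; rewrite -[in LHS](cX y Fy) conjgE mulVKg.
have GX : G (mx X) by apply/preimP.
split; first by rewrite block_map1; split=> i; rewrite ?scale1r; [apply: cmPi|apply: cmJ].
by move=> l; rewrite mul1g !prM prV (abgC FX (Fg l)) mulgK.
Qed.


Lemma bf_exponent (x : gsub (BF F)) : (x * x = 1)%g.
Proof.
rewrite -(coordK x); apply/val_inj; rewrite /= -prM.
have -> : (sign_sp (coord x) * sign_sp (coord x) = 1)%g by apply: mx_inj; rewrite mxM mx_sign_sp sign_mx_sqr.
exact: (gquot_pi1 (pm1 R n.+1)).
Qed.

(** If X acts trivially on F/ker m and on the blocks with J i <> 0, then
    X g l X^-1 = z g l with z in the commutant; comparing the squares of the two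
    sides on each block shows both that sigma is in S_mu and that z^2 = 1. *)
Lemma corr_aut_ker X : pr X \in Defs.normaliser F -> corr_aut X id 1%g 1%g ->
  exists phi sigma, corr_hom X phi sigma.
Proof.
move=> NX cX; have [s [tau [eps [XP XJ]]]] := norm_permutes NX.
have cX' : corr_aut X id [ffun j => eps j] tau.
  split=> [Y FY|j]; first by rewrite (proj1 cX).
  by have := XJ (rshift s0 j); rewrite block_map_rshift extend_sign_rshift ffunE.
have [_ eps1 tau1] := corr_aut_fun erefl cX' cX.
have rhoE : block_map s tau = block_map s id.
  by apply/funext; apply: split_ind => i; rewrite ?block_map_lshift ?block_map_rshift // tau1 perm1.
have epsE : extend_sign eps = fun=> false.
  apply/funext; apply: split_ind => i; rewrite ?extend_sign_lshift ?extend_sign_rshift //.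
  by have /ffunP/(_ i) := eps1; rewrite !ffunE.
rewrite rhoE in XP XJ; rewrite epsE in XJ.
have s_nu Y i : inF (pr Y) -> nu Y (lshift s1 (s i)) = nu Y (lshift s1 i).
  move=> FY; have FXY := norm_inF NX FY.
  have XPi := XP (lshift s1 i); rewrite block_map_lshift in XPi.
  rewrite -(conj_normalised Y XPi).
  by apply: nu_class; rewrite ?J_lshift // (proj1 cX).
have s_mu : s \in smu_pred F V.
  apply/asboolP => i; apply/funext => x.
  have eX : pr (repr (val x)) = val x by rewrite reprK.
  by rewrite !(mu_nu _ eX) s_nu // eX; apply: (valP x).
have Z_bf l : pr (X * g l * X^-1 * (g l)^-1)%g \in bf_pred F.
  have Fl := norm_inF NX (Fg l); set Y := (X * g l * X^-1)%g in Fl *.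
  have cY : cls Y = b l by rewrite (proj1 cX) ?gb.
  set Z := (Y * (g l)^-1)%g; have FZ : inF (pr Z) by apply: inF_M => //; apply: inF_V.
  have cZ : commutant (mx Z).
    by apply/(cls_eq1 FZ); rewrite clsM ?inF_V // clsV // cY gb mulgV.
  apply/(bfP maxF); split=> //; apply: blocks_eq => i; rewrite mul1r.
  have Zg : mx Z * mx (g l) = mx Y by rewrite -mxM /Z mulgKV.
  have nuY : nu Y i = nu (g l) i.
    rewrite (conj_normalised (g l) (XP i)); move: i; apply: split_ind => i.
      by rewrite block_map_lshift s_nu.
    by rewrite block_map_rshift.
  have nY : normalised Y.
    move=> k Jk; apply/eqP; rewrite -[_ == _]negbK -/(nu Y k).
    rewrite (conj_normalised (g l) (XP k)) /nu gn ?eqxx //.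
    move: k Jk; apply: split_ind => k; first by rewrite J_lshift eqxx.
    by rewrite block_map_rshift.
  have gZ : mx (g l) * mx Z = mx Z * mx (g l) by apply/esym/cZ/preimP.
  have := nuP i Fl nY; rewrite nuY -Zg.
  have -> : mx Z * mx (g l) * (mx Z * mx (g l)) = mx Z * mx Z * (mx (g l) * mx (g l)).
    by rewrite mulrA -(mulrA (mx Z) (mx (g l))) gZ !mulrA.
  rewrite -mulrA (nuP i (Fg l) (gn l)) -scalerAr.
  by move/(scalerI (negbT (signr_eq0 R _))).
pose y l : gsub (BF F) := exist (fun x => x \in (BF F : groupClosed _)) _ (Z_bf l).
have [phi phiE] := hom_extension y bf bf_exponent.
exists phi, (exist (fun x => x \in smu_pred F V) s s_mu).
split=> [|l]; first by split.
by rewrite phiE /= -prM mulgKV.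
Qed.

Lemma gaut_ext (V' : groupType) (h h' : gaut V') : aut_fun h = aut_fun h' -> h = h'.
Proof.
have /asboolP[hK hK' _] := valP h; have /asboolP[h'K h'K' _] := valP h'.
rewrite /aut_fun => e; apply/val_inj; rewrite [val h]surjective_pairing [val h']surjective_pairing.
by congr pair => //; apply/funext => c; rewrite -{1}(h'K' c) -e hK.
Qed.

Lemma corr_aut_onto (h : Aut_mu F V) (eps : {ffun 'I_s1 -> sign}) (tau : {perm 'I_s1}) :
  exists X, pr X \in Defs.normaliser F /\ corr_aut X (aut_fun (val h)) eps tau.
Proof.
have /asboolP[h_form [s h_mu]] := valP h; have /asboolP[hK hK' hM] := valP (val h).
set k := aut_fun (val h) in h_form h_mu *.
have k1 : k 1%g = 1%g by apply: (mulgI (k 1%g)); rewrite -hM !mulg1.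
have k_onto c : exists c', k c' = c by exists ((val (val h)).2 c); apply: hK'.
have mu_inv i c : quot_mu V i (k c) = quot_mu V (s^-1%g i) c by rewrite -[RHS]h_mu permKV.
have [g' Hg'] := choice (fun l => normalised_lift (k (b l))).
have Fg' l : inF (pr (g' l)) by case: (Hg' l).
have g'b l : cls (g' l) = k (b l) by case: (Hg' l).
have g'n l : normalised (g' l) by case: (Hg' l).
have [X [pX Xg]] := realize (h := k) tau eps hM k1 k_onto h_form mu_inv Fg' g'b g'n.
have [||NX clsX] := norm_intro pX (block_map_bij _ _) hM k1.
- by move=> l; rewrite Xg.
- by move=> l; rewrite Xg.
exists X; split=> //; split=> // j.
by have := proj2 pX (rshift s0 j); rewrite block_map_rshift extend_sign_rshift.
Qed.

Lemma weyl_exact_sequence :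
  exists (i : {multiplicative semidirect (hom_action Q bf_action) -> weyl_group F})
         (p : {multiplicative weyl_group F -> (Aut_mu F V * semidirect (sign_action s1))%type}),
    short_exact i p.
Proof.
pose T : groupType := gsub (Defs.normaliser F).
pose K : groupType := semidirect (hom_action Q bf_action).
pose S : groupType := (Aut_mu F V * semidirect (sign_action s1))%type.
pose r (k : K) (x : T) := exists2 X, pr X = val x & corr_hom X (sd_left k) (sd_right k).
pose p (x : T) (s : S) :=
  exists2 X, pr X = val x & corr_aut X (aut_fun (val s.1)) (sd_left s.2) (sd_right s.2).
have NT (x : T) X : pr X = val x -> pr X \in Defs.normaliser F.
  by move=> ->; apply: (valP x).
have TN X : pr X \in Defs.normaliser F -> exists x : T, pr X = val x.
  by move=> NX; exists (exist (fun x => x \in Defs.normaliser F) (pr X) NX).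
apply: (@exact_sequence_of_correspondences T (Defs.centraliser F) K S r p).
- move=> k; have [X cX] := corr_hom_total (sd_left k) (sd_right k).
  by have [x eX] := TN X (corr_hom_norm cX).1; exists x, X.
- move=> k k' x x' [X eX cX] [Y eY cY]; exists (X * Y)%g; first by rewrite prM eX eY.
  exact: (corr_homM cX cY).
- move=> x; have eX : pr (repr (val x)) = val x by rewrite reprK.
  split=> [[X eX' cX]|/asboolP cx].
    by apply/asboolP => y; rewrite -eX'; apply: (corr_hom_cent (NT x X eX')).1.
  exists (repr (val x)) => //; apply: (corr_hom_cent (NT x _ eX)).2 => y Fy.
  by rewrite eX; apply: cx.
- move=> [phi sigma] [psi tau] x [X eX cX] [Y eY cY].
  by have [] := corr_hom_fun (etrans eX (esym eY)) cX cY; move=> /= -> ->.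
- move=> x; have eX : pr (repr (val x)) = val x by rewrite reprK.
  have [h [eps [tau cX]]] := corr_aut_total (NT x _ eX).
  by exists (h, Semidirect (sign_action s1) eps tau), (repr (val x)).
- move=> x [h [eps tau]] [h' [eps' tau']] [X eX cX] [Y eY cY].
  have [/gaut_ext/val_inj /= -> e1 e2] := corr_aut_fun (etrans eX (esym eY)) cX cY.
  by move: e1 e2 => /= -> ->.
- move=> x x' s s' [X eX cX] [Y eY cY]; exists (X * Y)%g; first by rewrite prM eX eY.
  exact: (corr_autM (NT _ _ eY) cX cY).
- move=> [h [eps tau]]; have [X [NX cX]] := corr_aut_onto h eps tau.
  by have [x eX] := TN X NX; exists x, X.
move=> x; split=> [[X eX cX]|[k [X eX cX]]].
  have [phi [sigma cX']] := corr_aut_ker (NT x X eX) cX.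
  by exists (Semidirect (hom_action Q bf_action) phi sigma), X.
exists X => //; exact: (corr_hom_norm cX).2.
Qed.

End Lifts.


Local Close Scope ring_scope.

Theorem proposition4p4 (R : realType) (n : nat) (hn : (1 <= n)%N)
    (F : abelian_subgroup (PSp R n)) (hF : maximal_abelian F)
    (k s0 s1 : nat) (hk : F2_rank (form_quot F) (2 * k))
    (V : 'I_(s0 + s1) -> set 'cV[quat R]_n)
    (hV : eigen_decomposition F k V) :
  exists a : gaction (S_mu F V) (gsub (BF F)),
    permutes_coordinates a /\
    exists (i : {multiplicative
                   semidirect (hom_action (form_quot F) a) -> weyl_group F})
           (p : {multiplicative
                   weyl_group F ->
                   (Aut_mu F V * semidirect (sign_action s1))%type}),
      short_exact i p.
Proof.
case: n hn F hF hk V hV => // n _ F hF hk V hV.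
have [P [aP VP orth P1]] := eigen_atoms hF hV.
have [J cP] := choice (fun i => exists_cell (preim_maximal hF) (aP i)).
have typeP (i : 'I_(s0 + s1)) : (i < s0)%N <-> J i = 0%R.
  by rewrite (cell_type hF hk (cP i)) -VP; apply: (eigen_dim hV).
have [f bij_f] := hk.
have [g Hg] := choice (fun l => normalised_lift hF cP orth P1 (f (delta l))).
have Fg l : (\pi_(gquot (pm1 R n.+1)) (g l))%qT \in (F : groupClosed _) by case: (Hg l).
have gb l : cls F (g l) = f (delta l) by case: (Hg l).
have gn l : normalised P J (g l) by case: (Hg l).
exists (bf_action hF V cP orth P1); split; first exact: bf_action_permutes.
exact: (weyl_exact_sequence hF cP VP orth P1 typeP bij_f Fg gb gn).
Qed.
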